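(* Let $\gamma\in(1/2,\infty)$ be non-exceptional. Then there exists a real analytic surface $$M:\ z_2=z_1\bar z_1+\gamma z_1^2+\gamma\bar z_1^2+q(z_1,\bar z_1)$$ in $\mathbb{C}^2$, with $q$ a convergent power series starting with terms of order three, such that $M$ can be mapped by a biholomorphic map defined near $0$ into a real hyperplane of $\mathbb{C}^2$, but there is no biholomorphic map near $0$ transforming $M$ into a surface of the form $$x_2=z_1\bar z_1+(\gamma+\epsilon x_2^s)(z_1^2+\bar z_1^2),\quad y_2=0,$$ where either $\epsilon=0$, or $\epsilon=\pm1$ and $s$ is a positive integer.
   Context: Coordinates on $\mathbb{C}^2$ are $(z_1,z_2)$ with $z_2=x_2+iy_2$. For $\gamma>1/2$ let $\lambda$ be a root of $\gamma\lambda^2-\lambda+\gamma=0$ (so $|\lambda|=1$); $\gamma$ is called exceptional if $\lambda$ is a root of unity. *)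

(* Defs.v *)
(* mathcomp-analysis + real-closed's complex numbers R[i]. *)
From HB Require Import structures.
From mathcomp Require Import all_boot all_order all_algebra.
From mathcomp Require Import all_classical all_reals all_analysis.
From mathcomp Require Import complex.
Set Implicit Arguments. Unset Strict Implicit. Unset Printing Implicit Defensive.
Import Order.TTheory GRing.Theory Num.Theory.
Import numFieldNormedType.Exports.
Local Open Scope classical_set_scope.
Local Open Scope ring_scope.
Local Open Scope complex_scope.

(* The complex numbers C = R[i] over a real type R, seen as a numClosedFieldType
   so that mathcomp-analysis equips it (and C * C) with its normed topology. *)
Definition CC (R : realType) : numClosedFieldType := R[i].

Section Defs.
Variable R : realType.
Local Notation C := (CC R).
Local Notation "x ^*" := (x^*)%C : ring_scope.

(* gamma (real, > 1/2) is exceptional if a root lambda of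
   gamma*lambda^2 - lambda + gamma = 0 is a root of unity *)
Definition exceptional (g : R) : Prop :=
  exists lam : C, (g%:C : C) * lam ^+ 2 - lam + (g%:C : C) = 0 /\
    exists n : nat, (0 < n)%N /\ lam ^+ n = 1.

(* c j k is the coefficient of z^j zbar^k of a power series q(z, zbar);
   it converges near 0 (absolutely, on some polydisc of radius r > 0) *)
Definition conv_pseries2 (c : nat -> nat -> C) : Prop :=
  exists r B : R, 0 < r /\
    forall j k, `|c j k| * ((r%:C : C) ^+ (j + k)) <= (B%:C : C).

(* q starts with terms of order three *)
Definition order_ge3 (c : nat -> nat -> C) : Prop :=
  forall j k, (j + k < 3)%N -> c j k = 0.

(* value q(z, zbar): limit of the square partial sums *)
Definition pseries2_val (c : nat -> nat -> C) (z : C) : C :=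
  lim ((fun N : nat => \sum_(j < N) \sum_(k < N)
          c j k * z ^+ j * (z^*) ^+ k) @ \oo).

(* M : z2 = z1 zbar1 + g z1^2 + g zbar1^2 + q(z1, zbar1) *)
Definition surfM (g : R) (c : nat -> nat -> C) : set (C * C) :=
  [set z | z.2 = z.1 * z.1^* + (g%:C : C) * z.1 ^+ 2 + (g%:C : C) * z.1^* ^+ 2
                 + pseries2_val c z.1].

(* x2 = z1 zbar1 + (g + eps x2^s)(z1^2 + zbar1^2),  y2 = 0 *)
Definition surfN (g eps : R) (s : nat) : set (C * C) :=
  [set z | ((complex.Re z.2)%:C : C) =
              z.1 * z.1^* + (((g + eps * (complex.Re z.2) ^+ s)%:C : C)
                              * (z.1 ^+ 2 + z.1^* ^+ 2))
           /\ complex.Im z.2 = 0].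

(* holomorphic = complex (C-linearly) differentiable, via mathcomp-analysis's
   [differentiable] for normed modules over the scalar field C *)
Definition holo_at (F : C * C -> C * C) (z : C * C) : Prop :=
  @differentiable_def C _ _ F _ (Phantom _ (nbhs z)).

(* F is a biholomorphism from the open neighbourhood U of 0 onto an open set V *)
Definition biholo_on (U : set (C * C)) (F : C * C -> C * C) : Prop :=
  open U /\ U (0, 0) /\
  exists (V : set (C * C)) (G : C * C -> C * C),
    open V /\ (forall z, U z -> V (F z)) /\ (forall w, V w -> U (G w)) /\
    (forall z, U z -> G (F z) = z) /\ (forall w, V w -> F (G w) = w) /\
    (forall z, U z -> holo_at F z) /\ (forall w, V w -> holo_at G w).

(* real hyperplane of C^2 = R^4: {w | Re(a1 w1 + a2 w2) = c}, (a1,a2) <> 0 *)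
Definition real_hyperplane (H : set (C * C)) : Prop :=
  exists (a1 a2 : C) (c : R), (a1 != 0 \/ a2 != 0) /\
    H = [set w | complex.Re (a1 * w.1 + a2 * w.2) = c].
End Defs.

(* Main.v *)
(** Let V z = g z^2 + W z with W a real power series divisible by z^8, and let M be the graph of
    f(z, zbar), f(z, w) = (z w + V z + V w) / (1 - z w). As f is real on w = zbar, M already lies in
    y_2 = 0. The level set f = t is the symmetric correspondence (1 + t) x y + V x + V y = t; near
    the origin it is close to a rotation, hence has closed real orbits x_0, x_1, ..., x_q = x_0 of
    even period q, arbitrarily close to 0. Adding to W, by induction, small polynomials that vanish
    to second order on the earlier orbits, one makes the multiplier of some such orbit in each
    neighbourhood of 0 different from 1.
    A biholomorphic map F from M to a normal form gives F_2(z, f) = conj F_2(w, f) and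
    F_1 conj(F_1) + G(F_2) (F_1^2 + conj(F_1)^2) = F_2 on w = zbar, hence, by the identity theorem,
    for z, w real. On a level of F_2 the normal form reads as a linear recurrence
    a_{i+1} = - G (a_i + a_{i+2}), whose closed orbits all have multiplier 1.
    Comparing the linearizations along a closed orbit of multiplier different from 1 forces the
    derivative of F in the first variable to vanish there, a contradiction. *)

Require Import Defs.
From HB Require Import structures.
From mathcomp Require Import all_boot all_order all_algebra.
From mathcomp Require Import all_classical all_reals all_analysis.
From mathcomp Require Import complex.
From mathcomp Require Import ring lra zify.
Set Implicit Arguments. Unset Strict Implicit. Unset Printing Implicit Defensive.
Import Order.TTheory GRing.Theory Num.Theory.
Import numFieldNormedType.Exports.
Local Open Scope classical_set_scope.
Local Open Scope ring_scope.

(** * Closed orbits of the correspondence *)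

(** The denominator [1 - z * w] supplies a twist. It gives the cross term of the level equation the
    coefficient [1 + t], so the angle of the approximating rotation, whose cosine is
    [- (1 + t) / (2 * g)], moves with the level [t]. For every such [W] an intermediate value
    argument therefore finds closed orbits through the point 0 near the origin. The order eight of
    [W] controls the drift away from the rotation: an orbit of size [r] takes about [r ^ -2] steps,
    and each of them contributes an error of order [r ^ 7].

    All these orbits pass through 0, so two of them can never be separated there. Each perturbation
    therefore vanishes to high order at 0 and acts on the slopes of the new orbit at a single
    nonzero point. This requires that point to be met only once per period. An odd period guarantees
    it, since it excludes orbits that turn back and retrace themselves. Going round twice then gives
    the even period demanded by the alternation of [F] and its conjugate. *)

Section DividedDifference.
Variable R : realType.
Implicit Types (w : {poly R}) (a b : R).

(** Written as a sum of monomials so that it keeps its meaning for [a = b], where it is the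
    derivative. It is what the higher terms leave behind when the difference of two level equations
    is divided by the difference of their end points. *)
Definition divdiff w a b : R :=
  \sum_(j < size w) w`_j * \sum_(i < j) a ^+ (j.-1 - i) * b ^+ i.

(** The divided difference of [X^j] has [j] terms, each with a Lipschitz constant of at most [j]
    times a power of the radius; the square lets one weight bound both its size and its
    variation. *)
Definition coef_weight w : R := \sum_(j < size w) `|w`_j| * j%:R ^+ 2.

Lemma divdiffE w a b : (a - b) * divdiff w a b = w.[a] - w.[b].
Proof.
rewrite /divdiff !horner_coef -sumrB mulr_sumr; apply: eq_bigr => j _.
by rewrite mulrCA -mulrBr -subrXX.
Qed.

Lemma divdiffC w a b : divdiff w a b = divdiff w b a.
Proof.
have [->//|ab] := eqVneq a b; apply: (@mulfI _ (a - b)); first by rewrite subr_eq0.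
by rewrite divdiffE -[a - b]opprB mulNr divdiffE opprB.
Qed.

Lemma divdiff_diag w a : divdiff w a a = w^`().[a].
Proof.
rewrite /divdiff (horner_coef_wide a (_ : (size w^`() <= size w)%N)); last first.
  by rewrite (leq_trans (size_poly _ _))// leq_pred.
case E : (size w) => [|m]; first by rewrite !big_ord0.
rewrite big_ord_recl big_ord0 mulr0 add0r [RHS]big_ord_recr /=.
rewrite coef_deriv nth_default ?E// mul0rn mul0r addr0; apply: eq_bigr => i _.
rewrite coef_deriv /bump /= add1n -mulr_natr -mulrA; congr (_ * _).
under eq_bigr => k _ do rewrite -exprD subnK -1?ltnS//.
by rewrite sumr_const card_ord mulr_natl.
Qed.

Lemma norm_horner_sum_le (n : nat) (a b rho : R) : `|a| <= rho -> `|b| <= rho ->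
  `|\sum_(i < n) a ^+ (n.-1 - i) * b ^+ i| <= n%:R * rho ^+ n.-1.
Proof.
move=> ar br; apply: le_trans (ler_norm_sum _ _ _) _.
apply: (@le_trans _ _ (\sum_(i < n) rho ^+ n.-1)).
  apply: ler_sum => i _; rewrite normrM !normrX.
  have -> : rho ^+ n.-1 = rho ^+ (n.-1 - i) * rho ^+ i.
    by rewrite -exprD subnK// -ltnS (ltn_predK (ltn_ord i)) ltn_ord.
  by apply: ler_pM; rewrite ?exprn_ge0// lerXn2r// nnegrE (le_trans _ ar).
by rewrite sumr_const card_ord mulr_natl.
Qed.

Lemma divdiff_le w a b rho : 'X^8 %| w -> rho <= 1 -> `|a| <= rho -> `|b| <= rho ->
  `|divdiff w a b| <= coef_weight w * rho ^+ 7.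
Proof.
move=> w8 r1 ar br; have r0 : 0 <= rho by exact: le_trans ar.
have wj j : (j < 8)%N -> w`_j = 0.
  by move=> j8; case/dvdpP: w8 => u ->; rewrite coefMXn j8.
apply: le_trans (ler_norm_sum _ _ _) _; rewrite /coef_weight mulr_suml.
apply: ler_sum => j _; have [j8|j8] := ltnP j 8; first by rewrite wj// !(mul0r, normr0).
rewrite normrM -mulrA ler_wpM2l//; apply: le_trans (norm_horner_sum_le _ ar br) _.
have j1 : (1 : R) <= j%:R by rewrite ler1n (leq_trans _ j8).
apply: ler_pM; rewrite ?ler0n ?exprn_ge0//.
  by rewrite expr2 ler_peMl ?ler0n.
by apply: ler_wiXn2l => //; rewrite -ltnS (ltn_predK j8).
Qed.

Lemma divdiff_lipschitz w a b c rho : 'X^8 %| w -> rho <= 1 ->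
  `|a| <= rho -> `|b| <= rho -> `|c| <= rho ->
  `|divdiff w a b - divdiff w a c| <= coef_weight w * rho ^+ 6 * `|b - c|.
Proof.
move=> w8 r1 ar br cr; have r0 : 0 <= rho by exact: le_trans ar.
have wj j : (j < 8)%N -> w`_j = 0.
  by move=> j8; case/dvdpP: w8 => u ->; rewrite coefMXn j8.
rewrite /divdiff -sumrB; apply: le_trans (ler_norm_sum _ _ _) _.
rewrite /coef_weight !mulr_suml.
apply: ler_sum => j _; have [j8|j8] := ltnP j 8; first by rewrite wj// !(mul0r, subrr, normr0).
rewrite -mulrBr normrM -!mulrA ler_wpM2l// -sumrB.
have j0 : (0 < j)%N by exact: leq_trans j8.
apply: le_trans (ler_norm_sum _ _ _) _.
apply: (@le_trans _ _ (\sum_(i < j) j%:R * rho ^+ 6 * `|b - c|)); last first.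
  rewrite sumr_const card_ord -[_ *+ j]mulr_natl le_eqVlt; apply/orP; left; apply/eqP.
  by ring.
apply: ler_sum => i _; rewrite -mulrBr subrXX !normrM normrX mulrCA -[leRHS]mulrC ler_wpM2l//.
have [->|i0] := posnP i.
  by rewrite big_ord0 normr0 mulr0 mulr_ge0 ?exprn_ge0.
apply: le_trans (ler_wpM2l _ (norm_horner_sum_le _ br cr)) _; first by rewrite exprn_ge0.
rewrite mulrCA; apply: ler_pM; rewrite ?ler0n ?mulr_ge0 ?exprn_ge0//.
  by rewrite ler_nat ltnW.
apply: (@le_trans _ _ (rho ^+ (j.-1 - i) * rho ^+ i.-1)).
  by rewrite ler_wpM2r ?exprn_ge0// lerXn2r// nnegrE.
rewrite -exprD; apply: ler_wiXn2l => //; have := ltn_ord i; lia.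
Qed.

End DividedDifference.

(** * Angles whose sine is small, and their multiples *)

Section Trigonometry.
Variable R : realType.
Implicit Types (x y e : R) (n : nat).

Lemma sin_muln_le n x : `|sin (n%:R * x)| <= n%:R * `|sin x|.
Proof.
elim: n => [|n IH]; first by rewrite !mul0r sin0 normr0.
rewrite -natr1 !mulrDl !mul1r sinD; apply: le_trans (ler_normD _ _) _; rewrite lerD//.
  by rewrite normrM; apply: le_trans IH; rewrite ler_piMr// cos_max.
by rewrite normrM ler_piMl// cos_max.
Qed.

(** By the half-angle identity [1 - cos y = 2 * sin (y / 2) ^+ 2] this is the square of
    [sin_muln_le]. *)
Lemma one_minus_cos_muln n x : 1 - cos (n%:R * x) <= n%:R ^+ 2 * (1 - cos x).
Proof.
have h y : 1 - cos y = 2 * `|sin (y / 2)| ^+ 2.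
  rewrite real_normK ?num_real// sin2cos2 {1}(splitr y) cosD -!expr2 sin2cos2; ring.
rewrite !h [leRHS]mulrCA ler_pM2l// -exprMn lerXn2r ?nnegrE ?mulr_ge0//.
by rewrite -mulrA sin_muln_le.
Qed.

(** For [0 <= cos x] one has [1 - cos x <= 1 - cos x ^+ 2 <= e ^+ 2], so [1 - cos (n * x)] is at
    most [(n * e) ^+ 2], which is less than 1. *)
Lemma cos_muln_gt0 n x e : `|sin x| <= e -> 0 <= cos x -> n%:R * e < 1 -> 0 < cos (n%:R * x).
Proof.
move=> se c0 ne; have e0 : 0 <= e by exact: le_trans se.
have c1 : 1 - cos x <= e ^+ 2.
  have : `|sin x| ^+ 2 <= e ^+ 2 by rewrite lerXn2r ?nnegrE.
  rewrite real_normK ?num_real// sin2cos2; have := cos_le1 x => q p.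
  have : cos x ^+ 2 <= cos x by rewrite expr2 ler_piMl.
  lra.
have := one_minus_cos_muln n x.
have : n%:R ^+ 2 * (1 - cos x) <= (n%:R * e) ^+ 2 by rewrite exprMn ler_wpM2l ?exprn_ge0.
have : (n%:R * e) ^+ 2 < 1 by rewrite expr_lt1 ?mulr_ge0.
lra.
Qed.

(** A shift of [x] by [pi] reduces this to [cos_muln_gt0]; as [n] is odd, the shift reverses the
    sign of [cos (n * x)]. *)
Lemma cos_muln_lt0 n x e : odd n -> `|sin x| <= e -> cos x <= 0 -> n%:R * e < 1 ->
  cos (n%:R * x) < 0.
Proof.
move=> on se c0 ne.
have := @cos_muln_gt0 n (x + pi) e; rewrite sinDpi normrN cosDpi oppr_ge0 => /(_ se c0 ne).
rewrite mulrDr mulr_natl (_ : n%:R * pi = pi *+ n); last by rewrite mulr_natl.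
by rewrite (alternatingn (@cosDpi R)) -signr_odd on expr1 mulN1r oppr_gt0.
Qed.

Lemma cos_lipschitz x y : `|cos x - cos y| <= `|x - y|.
Proof.
wlog xy : x y / x <= y.
  by move=> H; case: (leP x y) => [|/ltW] /H//; rewrite distrC [`|y - x|]distrC.
have [|z _ e] := @MVT_segment R cos (- sin) x y xy.
  exact/continuous_subspaceT/continuous_cos.
rewrite distrC e normrM [`|x - y|]distrC ler_piMl//= fctE normrN; exact: sin_max.
Qed.

Lemma cos_ge_half x e : `|sin x| <= e -> e <= 2^-1 -> 0 <= cos x -> 2^-1 <= cos x.
Proof.
move=> se e2 c0; have : `|sin x| ^+ 2 <= 2^-1 ^+ 2.
  by rewrite lerXn2r ?nnegrE ?invr_ge0// (le_trans se).
rewrite real_normK ?num_real// sin2cos2 => p; rewrite leNgt; apply/negP => c2.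
have : cos x ^+ 2 < 2^-1 ^+ 2 by rewrite ltrXn2r ?nnegrE ?invr_ge0.
rewrite expr2 in p *; rewrite expr2; lra.
Qed.

End Trigonometry.

Lemma lipschitz_within_continuous (R : realType) (f : R -> R) (a b C : R) : 0 < C ->
  (forall x y, a <= x <= b -> a <= y <= b -> `|f x - f y| <= C * `|x - y|) ->
  {within `[a, b], continuous f}.
Proof.
move=> C0 fC; apply/subspace_continuousP => z /=; rewrite in_itv /= => zab.
apply/cvgrPdist_le => e e0; rewrite near_withinE; near=> y; rewrite /= in_itv /= => yab.
apply: le_trans (fC _ _ zab yab) _.
rewrite -ler_pdivlMl// mulrC; near: y.
by apply/nbhs_normP; exists (e / C); [exact: divr_gt0 | move=> y /= /ltW].
Unshelve. all: by end_near. Qed.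

(** * Orbits on a level, compared with a rotation *)

Section Chains.
Variables (R : realType) (g : R) (v : R -> R) (D : R -> R -> R) (K rho : R).

(** The difference of the level equations at [(x, y)] and [(y, z)], divided by [x - z]. It selects
    the second solution of the level equation in [y], and it still does so at a turning point
    [z = x], where the two level equations coincide and say nothing. *)
Definition chain_step (t x y z : R) : Prop := (1 + t) * y + g * (x + z) + D x z = 0.

Definition on_level (t x y : R) : Prop :=
  (1 + t) * (x * y) + g * (x ^+ 2 + y ^+ 2) + v x + v y = t.

Hypothesis g_gt : 2^-1 < g.
Hypothesis K_ge0 : 0 <= K.
Hypothesis v0 : v 0 = 0.
Hypothesis DE : forall a b, (a - b) * D a b = v a - v b.
Hypothesis DC : forall a b, D a b = D b a.
Hypothesis D_le : forall s a b, s <= 1 -> `|a| <= s -> `|b| <= s -> `|D a b| <= K * s ^+ 7.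
Hypothesis D_lip : forall s a b c, s <= 1 -> `|a| <= s -> `|b| <= s -> `|c| <= s ->
  `|D a b - D a c| <= K * s ^+ 6 * `|b - c|.

Let kap : R := (g - 2^-1) / 8.
Hypothesis rho_gt0 : 0 < rho.
Hypothesis rho_le1 : rho <= 1.
Hypothesis rho_small : K * rho ^+ 6 <= (g - 2^-1) / 8.

Let kap_gt0 : 0 < kap. Proof. by rewrite divr_gt0// subr_gt0. Qed.
Let g_gt0 : 0 < g.
Proof. by apply: lt_trans g_gt; rewrite invr_gt0. Qed.

Let kap_lt : kap <= g / 8.
Proof. by rewrite /kap ler_pM2r// lerBlDr lerDl. Qed.

Lemma D_small s a b : s <= rho -> `|a| <= s -> `|b| <= s -> `|D a b| <= kap * s.
Proof.
move=> sr as_ bs; have s0 : 0 <= s by exact: le_trans as_.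
apply: le_trans (D_le (le_trans sr rho_le1) as_ bs) _.
rewrite exprSr mulrA ler_wpM2r//; apply: le_trans rho_small; rewrite ler_wpM2l//.
by rewrite lerXn2r// nnegrE ltW.
Qed.

Lemma D_lip_small a b c : `|a| <= rho -> `|b| <= rho -> `|c| <= rho ->
  `|D a b - D a c| <= kap * `|b - c|.
Proof.
move=> ar br cr; apply: le_trans (D_lip rho_le1 ar br cr) _.
by rewrite ler_wpM2r.
Qed.

Lemma v_small a : `|a| <= rho -> `|v a| <= kap * a ^+ 2.
Proof.
move=> ar; have -> : v a = a * D a 0 by have := DE a 0; rewrite subr0 v0 subr0.
rewrite normrM -[a ^+ 2]real_normK ?num_real// expr2 mulrCA ler_wpM2l//.
by apply: D_small => //; rewrite normr0.
Qed.

Lemma chain_stepC t x y z : chain_step t x y z -> chain_step t z y x.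
Proof. by rewrite /chain_step DC [x + z]addrC. Qed.

(** As a function of [z] the left side of [chain_step] is [g * z] plus a term with Lipschitz
    constant at most [g / 8], hence injective. *)
Lemma chain_step_unique t x y z z' : `|x| <= rho -> `|z| <= rho -> `|z'| <= rho ->
  chain_step t x y z -> chain_step t x y z' -> z = z'.
Proof.
move=> xr zr zr' s1 s2; apply/eqP; rewrite -subr_eq0 -normr_le0 leNgt; apply/negP => p.
have := D_lip_small xr zr zr'.
have -> : D x z - D x z' = - g * (z - z').
  by move: s1 s2; rewrite /chain_step ; lra.
rewrite normrM normrN ler_pM2r// (ger0_norm (ltW g_gt0)).
by move: kap_lt kap_gt0 g_gt0; lra.
Qed.

Lemma chain_step_level t x y z : chain_step t x y z -> on_level t x y -> on_level t y z.
Proof.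
rewrite /chain_step /on_level => st lv; have := DE z x; rewrite DC => de.
have : (z - x) * ((1 + t) * y + g * (x + z) + D x z) = 0 by rewrite st mulr0.
by move: lv de => lv de e; lra.
Qed.

Lemma level_chain_step t x y z : on_level t x y -> on_level t y z -> x <> z ->
  chain_step t x y z.
Proof.
rewrite /chain_step /on_level => l1 l2 /eqP xz; apply: (@mulfI _ (x - z)); rewrite ?subr_eq0//.
by move: l1 l2 (DE x z); rewrite mulr0; lra.
Qed.

(** This is where [g > 1/2] makes the levels closed ovals: the cross term costs at most
    [(1 + t) / 2] and [v] at most [(g - 1/2) / 8] times [x ^+ 2 + y ^+ 2]. For small [t] more than
    half of the excess [g - 1/2] of the quadratic part is left. *)
Lemma level_bound t x y : 0 <= t -> t <= (g - 2^-1) / 2 -> `|x| <= rho -> `|y| <= rho ->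
  on_level t x y -> (g - 2^-1) / 2 * (x ^+ 2 + y ^+ 2) <= t.
Proof.
move=> t0 tm xr yr lv; have := v_small xr; have := v_small yr; rewrite !ler_norml.
move=> /andP[vy _] /andP[vx _].
have xy : - ((1 + t) / 2 * (x ^+ 2 + y ^+ 2)) <= (1 + t) * (x * y).
  have : 0 <= (1 + t) / 2 * (x + y) ^+ 2 by rewrite mulr_ge0 ?sqr_ge0// divr_ge0// addr_ge0.
  by lra.
have tt : t * (x ^+ 2 + y ^+ 2) <= (g - 2^-1) / 2 * (x ^+ 2 + y ^+ 2).
  by rewrite ler_wpM2r// addr_ge0 ?sqr_ge0.
have pos : 0 <= (g - 2^-1) * (x ^+ 2 + y ^+ 2).
  by apply: mulr_ge0; [move: g_gt; lra | rewrite addr_ge0 ?sqr_ge0].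
move: lv vx vy xy tt pos; rewrite /on_level /kap; set X := x ^+ 2; set Y := y ^+ 2.
nra.
Qed.

(** Intermediate values on [[-10 s, 10 s]]: at the ends [g * z] has size [10 g s], while the other
    terms add up to at most [2 s + g s + (10 / 8) g s], and [2 s < 4 g s] when [s] is positive. *)
Lemma chain_step_exists t x y s : 0 <= t <= 1 -> `|x| <= s -> `|y| <= s -> 10 * s <= rho ->
  exists z, `|z| <= 10 * s /\ chain_step t x y z.
Proof.
move=> /andP[t0 t1] xs ys sr; have s0 : 0 <= s by exact: le_trans xs.
pose h z := (1 + t) * y + g * (x + z) + D x z.
have xr : `|x| <= rho by apply: le_trans xs _; lra.
have hlip z z' : `|z| <= rho -> `|z'| <= rho -> `|h z - h z'| <= (g + kap) * `|z - z'|.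
  move=> zr zr'; rewrite (_ : h z - h z' = g * (z - z') + (D x z - D x z')); last by rewrite /h; ring.
  apply: le_trans (ler_normD _ _) _; rewrite mulrDl lerD ?D_lip_small//.
  by rewrite normrM (ger0_norm (ltW g_gt0)).
have gk : 0 < g + kap by rewrite addr_gt0.
have wh : {within `[- (10 * s), 10 * s], continuous h}.
  apply: (lipschitz_within_continuous gk) => z z'; rewrite -!ler_norml => zs zs'.
  by apply: hlip; [exact: le_trans sr | exact: le_trans sr].
have ten : `|10 * s| = 10 * s by rewrite ger0_norm// mulr_ge0.
have Db z : `|z| <= 10 * s -> `|D x z| <= kap * (10 * s).
  by move=> zs; apply: D_small => //; apply: le_trans xs _; lra.
have y2 : `|(1 + t) * y| <= 2 * s.
  by rewrite normrM ger0_norm; [apply: ler_pM => //; lra | lra].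
have hp : 0 <= h (10 * s).
  have := Db (10 * s); rewrite ten lexx => /(_ isT); move: y2 xs; rewrite !ler_norml /h.
  move=> /andP[? _] /andP[? _] /andP[? _].
  have : 0 <= (g - kap * 8) * s by rewrite mulr_ge0// subr_ge0; move: kap_lt g_gt0; lra.
  have : 0 <= (g - 2^-1) * s by apply: mulr_ge0 => //; rewrite subr_ge0 ltW.
  have : - (g * s) <= g * x by rewrite -mulrN ler_wpM2l ?(ltW g_gt0)//; lra.
  by move=> ? ? ?; lra.
have hn : h (- (10 * s)) <= 0.
  have := Db (- (10 * s)); rewrite normrN ten lexx => /(_ isT); move: y2 xs; rewrite !ler_norml /h.
  move=> /andP[_ ?] /andP[_ ?] /andP[_ ?].
  have : 0 <= (g - kap * 8) * s by rewrite mulr_ge0// subr_ge0; move: kap_lt g_gt0; lra.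
  have : 0 <= (g - 2^-1) * s by apply: mulr_ge0 => //; rewrite subr_ge0 ltW.
  have : g * x <= g * s by rewrite ler_wpM2l ?(ltW g_gt0)//; lra.
  by move=> ? ? ?; lra.
have [||z] := IVT (_ : - (10 * s) <= 10 * s) wh (v := 0); first by lra.
  by rewrite ge_min hn le_max hp orbT.
by rewrite in_itv /= -ler_norml => zs hz; exists z.
Unshelve. all: by end_near. Qed.

(** For a level at most [2 * g * r ^+ 2], [level_bound] gives
    [x ^+ 2 <= 4 * g / (g - 1/2) * r ^+ 2]. This is at most [(C1 * r) ^+ 2] because [C1] is at least
    1. *)
Let C1 : R := 1 + 4 * g / (g - 2^-1).
Variable r1 : R.
Hypothesis r1_rho : 10 * (C1 * r1) <= rho.
Hypothesis r1_le1 : 2 * g * r1 ^+ 2 <= 1.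
Hypothesis r1_small : 2 * g * r1 ^+ 2 <= (g - 2^-1) / 2.

Let m_gt0 : 0 < g - 2^-1. Proof. by rewrite subr_gt0. Qed.

Let C1_ge1 : 1 <= C1.
Proof. by rewrite /C1 lerDl divr_ge0 ?mulr_ge0 ?ltW. Qed.

(** The level of the pair [(0, r)], since [v] vanishes at 0; each chain starts at such a pair. *)
Definition start_level (r : R) : R := g * r ^+ 2 + v r.

Definition is_chain (r : R) (x : nat -> R) : Prop :=
  [/\ x 0%N = 0, x 1%N = r, forall i, `|x i| <= C1 * r,
   forall i, chain_step (start_level r) (x i) (x i.+1) (x i.+2) &
   forall i, on_level (start_level r) (x i) (x i.+1)].

Let r_rho r : 0 < r <= r1 -> 10 * (C1 * r) <= rho.
Proof.
move=> /andP[r0 rr]; apply: le_trans r1_rho; rewrite ler_pM2l// ler_wpM2l//.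
by apply: le_trans C1_ge1; rewrite ler01.
Qed.

Let r_le_rho r : 0 < r <= r1 -> C1 * r <= rho /\ r <= rho.
Proof.
move=> rr; have := r_rho rr; case/andP: rr => r0 _.
have : r <= C1 * r by rewrite ler_peMl// ltW.
by split; lra.
Qed.

Let r2_le r : 0 < r <= r1 -> r ^+ 2 <= r1 ^+ 2.
Proof. by move=> /andP[r0 rr]; rewrite lerXn2r// nnegrE ?(le_trans _ rr)// ltW. Qed.

Lemma start_level_bounds r : 0 < r <= r1 ->
  [/\ g / 2 * r ^+ 2 <= start_level r, start_level r <= 2 * g * r ^+ 2,
   0 < start_level r, start_level r <= 1 & start_level r <= (g - 2^-1) / 2].
Proof.
move=> rr; have [_ rrho] := r_le_rho rr.
have r0 : 0 < r by case/andP: rr.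
have r2 : 0 < r ^+ 2 by rewrite exprn_gt0.
have gr : 2 * g * r ^+ 2 <= 2 * g * r1 ^+ 2 by rewrite ler_wpM2l ?r2_le// mulr_ge0// ltW.
have vr : `|v r| <= g / 8 * r ^+ 2.
  apply: le_trans (v_small _) _; first by rewrite gtr0_norm.
  by rewrite ler_wpM2r// ltW.
have gr2 : 0 < g * r ^+ 2 by rewrite mulr_gt0.
move: vr; rewrite ler_norml /start_level => /andP[v1 v2]; move: r1_le1 r1_small => q1 q2.
split; lra.
Qed.

(** A single step may leave the bound [C1 * r] by a factor of ten. The new pair is still on the
    level, however, and [level_bound] brings it back below [C1 * r], so the iteration never leaves
    the region where steps exist. *)
Lemma chain_exists r : 0 < r <= r1 -> exists x, is_chain r x.
Proof.
move=> rr; have [_ tg t0 t1 tm] := start_level_bounds rr.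
set t := start_level r in tg t0 t1 tm *.
have [crho _] := r_le_rho rr; have r10 := r_rho rr.
have r0 : 0 < r by case/andP: rr.
(* Pairs outside the bounds get the dummy successor 0; the invariant [inv] shows that the chain
   never meets them. *)
have step (p : R * R) : exists z, `|p.1| <= C1 * r -> `|p.2| <= C1 * r ->
    `|z| <= 10 * (C1 * r) /\ chain_step t p.1 p.2 z.
  have [b1|b1] := pselect (`|p.1| <= C1 * r); last by exists 0 => /b1.
  have [b2|b2] := pselect (`|p.2| <= C1 * r); last by exists 0 => _ /b2.
  have [|z zP] := @chain_step_exists t p.1 p.2 (C1 * r) _ b1 b2 r10.
    by rewrite t1 ltW.
  by exists z.
have [next nextP] := choice step.
pose p := fix p n : R * R := if n is n'.+1 then ((p n').2, next (p n')) else (0, r).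
have close x y : `|x| <= rho -> `|y| <= rho -> on_level t x y -> `|x| <= C1 * r /\ `|y| <= C1 * r.
  move=> xr yr lv; have lb := level_bound (ltW t0) tm xr yr lv.
  have sq a : (g - 2^-1) / 2 * a ^+ 2 <= t -> `|a| <= C1 * r.
    move=> at_; rewrite -ler_sqr ?nnegrE ?mulr_ge0 ?(le_trans _ C1_ge1)//; last exact: ltW.
    rewrite real_normK ?num_real// exprMn.
    have m2 : 0 < (g - 2^-1) / 2 by rewrite divr_gt0.
    rewrite -(ler_pM2l m2); apply: le_trans at_ _; apply: le_trans tg _.
    rewrite [leRHS]mulrA ler_wpM2r ?sqr_ge0//.
    apply: (@le_trans _ _ ((g - 2^-1) / 2 * C1)).
      rewrite /C1 mulrDr mulr1 (_ : (g - 2^-1) / 2 * (4 * g / (g - 2^-1)) = 2 * g).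
        by rewrite lerDr ltW.
      by field; rewrite gt_eqF//; move: m_gt0; lra.
    by rewrite (ler_wpM2l (ltW m2))// expr2 ler_peMl// (le_trans _ C1_ge1).
  by split; apply: sq; apply: le_trans lb; apply: ler_wpM2l;
    rewrite ?lerDl ?lerDr ?sqr_ge0// divr_ge0// ltW.
have inv n : [/\ `|(p n).1| <= C1 * r, `|(p n).2| <= C1 * r & on_level t (p n).1 (p n).2].
  elim: n => [|n [i1 i2 i3]] /=.
    split; rewrite ?normr0 ?mulr_ge0 ?(le_trans _ C1_ge1) ?(ltW r0)//.
      by rewrite (gtr0_norm r0) ler_peMl// ltW.
    by rewrite /on_level /t /start_level v0; ring.
  have [z1 z2] := nextP _ i1 i2; have lv := chain_step_level z2 i3.
  by have [||] := close _ _ _ _ lv; [exact: le_trans crho | exact: le_trans r10 | split].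
exists (fun n => (p n).1); split => //.
- by move=> n; have [] := inv n.
- by move=> n /=; have [i1 i2 i3] := inv n; have [_] := nextP _ i1 i2.
- by move=> n /=; have [] := inv n.
Qed.

Lemma start_level_lipschitz r r' : 0 < r <= r1 -> 0 < r' <= r1 ->
  `|start_level r - start_level r'| <= (3 * g + 1) * `|r - r'|.
Proof.
move=> rr rr'.
have [_ rrho] := r_le_rho rr; have [_ rrho'] := r_le_rho rr'.
have r0 : 0 < r by case/andP: rr.
have r0' : 0 < r' by case/andP: rr'.
have -> : start_level r - start_level r' = (g * (r + r') + D r r') * (r - r').
  by have := DE r r'; rewrite /start_level; lra.
rewrite normrM ler_wpM2r//; apply: le_trans (ler_normD _ _) _.
have d1 : `|D r r'| <= kap * rho by apply: D_small; rewrite ?gtr0_norm.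
have d2 : kap * rho <= g / 8.
  by apply: le_trans kap_lt; rewrite ler_piMr// ltW.
rewrite gtr0_norm ?mulr_gt0 ?addr_gt0//.
have : g * (r + r') <= g * 2 by rewrite ler_wpM2l ?(ltW g_gt0)//; move: rho_le1; lra.
by move: g_gt0; lra.
Qed.

(** Serves only to make [x n] continuous in [r] for a fixed [n], so the growth rate may be crude.
    With [3 <= 6 * g], one step enlarges the difference by at most [(1 + 1/8 + 6) / (1 - 1/8)],
    which is below 15. *)
Lemma chain_lipschitz r r' x x' : 0 < r <= r1 -> 0 < r' <= r1 ->
  is_chain r x -> is_chain r' x' ->
  forall i, `|x i - x' i| <= (3 * g + 1) * 15 ^+ i * `|r - r'| /\
            `|x i.+1 - x' i.+1| <= (3 * g + 1) * 15 ^+ i * `|r - r'|.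
Proof.
move=> rr rr' [x0 xr xb xs _] [x0' xr' xb' xs' _].
have [crho rrho] := r_le_rho rr; have [crho' rrho'] := r_le_rho rr'.
have [_ _ t0 t1 _] := start_level_bounds rr; have [_ _ t0' t1' _] := start_level_bounds rr'.
have r0 : 0 < r by case/andP: rr.
have r0' : 0 < r' by case/andP: rr'.
have dt := start_level_lipschitz rr rr'.
set E := (3 * g + 1) * _ in dt.
have E0 : 0 <= E by rewrite mulr_ge0// addr_ge0// mulr_ge0// ltW.
have p15 i : (1 : R) <= 15 ^+ i by rewrite exprn_ege1// ler1n.
suff H i : `|x i - x' i| <= 15 ^+ i * E /\ `|x i.+1 - x' i.+1| <= 15 ^+ i * E.
  by move=> i; rewrite -mulrA [_ ^+ i * _]mulrC mulrA -/E [E * _]mulrC; exact: H.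
elim: i => [|i [IH1 IH2]].
  rewrite x0 x0' xr xr' subrr normr0 expr0 mul1r; split=> //.
  by rewrite /E ler_peMl// lerDr mulr_ge0// ltW.
rewrite exprS -mulrA; set F := 15 ^+ i * E in IH1 IH2 *.
have F0 : 0 <= F by rewrite mulr_ge0// (le_trans _ (p15 i)).
have EF : E <= F by rewrite ler_peMl.
split; first by apply: le_trans IH2 _; lra.
have xrho j : `|x j| <= rho by exact: le_trans crho.
have xrho' j : `|x' j| <= rho by exact: le_trans crho'.
set dx := x i - x' i in IH1; set dy := x i.+1 - x' i.+1 in IH2; set dz := x i.+2 - x' i.+2.
have eq : g * dz = - (g * dx + ((1 + start_level r) * dy + (start_level r - start_level r') * x' i.+1)
    + (D (x i) (x i.+2) - D (x i) (x' i.+2)) + (D (x' i.+2) (x i) - D (x' i.+2) (x' i))).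
  move: (xs i) (xs' i); rewrite /chain_step /dx /dy /dz [D (x' i.+2) (x i)]DC [D (x' i.+2) (x' i)]DC.
  by move=> ? ?; lra.
have k1 : `|D (x i) (x i.+2) - D (x i) (x' i.+2)| <= kap * `|dz| by exact: D_lip_small.
have k2 : `|D (x' i.+2) (x i) - D (x' i.+2) (x' i)| <= kap * `|dx| by exact: D_lip_small.
have k3 : `|(1 + start_level r) * dy| <= 2 * F.
  by rewrite normrM ger0_norm; [apply: ler_pM => //; lra | lra].
have k4 : `|(start_level r - start_level r') * x' i.+1| <= F.
  rewrite normrM -[F]mulr1; apply: ler_pM => //; first by rewrite (le_trans dt).
  exact: le_trans (xrho' _) rho_le1.
have gz : `|g * dz| = g * `|dz| by rewrite normrM (gtr0_norm g_gt0).
have gx : `|g * dx| = g * `|dx| by rewrite normrM (gtr0_norm g_gt0).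
have tri : g * `|dz| <= g * `|dx| + (2 * F + F) + kap * `|dz| + kap * `|dx|.
  rewrite -gz eq normrN -gx.
  do 3 (apply: le_trans (ler_normD _ _) _; apply: lerD => //).
  by apply: le_trans (ler_normD _ _) _; apply: lerD.
have q1 : kap * `|dz| <= g / 8 * `|dz| by rewrite ler_wpM2r.
have q2 : kap * `|dx| <= g / 8 * F by apply: ler_pM => //; rewrite ltW.
have q3 : g * `|dx| <= g * F by rewrite ler_wpM2l// ltW.
have q4 : F <= 2 * g * F by rewrite ler_peMl//; move: g_gt; lra.
rewrite -(ler_pM2l g_gt0); lra.
Qed.

(** Without [D], [chain_step] is the recurrence with [x i.+2 = 2 * cos om * x i.+1 - x i] for this
    angle [om]. *)
Definition rot_angle (t : R) : R := acos (- (1 + t) / (2 * g)).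

Let cos_range t : 0 <= t -> t <= (g - 2^-1) / 2 -> -1 < - (1 + t) / (2 * g) < 1.
Proof.
move=> t0 tm; have g2 : 0 < 2 * g by rewrite mulr_gt0.
rewrite mulNr ltrN2 ltrNl ltr_pdivrMr// mul1r ltr_pdivlMr//.
by apply/andP; split; move: g_gt; lra.
Qed.

Lemma cos_rot_angle t : 0 <= t -> t <= (g - 2^-1) / 2 ->
  cos (rot_angle t) = - (1 + t) / (2 * g).
Proof.
move=> t0 tm; have /andP[? ?] := cos_range t0 tm.
by rewrite /rot_angle acosK// in_itv /= !ltW.
Qed.

Lemma sin_rot_angle_gt0 t : 0 <= t -> t <= (g - 2^-1) / 2 -> 0 < sin (rot_angle t).
Proof.
move=> t0 tm; have /andP[? ?] := cos_range t0 tm; apply: sin_gt0_pi.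
by rewrite /rot_angle acos_gt0 ?acos_ltpi// ?ltW//; apply/andP; split=> //; exact: ltW.
Qed.

(** The unperturbed recurrence rotates the vector with entries [sin om * x n] and
    [x n.+1 - cos om * x n] by the angle [om], starting from [(0, r)]. Testing the deviation against
    all unit vectors [(cos phi, sin phi)] bounds its Euclidean norm. As rotations preserve this
    norm, the errors of the steps merely add up. *)
Lemma chain_rotation r x : 0 < r <= r1 -> is_chain r x ->
  let om := rot_angle (start_level r) in
  forall n phi, `|cos phi * (sin om * x n - r * sin (n%:R * om))
     + sin phi * ((x n.+1 - cos om * x n) - r * cos (n%:R * om))|
  <= n%:R * (K * (C1 * r) ^+ 7 / g).
Proof.
move=> rr [x0 xr xb xs _] om.
have [_ _ t0 t1 tm] := start_level_bounds rr.
have [crho _] := r_le_rho rr.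
have co : cos om = - (1 + start_level r) / (2 * g) by apply: cos_rot_angle => //; exact: ltW.
set eb := K * _ / g; elim=> [|n IH] phi.
  by rewrite x0 xr !mul0r sin0 cos0 !mulr0 subrr mulr0 subr0 mulr1 subrr mulr0 addr0 normr0.
pose e := - D (x n) (x n.+2) / g.
have rec : x n.+2 = 2 * cos om * x n.+1 - x n + e.
  have := xs n; rewrite /chain_step /e co => h; apply: (mulfI (lt0r_neq0 g_gt0)).
  have -> : g * (2 * (- (1 + start_level r) / (2 * g)) * x n.+1 - x n + - D (x n) (x n.+2) / g)
    = - (1 + start_level r) * x n.+1 - g * x n - D (x n) (x n.+2).
    by field; exact: lt0r_neq0.
  by lra.
have eb_e : `|e| <= eb.
  rewrite /e /eb normrM normrN (gtr0_norm (_ : 0 < g^-1)) ?invr_gt0// ler_wpM2r ?invr_ge0 ?(ltW g_gt0)//.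
  by apply: D_le => //; exact: le_trans rho_le1.
have -> : n.+1%:R * om = n%:R * om + om :> R by rewrite -natr1 mulrDl mul1r.
have -> : cos phi * (sin om * x n.+1 - r * sin (n%:R * om + om)) +
   sin phi * (x n.+2 - cos om * x n.+1 - r * cos (n%:R * om + om)) =
   (cos (phi + om) * (sin om * x n - r * sin (n%:R * om)) +
   sin (phi + om) * (x n.+1 - cos om * x n - r * cos (n%:R * om))) + sin phi * e.
  rewrite rec !sinD !cosD; have := cos2Dsin2 om; set c := cos om; set s := sin om => cs.
  have s2 : s * s = 1 - c * c by rewrite -cs; ring.
  set sn := sin (_ * _); set cn := cos (_ * _); set sp := sin phi; set cp := cos phi.
  by ring: s2.
apply: le_trans (ler_normD _ _) _; rewrite -natr1 mulrDl mul1r lerD//.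
rewrite normrM; apply: le_trans eb_e; rewrite ler_piMl//; exact: sin_max.
Qed.

Lemma start_level_growth r r' : 0 < r -> r <= r' -> r' <= r1 ->
  g * r' / 2 * (r' - r) <= start_level r' - start_level r.
Proof.
move=> r0 rr r'1; have rr' : 0 < r' <= r1 by rewrite r'1 andbT (lt_le_trans r0).
have [_ rrho'] := r_le_rho rr'.
have -> : start_level r' - start_level r = (g * (r' + r) + D r' r) * (r' - r).
  by have := DE r' r; rewrite /start_level; lra.
rewrite ler_wpM2r ?subr_ge0//.
have : `|D r' r| <= kap * r'.
  by apply: D_small; rewrite // gtr0_norm// (lt_le_trans r0).
rewrite ler_norml => /andP[d1 _].
have : kap * r' <= g / 8 * r' by rewrite ler_wpM2r// (le_trans _ rr)// ltW.
have : 0 < g * r by rewrite mulr_gt0.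
have : 0 < g * r' by rewrite mulr_gt0//; case/andP: rr'.
by move=> ? ? ?; lra.
Qed.

(** The twist. Since [cos] is 1-Lipschitz, the angle grows at least as much as its cosine falls,
    which is [(t' - t) / (2 * g)]. *)
Lemma rot_angle_growth r r' : 0 < r -> r <= r' -> r' <= r1 ->
  r' / 4 * (r' - r) <= rot_angle (start_level r') - rot_angle (start_level r) .
Proof.
move=> r0 rr r'1; have := start_level_growth r0 rr r'1.
have rr1 : 0 < r <= r1 by rewrite r0 (le_trans rr).
have rr' : 0 < r' <= r1 by rewrite r'1 andbT (lt_le_trans r0).
have [_ _ t0 _ tm] := start_level_bounds rr1; have [_ _ t0' _ tm'] := start_level_bounds rr'.
set t := start_level r in t0 tm *; set t' := start_level r' in t0' tm' * => tt.
have ct := cos_rot_angle (ltW t0) tm; have ct' := cos_rot_angle (ltW t0') tm'.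
have [/andP[? ?] /andP[? ?]] := (cos_range (ltW t0) tm, cos_range (ltW t0') tm').
have in1 : rot_angle t \in `[0, pi].
  by rewrite in_itv /= acos_ge0 ?acos_lepi// !ltW.
have in1' : rot_angle t' \in `[0, pi].
  by rewrite in_itv /= acos_ge0 ?acos_lepi// !ltW.
have tt' : t <= t'.
  rewrite -subr_ge0; apply: le_trans tt; rewrite mulr_ge0 ?subr_ge0// divr_ge0// mulr_ge0 ?ltW//.
  by case/andP: rr'.
have oo : rot_angle t <= rot_angle t'.
  rewrite leNgt -(ltr_cos in1' in1) ct ct' -leNgt ler_pM2r ?invr_gt0 ?mulr_gt0//.
  by rewrite lerN2 lerD2l.
have := cos_lipschitz (rot_angle t') (rot_angle t); rewrite ct ct' [X in _ <= X]ger0_norm ?subr_ge0//.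
have -> : - (1 + t') / (2 * g) - - (1 + t) / (2 * g) = - ((t' - t) / (2 * g)).
  by field; exact: lt0r_neq0.
rewrite normrN ger0_norm ?divr_ge0 ?subr_ge0 ?mulr_ge0 ?(ltW g_gt0)//.
apply: le_trans.
rewrite ler_pdivlMr ?mulr_gt0//; apply: le_trans tt.
by rewrite le_eqVlt; apply/orP; left; apply/eqP; field.
Qed.

(** On the axis the level equation reads [g * y ^+ 2 + v y = t], and [v] is too small for it to have
    a second positive root. *)
Lemma positive_return r x j : 0 < r <= r1 -> is_chain r x -> x j = 0 -> 0 < x j.+1 ->
  x j.+1 = r.
Proof.
move=> rr [x0 xr xb _ xl] xj; set y := x j.+1 => y0.
have [_ rrho] := r_le_rho rr; have r10 := r_rho rr; have r0 : 0 < r by case/andP: rr.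
have yC : y <= C1 * r by apply: le_trans (xb j.+1); rewrite ler_norm.
have rC : r <= C1 * r by rewrite ler_peMl// ltW.
have := xl j; rewrite xj /on_level -/y => lv.
have e : (y - r) * (g * (y + r) + D y r) = 0.
  by have := DE y r; move: lv; rewrite /start_level v0; lra.
apply/eqP; rewrite -subr_eq0; move/eqP: e; rewrite mulf_eq0 => /orP[//|/eqP e].
have : `|D y r| <= kap * (y + r).
  by apply: D_small; rewrite ?gtr0_norm ?lerDl ?lerDr ?(ltW r0) ?(ltW y0)//; lra.
rewrite ler_norml => /andP[d1 _].
have : kap * (y + r) <= g / 8 * (y + r) by rewrite ler_wpM2r// addr_ge0 ?ltW.
have : 0 < g * (y + r) by rewrite mulr_gt0 ?addr_gt0.
by move=> ? ?; lra.
Qed.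

(* At a step [j] where the chain meets the axis again the phase [j * om] is close to a multiple
   of [pi]; as [n] is odd and [n * om] is close to a multiple of [2 * pi], comparing
   [cos (n * (j * om))] with [cos (j * (n * om))] shows that it is an even one. *)
Lemma return_of_small_error r x n e : 0 < r <= r1 -> is_chain r x -> odd n ->
  n%:R * (K * (C1 * r) ^+ 7 / g) <= e * r -> n%:R * e < 2^-1 ->
  0 <= cos (n%:R * rot_angle (start_level r)) -> x n = 0 ->
  forall j, (j <= n)%N -> x j = 0 -> x j.+1 = r.
Proof.
move=> rr cx on ne ne2 cn xn j jn xj; have r0 : 0 < r by case/andP: rr.
set om := rot_angle _ in cn.
have n1 : (1 <= n)%N by case: n on {ne ne2 cn xn jn}.
have eb0 : 0 <= K * (C1 * r) ^+ 7 / g.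
  rewrite divr_ge0 ?(ltW g_gt0)// mulr_ge0// exprn_ge0// mulr_ge0 ?(ltW r0)//.
  by rewrite (le_trans _ C1_ge1).
have e0 : 0 <= e by rewrite -(pmulr_lge0 _ r0) (le_trans _ ne)// mulr_ge0.
have e2 : e < 2^-1 by apply: le_lt_trans ne2; rewrite ler_peMl// ler1n.
have small i : (i <= n)%N -> i%:R * (K * (C1 * r) ^+ 7 / g) <= e * r.
  by move=> i_n; apply: le_trans ne; rewrite ler_wpM2r// ler_nat.
have s_small i : (i <= n)%N -> x i = 0 -> `|sin (i%:R * om)| <= e.
  move=> i_n xi; have := chain_rotation rr cx i 0; rewrite -/om xi !mulr0 sub0r cos0 sin0 mul0r addr0 mul1r.
  move=> /le_trans /(_ (small i i_n)); rewrite normrN normrM (gtr0_norm r0) mulrC.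
  by rewrite ler_pM2r.
have cj : 0 <= cos (j%:R * om).
  rewrite leNgt; apply/negP => cj.
  have := cos_muln_lt0 on (s_small j jn xj) (ltW cj) _.
  have := @cos_muln_gt0 R j (n%:R * om) e (s_small n (leqnn n) xn) cn _.
  rewrite mulrCA => p q; have p' : j%:R * e < 1.
    by apply: le_lt_trans (_ : n%:R * e < 1); [rewrite ler_wpM2r// ler_nat | lra].
  by have := p p'; rewrite ltNge ltW// q//; lra.
apply: (positive_return rr cx xj).
have ch := cos_ge_half (s_small j jn xj) (ltW e2) cj.
have := chain_rotation rr cx j (pi / 2); rewrite -/om xj cos_pihalf sin_pihalf mul0r add0r mul1r mulr0 subr0.
move=> /le_trans /(_ (small j jn)); rewrite ler_norml => /andP[p _].
have : r * 2^-1 <= r * cos (j%:R * om) by rewrite ler_pM2l.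
have : e * r < 2^-1 * r by rewrite ltr_pM2r.
by move=> ? ?; lra.
Qed.

Lemma rot_angle_continuous t : 0 <= t -> t <= (g - 2^-1) / 2 -> {for t, continuous rot_angle}.
Proof.
move=> t0 tm; apply: continuous_comp; last exact/continuous_acos/cos_range.
by apply: cvgMl; apply: cvgN; apply: cvgD; [exact: cvg_cst | exact: cvg_id].
Qed.

(** As [r] runs through [[S, 2 S]] the angle gains at least [S ^+ 2 / 2], so for [n] of order
    [S ^ -2] the phase [n * om] gains at least [4 * pi]. It thus passes a quarter turn before and a
    quarter turn after some multiple of [2 * pi]. There [sin om * x n] is close to [- r] and to [r],
    so [x n] vanishes for some radius in between. *)
Lemma closed_chain_exists (R0 : R) : 0 < R0 -> 0 < r1 -> exists r n x,
  [/\ 0 < r <= r1, r <= R0, odd n, is_chain r x &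
      x n = 0 /\ forall j, (j <= n)%N -> x j = 0 -> x j.+1 = r].
Proof.
move=> R00 r10; pose L := K * C1 ^+ 7 / g; pose B : R := 16 * pi + 3.
have pi0 : 0 < (pi : R) := pi_gt0 R.
have B1 : 1 <= B by rewrite /B; lra.
have B0 : 0 < B by rewrite (lt_le_trans _ B1).
have C10 : 0 < C1 by rewrite (lt_le_trans _ C1_ge1).
have L0 : 0 <= L by rewrite divr_ge0 ?(ltW g_gt0)// mulr_ge0// exprn_ge0// ltW.
have BL0 : 0 <= 64 * B ^+ 2 * L by rewrite mulr_ge0// mulr_ge0// exprn_ge0// ltW.
have BL1 : 0 < 64 * B ^+ 2 * L + 1 by rewrite ltr_wpDl.
(* Small enough for [64 * B ^+ 2 * L * S ^+ 2 <= 1/4], which keeps [n * e] below 1/2. *)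
pose S := Num.min (Num.min R0 r1) (Num.min 1 (64 * B ^+ 2 * L + 1)^-1) / 2.
have S0 : 0 < S by rewrite divr_gt0// !lt_min R00 r10 ltr01 invr_gt0.
have SM : 2 * S = Num.min (Num.min R0 r1) (Num.min 1 (64 * B ^+ 2 * L + 1)^-1).
  by rewrite /S; field.
have [SR Sr S1 SB] : [/\ 2 * S <= R0, 2 * S <= r1, 2 * S <= 1
    & 2 * S <= (64 * B ^+ 2 * L + 1)^-1].
  by rewrite SM; split; rewrite !ge_min lexx ?orbT.
clearbody S.
have S20 : 0 < S ^+ 2 by rewrite exprn_gt0.
(* An odd [n] with [8 * pi <= n * S ^+ 2 <= B]: the lower bound yields the phase gain [4 * pi], the
   upper one limits the accumulated error. *)
pose N := (Num.truncn (8 * pi / S ^+ 2)).+1; pose n := N.*2.+1.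
have on : odd n by rewrite /n /= odd_double.
have nE : n%:R = 2 * N%:R + 1 :> R by rewrite /n -natr1 -mul2n natrM.
have pS : 0 <= 8 * pi / S ^+ 2 by rewrite divr_ge0 ?mulr_ge0 ?ltW.
have /andP[Nhi Nlo] := truncn_itv pS.
rewrite -/N in Nlo; have {}Nhi : N%:R <= 8 * pi / S ^+ 2 + 1 by rewrite /N -natr1 lerD2r.
clearbody N.
have nlo : 8 * pi <= n%:R * S ^+ 2.
  rewrite -ler_pdivrMr// nE; apply: (le_trans (ltW Nlo)).
  have : 0 <= N%:R :> R by []. by lra.
have nhi : n%:R * S ^+ 2 <= B.
  have : N%:R * S ^+ 2 <= 8 * pi + S ^+ 2.
    have := ler_wpM2r (ltW S20) Nhi; rewrite mulrDl mul1r divfK ?gt_eqF//.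
  have : S ^+ 2 <= 1 by rewrite exprn_ile1 ?(ltW S0)//; lra.
  by rewrite nE mulrDl mul1r /B => ? ?; lra.
have n0 : 0 < n%:R :> R by rewrite ltr0n.
(* The error after [n] steps relative to [r]: the factor [(2 * S) ^+ 6] from the radius, times
   [n <= B / S ^+ 2]. *)
pose e := 64 * B * L * S ^+ 4.
have err (r : R) : 0 < r -> r <= 2 * S -> n%:R * (K * (C1 * r) ^+ 7 / g) <= e * r.
  move=> rp rS; rewrite exprMn.
  have -> : n%:R * (K * (C1 ^+ 7 * r ^+ 7) / g) = n%:R * L * r ^+ 6 * r.
    by rewrite /L; field; exact: lt0r_neq0.
  rewrite ler_pM2r//; apply: (@le_trans _ _ (n%:R * L * (2 * S) ^+ 6)).
    by apply: ler_wpM2l; [rewrite mulr_ge0// ltW | rewrite lerXn2r// nnegrE ltW// mulr_gt0].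
  have -> : n%:R * L * (2 * S) ^+ 6 = (n%:R * S ^+ 2) * (64 * L * S ^+ 4) by ring.
  have -> : e = B * (64 * L * S ^+ 4) by rewrite /e; ring.
  by apply: ler_wpM2r nhi; apply: mulr_ge0; [apply: mulr_ge0 | rewrite exprn_ge0// ltW].
have ne2 : n%:R * e < 2^-1.
  have -> : n%:R * e = (n%:R * S ^+ 2) * (64 * B * L * S ^+ 2) by rewrite /e; ring.
  apply: (@le_lt_trans _ _ (B * (64 * B * L * S ^+ 2))).
    by apply: ler_wpM2r nhi; apply: mulr_ge0 (ltW S20); apply: mulr_ge0 => //;
      apply: mulr_ge0 => //; exact: ltW.
  have -> : B * (64 * B * L * S ^+ 2) = (64 * B ^+ 2 * L) * (2 * S) * (2 * S) / 4 by field.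
  have q : (64 * B ^+ 2 * L) * (2 * S) <= 1.
    apply: le_trans (ler_wpM2l BL0 SB) _; rewrite ler_pdivrMr// mul1r lerDl//.
  have : (64 * B ^+ 2 * L) * (2 * S) * (2 * S) <= 1 * 1.
    have S2 : 0 <= 2 * S by rewrite mulr_ge0// ltW.
    by apply: ler_pM => //; exact: mulr_ge0.
  by lra.
have e0 : 0 <= e.
  by apply: mulr_ge0; [apply: mulr_ge0 => //; apply: mulr_ge0 => //; exact: ltW
    | rewrite exprn_ge0// ltW].
have e2 : e < 2^-1.
  by apply: le_lt_trans ne2; rewrite ler_peMl// ler1n.
pose om r := rot_angle (start_level r).
have ok (r : R) : S <= r <= 2 * S -> 0 < r <= r1.
  by move=> /andP[a b]; apply/andP; split; [exact: lt_le_trans a | exact: le_trans Sr].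
have T0 : 0 < 3 * g + 1 by rewrite addr_gt0// mulr_gt0.
have c_om : {within `[S, 2 * S], continuous (fun r => n%:R * om r)}.
  have : {within `[S, 2 * S], continuous start_level}.
    apply: (lipschitz_within_continuous T0) => x y /ok xr /ok yr.
    exact: start_level_lipschitz.
  move=> /subspace_continuousP H; apply/subspace_continuousP => z zin.
  have /ok/start_level_bounds[_ _ t0 _ tm] : S <= z <= 2 * S by move: zin; rewrite /= in_itv.
  apply: cvgMr; apply: (cvg_comp _ _ (H z zin)).
  exact: (rot_angle_continuous (ltW t0) tm).
have SS : S <= 2 * S by lra.
have gap : n%:R * om S + 4 * pi <= n%:R * om (2 * S).
  have := rot_angle_growth S0 SS Sr; rewrite -/(om _) -/(om _) => h.
  have : n%:R * (2 * S / 4 * (2 * S - S)) <= n%:R * (om (2 * S) - om S) by rewrite ler_wpM2l.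
  have -> : n%:R * (2 * S / 4 * (2 * S - S)) = n%:R * S ^+ 2 / 2 :> R by field.
  by rewrite mulrBr => ?; lra.
have om0 : 0 <= om S.
  have /ok/start_level_bounds[_ _ t0 _ tm] : S <= S <= 2 * S by rewrite lexx.
  by have /andP[? ?] := cos_range (ltW t0) tm; rewrite /om acos_ge0// !ltW.
(* The number of turns is rounded so that [k.+1] full turns minus a quarter lie beyond the phase at
   [S]. Adding a quarter instead stays within [3 * pi] of that phase, hence inside the gain of
   [4 * pi]. *)
pose X := (n%:R * om S + pi / 2) / (2 * pi).
have X0 : 0 <= X.
  apply: divr_ge0; last by rewrite mulr_ge0// ltW.
  by apply: addr_ge0; [apply: mulr_ge0 => //; exact: ltW | rewrite divr_ge0// ltW].
have /andP[] := truncn_itv X0; set k := Num.truncn X => kX Xk.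
have {}kX : (k.+1%:R - 1) * (2 * pi) <= n%:R * om S + pi / 2.
  by rewrite -ler_pdivlMr ?mulr_gt0// -natr1 addrK.
have {}Xk : n%:R * om S + pi / 2 < k.+1%:R * (2 * pi) by rewrite -ltr_pdivrMr ?mulr_gt0.
have [ra raI oma] : exists2 c, c \in `[S, 2 * S] & n%:R * om c = k.+1%:R * (2 * pi) - pi / 2.
  apply: IVT => //; rewrite ge_min le_max; apply/andP; split; apply/orP; [left | right]; lra.
have [rb rbI omb] : exists2 c, c \in `[S, 2 * S] & n%:R * om c = k.+1%:R * (2 * pi) + pi / 2.
  apply: IVT => //; rewrite ge_min le_max; apply/andP; split; apply/orP; [left | right]; lra.
move: raI rbI; rewrite !in_itv /= => raI rbI.
have mono r r' : S <= r <= 2 * S -> S <= r' <= 2 * S -> r <= r' -> om r <= om r'.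
  move=> /ok/andP[a _] /ok/andP[a' b'] rr; rewrite -subr_ge0.
  by apply: le_trans (rot_angle_growth a rr b'); rewrite mulr_ge0 ?subr_ge0// divr_ge0// ltW.
have ab : ra <= rb.
  rewrite leNgt; apply/negP => ba; have := mono _ _ rbI raI (ltW ba).
  by rewrite -(ler_pM2l n0) oma omb; lra.
have inS r : ra <= r <= rb -> S <= r <= 2 * S.
  move=> /andP[a b]; move: raI rbI => /andP[? _] /andP[_ ?].
  by apply/andP; split; [exact: le_trans a | exact: le_trans b _].
have [xs xsP] : exists xs : R -> nat -> R, forall r, S <= r <= 2 * S -> is_chain r (xs r).
  have st r : exists x, S <= r <= 2 * S -> is_chain r x.
    have [/ok/chain_exists[x xc]|nr] := pselect (S <= r <= 2 * S); first by exists x.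
    by exists (fun=> 0) => /nr.
  by have [f fP] := choice st; exists f.
have c_x : {within `[ra, rb], continuous (fun r => xs r n)}.
  apply: (@lipschitz_within_continuous _ _ _ _ ((3 * g + 1) * 15 ^+ n)).
    by rewrite mulr_gt0// exprn_gt0.
  move=> x y /inS xS /inS yS.
  exact: (chain_lipschitz (ok _ xS) (ok _ yS) (xsP _ xS) (xsP _ yS) n).1.
have val r : ra <= r <= rb -> 
    `|sin (om r) * xs r n - r * sin (n%:R * om r)| <= e * r.
  move=> /inS rS; have := chain_rotation (ok _ rS) (xsP _ rS) n 0.
  rewrite cos0 sin0 mul0r addr0 mul1r => /le_trans; apply.
  by case/andP: rS => ? ?; apply: err => //; exact: lt_le_trans S0 _.
have so r : S <= r <= 2 * S -> 0 < sin (om r).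
  move=> /ok/start_level_bounds[_ _ t0 _ tm]; apply: sin_rot_angle_gt0 => //; exact: ltW.
have per (y : R) : sin (k.+1%:R * (2 * pi) + y) = sin y /\ cos (k.+1%:R * (2 * pi) + y) = cos y.
  have -> : k.+1%:R * (2 * pi) + y = y + pi *+ 2 *+ k.+1.
    by rewrite -[pi *+ 2 *+ _]mulr_natl -[pi *+ 2]mulr_natl addrC.
  by rewrite (periodicn (@sinD2pi R)) (periodicn (@cosD2pi R)).
have xa : xs ra n <= 0.
  have rS : ra <= ra <= rb by rewrite lexx.
  have := val _ rS; rewrite oma (per _).1 sinN sin_pihalf mulrN1 opprK ler_norml => /andP[_ p].
  have r0 : 0 < ra by case/andP: raI => ? _; exact: lt_le_trans S0 _.
  have : e * ra <= 2^-1 * ra by rewrite ler_wpM2r// ltW.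
  rewrite -(pmulr_rle0 _ (so _ raI)) => er; rewrite -lerBrDr in p; apply: le_trans p _.
  by rewrite subr_le0 (le_trans er)// ger_pMl// invf_le1 ?ler1n.
have xb : 0 <= xs rb n.
  have rS : ra <= rb <= rb by rewrite lexx andbT.
  have := val _ rS; rewrite omb (per _).1 sin_pihalf mulr1 ler_norml => /andP[p _].
  have r0 : 0 < rb by case/andP: rbI => ? _; exact: lt_le_trans S0 _.
  have : e * rb <= 2^-1 * rb by rewrite ler_wpM2r// ltW.
  rewrite -(pmulr_rge0 _ (so _ rbI)) => er; rewrite lerBrDr in p; apply: le_trans p.
  by rewrite addrC subr_ge0 (le_trans er)// ger_pMl// invf_le1 ?ler1n.
have [|r] := IVT ab c_x (v := 0); first by rewrite ge_min xa le_max xb orbT.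
rewrite in_itv /= => rI xr0; have rS := inS _ rI.
have r0 : 0 < r by case/andP: rS => ? _; exact: lt_le_trans S0 _.
exists r, n, (xs r); split=> //.
- exact: ok.
- by case/andP: rS => _ /le_trans; apply.
- exact: xsP.
split=> // j; apply: (@return_of_small_error r (xs r) n e (ok _ rS) (xsP _ rS)) => //.
  by apply: err => //; case/andP: rS.
(* Between the two radii the phase is within a quarter turn of a multiple of [2 * pi], so its cosine
   is nonnegative, as [return_of_small_error] requires. *)
rewrite -/(om r) (_ : n%:R * om r = k.+1%:R * (2 * pi) + (n%:R * om r - k.+1%:R * (2 * pi))); last by ring.
rewrite (per _).2; apply: cos_ge0_pihalf; move: rI => /andP[rI1 rI2].
have m1 : n%:R * om ra <= n%:R * om r by rewrite ler_pM2l// mono.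
have m2 : n%:R * om r <= n%:R * om rb by rewrite ler_pM2l// mono.
by rewrite oma in m1; rewrite omb in m2; rewrite lerBrDr lerBlDr addrC m1 addrC m2.
Qed.

Lemma chain_determined r x a b : 0 < r <= r1 -> is_chain r x ->
  x a = x b -> x a.+1 = x b.+1 -> forall i, x (a + i)%N = x (b + i)%N.
Proof.
move=> rr [_ _ xb xs _] ab ab1; have [crho _] := r_le_rho rr.
have xr i : `|x i| <= rho by exact: le_trans crho.
suff H i : x (a + i)%N = x (b + i)%N /\ x (a + i).+1 = x (b + i).+1 by move=> i; case: (H i).
elim: i => [|i [IH1 IH2]]; first by rewrite !addn0.
rewrite !addnS; split=> //; have := xs (a + i)%N; rewrite IH1 IH2 => s1.
exact: (chain_step_unique _ _ _ s1 (xs (b + i)%N)).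
Qed.

(* Reflecting the chain about an index where it turns back would make [0] the centre of a
   reflection as well, by oddness of the period; but the two neighbours of [0] differ. *)
Lemma periodic_chain_exists (R0 : R) : 0 < R0 -> 0 < r1 -> exists t q (x : nat -> R),
  [/\ odd q, forall i, x (i + q)%N = x i, forall i, `|x i| <= Num.min R0 rho &
   forall i, on_level t (x i) (x i.+1)] /\
  [/\ x 0%N = 0 /\ 0 < t, 0 < x 1%N, forall i, chain_step t (x i) (x i.+1) (x i.+2),
   forall i, x i.+2 <> x i & forall i, x i = x 1%N -> i = 1 %[mod q]].
Proof.
move=> R00 r10; have C10 : 0 < C1 by rewrite (lt_le_trans _ C1_ge1).
have [|r [n [x [rr rR on cx [xn ret]]]]] := closed_chain_exists (_ : 0 < R0 / C1) r10.
  exact: divr_gt0.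
have [crho _] := r_le_rho rr; have r0 : 0 < r by case/andP: rr.
have [x0 x1 xb xs xl] := cx.
have [_ _ t0 _ _] := start_level_bounds rr.
have xr i : `|x i| <= rho by exact: le_trans crho.
have ex : exists j, (0 < j)%N && (x j == 0).
  by exists n; rewrite xn eqxx andbT; case: n on {xn ret}.
case: (ex_minnP ex) => q /andP[q0 /eqP xq] qmin.
have qn : (q <= n)%N by apply: qmin; rewrite xn eqxx andbT; case: n on {xn ret}.
have per i : x (i + q)%N = x i.
  have := chain_determined rr cx (a := q) (b := 0%N); rewrite x0 x1 => /(_ xq (ret q qn xq) i).
  by rewrite addnC add0n.
have perM i d : x (i + d * q)%N = x i.
  by elim: d => [|d IH]; rewrite ?addn0// mulSn addnCA addnC per.
have x_mod i : x i = x (i %% q)%N by rewrite {1}(divn_eq i q) addnC perM.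
have zero i : x i = 0 -> (q %| i)%N.
  rewrite x_mod => xi; apply/negPn/negP; rewrite /dvdn -lt0n => lt.
  have := ltn_pmod i q0; rewrite ltnNge => /negP; apply.
  by apply: qmin; rewrite lt xi eqxx.
have oq : odd q by apply: dvdn_odd (zero n xn) on.
have nd i : x i.+2 <> x i.
  move=> xi.
  have refl m : (m <= i)%N -> x (i.+1 + m)%N = x (i.+1 - m)%N /\ x (i.+1 + m).+1 = x (i - m)%N.
    elim: m => [|m IH] mi; first by rewrite !addn0 !subn0.
    have [IH1 IH2] := IH (ltnW mi); rewrite addnS subSS; split=> //.
    have s1 := xs (i.+1 + m)%N; have s2 := xs (i - m.+1)%N.
    have e1 : (i - m.+1).+1 = (i - m)%N by rewrite -subSn// subSS.
    have e2 : (i - m).+1 = (i.+1 - m)%N by rewrite -subSn// ltnW.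
    rewrite IH1 IH2 in s1; rewrite e1 e2 in s2.
    exact: (chain_step_unique _ _ _ s1 (chain_stepC s2)).
  (* The reflection carries index 0 to [2 * (i + 1)], so the odd period divides [i + 1] and [x i.+1]
     is 0. Its two equal neighbours then satisfy a chain step that forces them to be 0, against the
     positive level. *)
  have := (refl i (leqnn i)).2; rewrite subnn x0 => /zero.
  rewrite (_ : (i.+1 + i).+1 = i.+1 * 2)%N; last by rewrite muln2 -addnn addnS.
  rewrite Gauss_dvdl ?coprimen2// => qi.
  have xi1 : x i.+1 = 0 by rewrite x_mod (eqP qi).
  have := xs i; rewrite /chain_step xi xi1 mulr0 add0r => e.
  have xi0 : x i = 0.
    have := D_small (xr i) (lexx _) (lexx _); rewrite (_ : D (x i) (x i) = - (2 * g * x i)); last by lra.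
    rewrite normrN !normrM (gtr0_norm g_gt0) (ger0_norm (ler0n _ _)) => le.
    apply/eqP; rewrite -normr_le0 leNgt; apply/negP => p.
    by move: le; rewrite ler_pM2r//; move: kap_lt g_gt0; lra.
  by have := xl i; rewrite /on_level xi1 xi0 v0; move: t0; lra.
exists (start_level r), q, x; split; split=> //; last 2 first.
- by rewrite x1.
(* The value [x 1] is taken once per period. If it recurs at [i.+1] and is followed by 0, the next
   value is [x 1] again and the chain turns back, which [nd] excludes. Otherwise 0 and [x i.+2] are
   distinct partners of [x 1] on the level, and uniqueness of the step backwards gives [x i = 0]. *)
- case=> [|i]; first by rewrite x0 x1 => e; rewrite e ltxx in r0.
  move=> xi; have [z|/eqP nz] := eqVneq (x i.+2) 0.
    have /dvdnP[d dq] := zero _ z; have := nd i.+1; rewrite xi x1 -x1.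
    by case; rewrite -(perM 1%N d) -dq.
  have l0 := xl 0%N; have li := xl i.+1; rewrite x0 in l0; rewrite xi in li.
  have st := level_chain_step l0 li (fun e => nz (esym e)).
  have := xs i; rewrite xi => st'.
  have xi0 := chain_step_unique (xr _) _ _ (chain_stepC st) (chain_stepC st').
  have /zero/dvdnP[d ->] : x i = 0 by rewrite -xi0// normr0 ltW.
  by rewrite -addn1 modnMDl.
- move=> i; rewrite le_min xr andbT; apply: le_trans (xb i) _.
  by rewrite mulrC -ler_pdivlMr.
Qed.

End Chains.

(* [1 - x * y] times the partial derivative in [x] of
   [(x * y + V x + V y) / (1 - x * y)], where [V x = g * x ^+ 2 + v x], at a point of level [t]. *)
Definition slope_fst (R : realType) (g : R) (dv : R -> R) (t x y : R) : R :=
  (1 + t) * y + 2 * g * x + dv x.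

(* The quotient of the two products is the multiplier of the orbit, [q] being even. *)
Definition resonant_orbit (R : realType) (g : R) (v dv : R -> R) (t : R) (q : nat)
    (x : nat -> R) : Prop :=
  [/\ (0 < q)%N, ~~ odd q, forall i, x (i + q)%N = x i &
   forall i, on_level g v t (x i) (x i.+1)] /\
  [/\ forall i, x i.+2 <> x i, forall i, slope_fst g dv t (x i.+1) (x i) != 0 &
   \prod_(i < q) slope_fst g dv t (x i) (x i.+1) !=
   \prod_(i < q) slope_fst g dv t (x i.+1) (x i)].

Definition coef_norm (R : realType) (p : {poly R}) : R := \sum_(i < size p) `|p`_i|.

(** * One perturbation of the series *)

Section Stage.
Variable R : realType.
Implicit Types (p w : {poly R}) (g t : R).

Lemma resonant_orbit_ext g (v dv v' dv' : R -> R) t q (x : nat -> R) :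
  (forall i, v' (x i) = v (x i)) -> (forall i, dv' (x i) = dv (x i)) ->
  resonant_orbit g v dv t q x -> resonant_orbit g v' dv' t q x.
Proof.
move=> ev ed [[q0 oq per lv] [nd D0 ND]].
have es y i : slope_fst g dv' t (x i) y = slope_fst g dv t (x i) y.
  by rewrite /slope_fst ed.
split; split=> //.
- by move=> i; rewrite /on_level !ev; exact: lv.
- by move=> i; rewrite es.
- by rewrite (eq_bigr _ (fun (i : 'I_q) _ => es (x i.+1) i))
    [X in _ != X](eq_bigr _ (fun (i : 'I_q) _ => es (x i) i.+1)).
Qed.

Lemma poly_small_nonroot p (a : R) : p != 0 -> 0 < a -> exists b, 0 < b <= a /\ p.[b] != 0.
Proof.
move=> p0 a0; pose rs := [seq a / i.+1%:R | i <- iota 0 (size p)].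
have : ~~ all (root p) rs.
  apply/negP => /(max_poly_roots p0)/(_ _)/wrap[].
    rewrite map_inj_in_uniq ?iota_uniq// => i j _ _ /(mulfI (lt0r_neq0 a0))/invr_inj/eqP.
    by rewrite eqr_nat eqSS => /eqP.
  by rewrite size_map size_iota ltnn.
move=> /allPn[_ /mapP[i _ ->]]; rewrite rootE => nz; exists (a / i.+1%:R); split=> //.
by rewrite divr_gt0//= ler_pdivrMr// (ler_peMr (ltW a0))// ler1n.
Qed.

Lemma double_root_deriv p s : ('X - s%:P) ^+ 2 %| p -> p.[s] = 0 /\ p^`().[s] = 0.
Proof.
move=> /dvdpP[u ->]; rewrite expr2 !derivM derivXsubC !(hornerD, hornerM, hornerN, hornerX, hornerC).
by split; ring.
Qed.

(** The excluded values of [b] are roots of one polynomial, which is nonzero: at [b = - N / d] the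
    left square vanishes while [D + b * d] equals [D - N]. The squares come from going round the
    orbit twice. *)
Lemma avoid_resonance (A B N D d a : R) : B != 0 -> N != D -> d != 0 -> 0 < a ->
  exists b, [/\ 0 < b <= a, D + b * d != 0 &
    (A * (N + b * d)) ^+ 2 != (B * (D + b * d)) ^+ 2].
Proof.
move=> B0 ND d0 a0.
pose Nb : {poly R} := N%:P + d%:P * 'X; pose Db : {poly R} := D%:P + d%:P * 'X.
have eN b : Nb.[b] = N + b * d by rewrite /Nb !hornerE mulrC.
have eD b : Db.[b] = D + b * d by rewrite /Db !hornerE mulrC.
clearbody Nb Db; pose P := Db * ((A%:P * Nb) ^+ 2 - (B%:P * Db) ^+ 2).
have eP b : P.[b] = (D + b * d) * ((A * (N + b * d)) ^+ 2 - (B * (D + b * d)) ^+ 2).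
  by rewrite /P hornerM hornerD hornerN !horner_exp !hornerM !hornerC eN eD.
have P0 : P != 0.
  apply/negP => /eqP P0; have := eP (- N / d); rewrite P0 horner0 divfK// subrr mulr0 expr0n sub0r.
  move/eqP; rewrite eq_sym mulf_eq0 oppr_eq0 sqrf_eq0 mulf_eq0 (negbTE B0) /= orbb subr_eq0.
  by rewrite eq_sym (negbTE ND).
have [b [ba]] := poly_small_nonroot P0 a0; rewrite eP mulf_eq0 negb_or subr_eq0 => /andP[p1 p2].
by exists b.
Qed.

Lemma coef_norm_ge0 p : 0 <= coef_norm p.
Proof. by apply: sumr_ge0. Qed.

Lemma coef_normZ (a : R) p : coef_norm (a *: p) <= `|a| * coef_norm p.
Proof.
rewrite /coef_norm mulr_sumr.
apply: (@le_trans _ _ (\sum_(i < size p) `|(a *: p)`_i|)).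
  have := size_scale_leq a p; move: (size (a *: p)) => n np.
  rewrite -(big_mkord xpredT (fun i => `|(a *: p)`_i|)).
  rewrite -[leRHS](big_mkord xpredT (fun i => `|(a *: p)`_i|)) (big_cat_nat (leq0n n) np) /=.
  by rewrite lerDl sumr_ge0.
by apply: ler_sum => i _; rewrite coefZ normrM.
Qed.

(** By the chain step the slope equals [g * (z - x)] plus a difference of two values of [divdiff],
    and this difference is smaller than [g * |z - x|]. *)
Lemma slope_snd_neq0 g w (rho t x y z : R) : 2^-1 < g -> 'X^8 %| w -> rho <= 1 ->
  coef_weight w * rho ^+ 6 <= (g - 2^-1) / 8 ->
  `|x| <= rho -> `|z| <= rho -> chain_step g (divdiff w) t x y z -> z <> x ->
  slope_fst g (horner w^`()) t z y != 0.
Proof.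
move=> g2 w8 r1 kr xr zr st zx; apply/eqP => s0.
have g0 : 0 < g by apply: lt_trans g2; rewrite invr_gt0.
have e : divdiff w z z - divdiff w z x = - g * (z - x).
  by move: st s0; rewrite /chain_step /slope_fst [divdiff w z x]divdiffC divdiff_diag; lra.
have := divdiff_lipschitz w8 r1 zr zr xr; rewrite e normrM normrN (gtr0_norm g0).
have zx0 : 0 < `|z - x| by rewrite normr_gt0 subr_eq0; apply/eqP.
by rewrite ler_pM2r//; move: kr g2; lra.
Qed.

Lemma small_constants g (K e : R) : 2^-1 < g -> 0 <= K -> 0 < e ->
  exists rho r1 : R, [/\ 0 < rho, rho <= 1, K * rho ^+ 6 <= (g - 2^-1) / 8 & 0 < r1] /\
   [/\ 10 * ((1 + 4 * g / (g - 2^-1)) * r1) <= rho, 2 * g * r1 ^+ 2 <= 1 &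
       2 * g * r1 ^+ 2 <= (g - 2^-1) / 2].
Proof.
move=> g2 K0 e0; have g0 : 0 < g by apply: lt_trans g2; rewrite invr_gt0.
have m0 : 0 < g - 2^-1 by rewrite subr_gt0.
pose rho := Num.min 1 ((g - 2^-1) / (8 * (K + 1))).
have K1 : 0 < 8 * (K + 1) by rewrite mulr_gt0// ltr_wpDl.
have rho0 : 0 < rho by rewrite lt_min ltr01 divr_gt0.
have rho1 : rho <= 1 by rewrite ge_min lexx.
have C0 : 0 < 1 + 4 * g / (g - 2^-1) by rewrite addr_gt0// divr_gt0// mulr_gt0.
pose r1 := Num.min (Num.min 1 (rho / (10 * (1 + 4 * g / (g - 2^-1)))))
  (Num.min (2 * g)^-1 ((g - 2^-1) / (4 * g))).
have r10 : 0 < r1.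
  by rewrite !lt_min ltr01 invr_gt0 !divr_gt0 ?mulr_gt0.
have [a1 a2 a3 a4] : [/\ r1 <= 1, r1 <= rho / (10 * (1 + 4 * g / (g - 2^-1))),
   r1 <= (2 * g)^-1 & r1 <= (g - 2^-1) / (4 * g)].
  by split; rewrite !ge_min lexx ?orbT.
have r12 : r1 ^+ 2 <= r1 by rewrite expr2 ler_piMr// ltW.
have g20 : 0 < 2 * g by rewrite mulr_gt0.
exists rho, r1; split; split=> //.
- apply: (@le_trans _ _ (K * rho)).
    by rewrite ler_wpM2l// -[leRHS]expr1 ler_wiXn2l// ltW.
  apply: (@le_trans _ _ ((K + 1) * rho)); first by rewrite ler_wpM2r ?(ltW rho0)// lerDl.
  have : rho <= (g - 2^-1) / (8 * (K + 1)) by rewrite ge_min lexx orbT.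
  rewrite ler_pdivlMr// ler_pdivlMr//; lra.
- by rewrite mulrA mulrC -ler_pdivlMr// mulr_gt0.
- apply: (@le_trans _ _ (2 * g * r1)); first by rewrite ler_pM2l.
  by rewrite mulrC -ler_pdivlMr// div1r.
- apply: (@le_trans _ _ (2 * g * r1)); first by rewrite ler_pM2l.
  by move: a4; rewrite ler_pdivlMr ?mulr_gt0//; lra.
Qed.

(** The perturbation has a simple root at [u = x 1] and vanishes to second order at 0, at the other
    points of the new orbit and on [S]. It keeps all these orbits and alters the slopes of the new
    one at [u] only: [N 1] and [D 0] both change by [b * p0'(u)]. They differ from each other by
    [(1 + t) * (x 2 - x 0)], which is nonzero, so the ratio of the two products moves with [b]. *)
Lemma perturbation_exists g w (S : seq R) (e : R) (k : nat) : 2^-1 < g -> 'X^8 %| w ->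
  0 \notin S -> 0 < e -> exists p t q x (T : seq R),
  [/\ 'X^(8 + k) %| p, coef_norm p <= e &
      {in S, forall s, p.[s] = 0 /\ p^`().[s] = 0}] /\
  [/\ resonant_orbit g (horner (w + p)) (horner (w + p)^`()) t q x,
      forall i, `|x i| <= e, forall i, x i \in 0 :: T & 0 \notin T].
Proof.
move=> g2 w8 S0 e0.
have K0 : 0 <= coef_weight w by apply: sumr_ge0 => i _; rewrite mulr_ge0 ?exprn_ge0.
have [rho [r1 [[rho0 rho1 kr r10] [c1 c2 c3]]]] := small_constants g2 K0 e0.
(* The new orbit stays closer to 0 than any point of [S]; in particular [u] is not in [S], so its
   root can be simple. *)
have [R0 [R00 R0e R0S]] : exists R0, [/\ 0 < R0, R0 <= e & {in S, forall s, R0 < `|s|}].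
  elim: S S0 => [|s S IH]; first by exists e.
  rewrite inE negb_or => /andP[s0 /IH[R0 [R00 R0e R0S]]].
  have s1 : 0 < `|s| / 2 by rewrite divr_gt0// normr_gt0 eq_sym.
  exists (Num.min R0 (`|s| / 2)); split; rewrite ?lt_min ?ge_min ?R00 ?R0e// => y.
  rewrite inE => /orP[/eqP->|/R0S yS]; rewrite gt_min ?yS//.
  by apply/orP; right; rewrite ltr_pdivrMr// ltr_pMr ?ltr1n// -(pmulr_lgt0 _ (_ : 0 < 2^-1)) ?invr_gt0.
have v00 : (horner w) 0 = 0 :> R.
  by case/dvdpP: w8 => u ->; rewrite hornerM hornerXn expr0n mulr0.
have [t [q [x [[oq per xb lv] [[x0 t0] x1 st nd uniq1]]]]] :=
  periodic_chain_exists g2 K0 v00 (divdiffE w) (divdiffC w)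
    (fun s a b => @divdiff_le R w a b s w8)
    (fun s a b c => @divdiff_lipschitz R w a b c s w8) rho0 rho1 kr c1 c2 c3 R00 r10.
have q0 : (0 < q)%N by case: q oq {per uniq1}.
have xrho i : `|x i| <= rho by have := xb i; rewrite le_min => /andP[].
have xR0 i : `|x i| <= R0 by have := xb i; rewrite le_min => /andP[].
set u := x 1%N in x1 uniq1.
have q3 : (2 < q)%N.
  case: q oq q0 per uniq1 => [|[|[|q]]]// _ _ per _.
  by have := per 0%N; rewrite add0n x0 -/u => e1; rewrite e1 ltxx in x1.
have perM i d : x (i + d * q)%N = x i.
  by elim: d => [|d IH]; rewrite ?addn0// mulSn addnCA addnC per.
have x_mod i : x i = x (i %% q)%N by rewrite {1}(divn_eq i q) addnC perM.
(* The point 0 is left out because it lies on every orbit and is taken care of by the factor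
   [X^(8 + k)]; the lists of points must avoid it for the choice of the next radius. *)
pose T := [seq y <- [seq x i | i <- iota 0 q] | (y != 0) && (y != u)].
have xT i : [|| x i == 0, x i == u | x i \in T].
  case: (eqVneq (x i) 0) => //= xi0; case: (eqVneq (x i) u) => //= xiu.
  rewrite mem_filter xi0 xiu /=; apply/mapP; exists (i %% q)%N; last exact: x_mod.
  by rewrite mem_iota add0n ltn_mod.
pose f := \prod_(s <- S ++ T) ('X - s%:P) ^+ 2.
pose p0 : {poly R} := 'X^(8 + k) * f * ('X - u%:P).
have dv_f s : s \in S ++ T -> ('X - s%:P) ^+ 2 %| p0.
  move=> sST; rewrite /p0 dvdp_mulr// dvdp_mull// /f.
  by rewrite (perm_big _ (perm_to_rem sST)) big_cons dvdp_mulr.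
have u_notin : u \notin S ++ T.
  rewrite mem_cat mem_filter eqxx andbF orbF; apply/negP => /R0S.
  by rewrite ltNge xR0.
have u0 : u != 0 by rewrite gt_eqF.
have p0u : p0.[u] = 0 by rewrite /p0 hornerM hornerXsubC subrr mulr0.
have d_ne : p0^`().[u] != 0.
  have -> : p0^`().[u] = u ^+ (8 + k) * f.[u].
    rewrite /p0; set A := 'X^(8 + k) * f.
    rewrite derivM derivXsubC mulr1 hornerD hornerM hornerXsubC subrr mulr0 add0r /A.
    by rewrite hornerM hornerXn.
  rewrite mulf_neq0 ?expf_neq0// /f horner_prod prodf_seq_neq0.
  apply/allP => s sST /=; rewrite horner_exp hornerXsubC expf_neq0// subr_eq0.
  by apply: contraNneq u_notin => ->.
have p00 : p0.[0] = 0 /\ p0^`().[0] = 0.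
  apply: double_root_deriv; rewrite subr0 /p0 dvdp_mulr// dvdp_mulr// dvdp_exp2l//.
have p0x i : p0.[x i] = 0.
  case/or3P: (xT i) => [/eqP->|/eqP->|xi]; [exact: p00.1 | exact: p0u |].
  by apply: (double_root_deriv _).1; apply: dv_f; rewrite mem_cat xi orbT.
have dp0x i : x i != u -> p0^`().[x i] = 0.
  move=> xiu; case/or3P: (xT i) => [/eqP->|/eqP e1|xi]; [exact: p00.2 | by rewrite e1 eqxx in xiu |].
  by apply: (double_root_deriv _).2; apply: dv_f; rewrite mem_cat xi orbT.
pose N i := slope_fst g (horner w^`()) t (x i) (x i.+1).
pose D i := slope_fst g (horner w^`()) t (x i.+1) (x i).
have perN i : N (i + q)%N = N i by rewrite /N -addSn !per.
have perD i : D (i + q)%N = D i by rewrite /D -addSn !per.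
have D0 i : D i != 0.
  rewrite -perD -(prednK q0) addnS.
  apply: (slope_snd_neq0 g2 w8 rho1 kr (xrho (i + q.-1)%N) (xrho _) (st _) (nd _)).
have [b [/andP[b0 ba] bD bND]] : exists b, [/\ 0 < b <= e / (coef_norm p0 + 1),
   D 0%N + b * p0^`().[u] != 0 &
   ((\prod_(i < q | i != 1%N :> nat) N i) * (N 1%N + b * p0^`().[u])) ^+ 2 !=
   ((\prod_(i < q | i != 0%N :> nat) D i) * (D 0%N + b * p0^`().[u])) ^+ 2].
  apply: avoid_resonance => //.
  - by apply/prodf_neq0 => i _; exact: D0.
  - rewrite /N /D /slope_fst -/u; apply/eqP => h; apply: (nd 0%N).
    have t1 : 1 + t != 0 by rewrite gt_eqF// addr_gt0.
    by apply: (mulfI t1); move: h; lra.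
  - by rewrite divr_gt0// ltr_wpDl// coef_norm_ge0.
pose p := b *: p0; pose w' := w + p.
have ev i : w'.[x i] = w.[x i] by rewrite /w' hornerD hornerZ p0x mulr0 addr0.
have ed i : w'^`().[x i] = w^`().[x i] + b * p0^`().[x i].
  by rewrite /w' derivD derivZ hornerD hornerZ.
have u_mod i : x i = u -> (i %% q)%N = 1%N.
  by move=> /uniq1 ->; rewrite modn_small// ltnW.
have D' i : slope_fst g (horner w'^`()) t (x i.+1) (x i) = D i + b * p0^`().[x i.+1].
  by rewrite /D /slope_fst ed addrA.
have N' i : slope_fst g (horner w'^`()) t (x i) (x i.+1) = N i + b * p0^`().[x i].
  by rewrite /N /slope_fst ed addrA.
have prodD : \prod_(i < q) slope_fst g (horner w'^`()) t (x i.+1) (x i) =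
    (\prod_(i < q | i != 0%N :> nat) D i) * (D 0%N + b * p0^`().[u]).
  rewrite (bigD1 (Ordinal q0))//= D' mulrC; congr (_ * _).
  apply: eq_big => [i|i i0] //; rewrite D' dp0x ?mulr0 ?addr0//.
  apply/eqP => /u_mod; have [iq|qi] := ltnP i.+1 q.
    by rewrite modn_small// => -[i1]; rewrite -val_eqE /= i1 in i0.
  have -> : i.+1 = q by apply/eqP; rewrite eqn_leq qi andbT.
  by rewrite modnn.
have prodN : \prod_(i < q) slope_fst g (horner w'^`()) t (x i) (x i.+1) =
    (\prod_(i < q | i != 1%N :> nat) N i) * (N 1%N + b * p0^`().[u]).
  have q1 : (1 < q)%N by exact: ltnW.
  rewrite (bigD1 (Ordinal q1))//= N' mulrC; congr (_ * _).
  apply: eq_big => [i|i i0] //; rewrite N' dp0x ?mulr0 ?addr0//.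
  by apply/eqP => /u_mod; rewrite modn_small// => i1; rewrite -val_eqE /= i1 in i0.
have prod2 (F : nat -> R) : (forall i, F (i + q)%N = F i) ->
    \prod_(i < q + q) F i = (\prod_(i < q) F i) ^+ 2.
  move=> perF; rewrite big_split_ord expr2 /=; congr (_ * _).
  by apply: eq_bigr => i _; rewrite addnC perF.
(* The odd period is doubled, which makes it even and squares both products. *)
exists p, t, (q + q)%N, x, (u :: T); split; split.
- by rewrite dvdpZr ?gt_eqF// /p0 -mulrA dvdp_mulr.
- apply: le_trans (coef_normZ _ _) _; rewrite (gtr0_norm b0).
  have := ba; rewrite ler_pdivlMr; last by rewrite ltr_wpDl// coef_norm_ge0.
  by rewrite mulrDr mulr1; have := coef_norm_ge0 p0; have := ltW b0; lra.
- move=> s sS; rewrite derivZ !hornerZ.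
  have [|-> ->] := @double_root_deriv p0 s; last by rewrite !mulr0.
  by apply: dv_f; rewrite mem_cat sS.
- split; split.
  + by rewrite addn_gt0 q0.
  + by rewrite addnn odd_double.
  + by move=> i; rewrite addnA !per.
  + by move=> i; rewrite /on_level !ev; exact: lv.
  + exact: nd.
  + move=> i; rewrite D'; case: (eqVneq (x i.+1) u) => [e1|/dp0x ->]; last by rewrite mulr0 addr0.
    suff -> : D i = D 0%N by rewrite e1.
    have /eqP := u_mod _ e1; rewrite -[i.+1]addn1 -[X in _ == X](modn_small (ltnW q3)).
    rewrite -[X in _ == X %[mod _]]add0n eqn_modDr mod0n => /eqP iq.
    by rewrite /D (x_mod i) iq (x_mod i.+1) -addn1 -modnDml iq add0n modn_small// ltnW.
  + rewrite (prod2 (fun i => slope_fst g (horner w'^`()) t (x i) (x i.+1))).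
      rewrite (prod2 (fun i => slope_fst g (horner w'^`()) t (x i.+1) (x i))).
        by rewrite prodD prodN.
      by move=> i; rewrite -addSn !per.
    by move=> i; rewrite -addSn !per.
- by move=> i; exact: le_trans (xR0 i) R0e.
- by move=> i; rewrite !inE; case/or3P: (xT i) => ->; rewrite ?orbT.
- by rewrite inE negb_or eq_sym u0 mem_filter eqxx.
Qed.

End Stage.

(** * Complex differentiability and the identity theorem *)

Lemma continuous_primitive (R : realType) (f : R -> R) (a b : R) : a < b ->
  (forall x, a <= x <= b -> {for x, continuous f}) ->
  exists F : R -> R, forall x, a < x < b -> is_derive x 1 F (f x).
Proof.
move=> ab cf.
have fi : lebesgue_measure.-integrable `[a, b] (EFin \o f).
  apply: continuous_compact_integrable; first exact: segment_compact.
  apply: continuous_in_subspaceT => x; rewrite inE /= in_itv /= => xab.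
  exact: cf.
exists (fun y => (\int[lebesgue_measure]_(t in [set` `[a, y]]) (f t))%R) => x.
move=> /andP[ax xb].
have [|d e] := continuous_FTC1_closed xb fi ax; first by apply: cf; rewrite !ltW.
by rewrite -e derive1E; exact/derivableP.
Qed.

Lemma increment_affine_le (R : realType) (F f : R -> R) (a b p q e : R) :
  a <= b -> (forall x, a <= x <= b -> is_derive x 1 F (f x)) ->
  (forall x, a <= x <= b -> `|f x - (p + q * x)| <= e) ->
  `|F b - F a - (p * (b - a) + q * (b ^+ 2 - a ^+ 2) / 2)| <= e * (b - a).
Proof.
move=> ab dF fe; pose G : R -> R := F - (p *: id + (q / 2) *: (id * id)).
have dG x : a <= x <= b -> is_derive x 1 G (f x - (p + q * x)).
  move=> /dF dFx; rewrite /G.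
  have di : is_derive x 1 (id : R -> R) 1 by exact: is_derive_id.
  apply: is_derive_eq (is_deriveB dFx (is_deriveD (is_deriveZ p di)
    (is_deriveZ (q / 2) (is_deriveM di di)))) _.
  by rewrite /GRing.scale /=; field.
have [x|| z] := @MVT_segment R G (fun x => f x - (p + q * x)) a b ab.
- by rewrite in_itv /= => /andP[? ?]; apply: dG; rewrite !ltW.
- apply: derivable_within_continuous => x; rewrite in_itv /= => xab.
  by have := dG _ xab; case.
rewrite in_itv /= => zab; rewrite /G /= !fctE /GRing.scale /= => e1.
have -> : F b - F a - (p * (b - a) + q * (b ^+ 2 - a ^+ 2) / 2)
   = (f z - (p + q * z)) * (b - a) by rewrite -e1; field.
by rewrite normrM (ger0_norm (_ : 0 <= b - a)) ?subr_ge0// ler_wpM2r ?subr_ge0// fe.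
Qed.

(** The integral of [P ds + Q dt] counterclockwise round the rectangle, where [A] is a primitive of
    [P] in [s] along horizontal lines and [B] one of [Q] in [t] along vertical lines. For [P = Im g]
    and [Q = Re g] it is the imaginary part of the contour integral of [g dz]. *)
Definition rect_int (R : realType) (A B : R -> R -> R) (a b c d : R) : R :=
  A b c - A a c + (B b d - B b c) - (A b d - A a d) - (B a d - B a c).

Definition diff2_at (R : realType) (P : R -> R -> R) (x y px py : R) : Prop :=
  forall e : R, 0 < e -> exists2 r : R, 0 < r & forall s t, `|s - x| < r -> `|t - y| < r ->
    `|P s t - (P x y + px * (s - x) + py * (t - y))| <= e * (`|s - x| + `|t - y|).

(** The two affine approximations share the mixed coefficient [py], so they define a closed form
    whose integral cancels; only the errors along the four sides remain. *)
Lemma rect_int_affine_le (R : realType) (A B P Q : R -> R -> R)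
    (a b c d p0 px py q0 qy e : R) : a <= b -> c <= d ->
  (forall s t, a <= s <= b -> c <= t <= d -> is_derive s 1 (A^~ t) (P s t)) ->
  (forall s t, a <= s <= b -> c <= t <= d -> is_derive t 1 (B s) (Q s t)) ->
  (forall s t, a <= s <= b -> c <= t <= d ->
     `|P s t - (p0 + px * s + py * t)| <= e) ->
  (forall s t, a <= s <= b -> c <= t <= d ->
     `|Q s t - (q0 + py * s + qy * t)| <= e) ->
  `|rect_int A B a b c d| <= 2 * e * ((b - a) + (d - c)).
Proof.
move=> ab cd dA dB eP eQ.
have hA t : c <= t <= d ->
    `|A b t - A a t - ((p0 + py * t) * (b - a) + px * (b ^+ 2 - a ^+ 2) / 2)|
    <= e * (b - a).
  move=> tcd; apply: (@increment_affine_le R (A^~ t) (P^~ t)) => // s sab; first exact: dA.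
  by rewrite addrAC; exact: eP.
have hB s : a <= s <= b ->
    `|B s d - B s c - ((q0 + py * s) * (d - c) + qy * (d ^+ 2 - c ^+ 2) / 2)|
    <= e * (d - c).
  move=> sab; apply: (@increment_affine_le R (B s) (Q s)) => // t tcd; first exact: dB.
  exact: eQ.
have aab : a <= a <= b by rewrite lexx. have bab : a <= b <= b by rewrite lexx andbT.
have ccd : c <= c <= d by rewrite lexx. have dcd : c <= d <= d by rewrite lexx andbT.
move: (hA c ccd) (hA d dcd) (hB a aab) (hB b bab); rewrite /rect_int !ler_norml.
move=> /andP[? ?] /andP[? ?] /andP[? ?] /andP[? ?]; apply/andP; split; lra.
Qed.

Lemma nested_intervals (R : realType) (f g : nat -> R) : (forall n, 0 <= g n) ->
  (forall n, f n <= f n.+1 /\ f n.+1 + g n.+1 <= f n + g n) ->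
  exists x, forall n, f n <= x <= f n + g n.
Proof.
move=> g0 fg1.
have fg n m : f n <= f (m + n)%N /\ f (m + n)%N + g (m + n)%N <= f n + g n.
  elim: m => [|m [IH1 IH2]] //; rewrite addSn; have [q1 q2] := fg1 (m + n)%N.
  by split; [exact: le_trans IH1 q1 | exact: le_trans q2 IH2].
exists (sup (range f)) => n.
have ub : ubound (range f) (f n + g n).
  move=> _ [m _ <-]; apply: (@le_trans _ _ (f (n + m)%N)); first exact: (fg m n).1.
  have := (fg n m).2; rewrite addnC => q; apply: le_trans q.
  by rewrite lerDl.
apply/andP; split.
  by apply: ub_le_sup; [exists (f n + g n) | exists n].
by apply: ge_sup => //; exists (f 0%N), 0%N.
Qed.

(** Bisection: one quarter always carries at least a quarter of the integral, and the quarters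
    shrink to a point. There the common [py], a Cauchy-Riemann equation, makes the linear
    approximation closed, so the integral is of smaller order than the area scale [4 ^ -n]. *)
Lemma goursat (R : realType) (A B P Q : R -> R -> R) (a b c d : R) : a <= b -> c <= d ->
  (forall s t, a <= s <= b -> c <= t <= d -> is_derive s 1 (A^~ t) (P s t)) ->
  (forall s t, a <= s <= b -> c <= t <= d -> is_derive t 1 (B s) (Q s t)) ->
  (forall s t, a <= s <= b -> c <= t <= d -> exists px py qy,
     diff2_at P s t px py /\ diff2_at Q s t py qy) ->
  rect_int A B a b c d = 0.
Proof.
move=> ab cd dA dB dPQ; apply/eqP; apply: contraT => RI0.
set M := `|rect_int A B a b c d|; have M0 : 0 < M by rewrite normr_gt0.
pose h n : R := (b - a) / 2 ^+ n; pose k n : R := (d - c) / 2 ^+ n.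
have p2 n : 0 < (2 : R) ^+ n by rewrite exprn_gt0.
have h0 n : 0 <= h n by rewrite divr_ge0 ?subr_ge0// ltW.
have k0 n : 0 <= k n by rewrite divr_ge0 ?subr_ge0// ltW.
have hS n : h n.+1 = h n / 2 by rewrite /h exprS; field; rewrite gt_eqF.
have kS n : k n.+1 = k n / 2 by rewrite /k exprS; field; rewrite gt_eqF.
pose good n (w : R * R) := [/\ a <= w.1, w.1 + h n <= b, c <= w.2, w.2 + k n <= d
  & M <= 4 ^+ n * `|rect_int A B w.1 (w.1 + h n) w.2 (w.2 + k n)|].
have step (nw : nat * (R * R)) : exists w', good nw.1 nw.2 ->
    [/\ good nw.1.+1 w', nw.2.1 <= w'.1, w'.1 + h nw.1.+1 <= nw.2.1 + h nw.1,
     nw.2.2 <= w'.2 & w'.2 + k nw.1.+1 <= nw.2.2 + k nw.1].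
  case: nw => n [u v] /=.
  have [g|ng] := pselect (good n (u, v)); last by exists (0, 0) => /ng.
  case: g => /= au ub cv vd MI.
  have := h0 n; have := k0 n; rewrite /good !hS !kS => kn0 hn0.
  set I1 := rect_int A B u (u + h n / 2) v (v + k n / 2).
  set I2 := rect_int A B (u + h n / 2) (u + h n / 2 + h n / 2) v (v + k n / 2).
  set I3 := rect_int A B u (u + h n / 2) (v + k n / 2) (v + k n / 2 + k n / 2).
  set I4 := rect_int A B (u + h n / 2) (u + h n / 2 + h n / 2)
     (v + k n / 2) (v + k n / 2 + k n / 2).
  have E : rect_int A B u (u + h n) v (v + k n) = I1 + I2 + I3 + I4.
    rewrite /I1 /I2 /I3 /I4 /rect_int -!addrA -!splitr; ring.
  have tri : `|rect_int A B u (u + h n) v (v + k n)| <= `|I1| + `|I2| + `|I3| + `|I4|.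
    by rewrite E; do 2! (apply: le_trans (ler_normD _ _) _; rewrite lerD2r); exact: ler_normD.
  have {}tri : M <= 4 ^+ n * `|I1| + 4 ^+ n * `|I2| + 4 ^+ n * `|I3| + 4 ^+ n * `|I4|.
    by rewrite -!mulrDr; apply: le_trans MI _; rewrite ler_wpM2l// exprn_ge0.
  rewrite !exprS.
  have [m1|m1] := leP M (4 * 4 ^+ n * `|I1|); first (exists (u, v) => _;
    by split => //=; first split => //=; move: m1 hn0 kn0 au ub cv vd; clear; lra).
  have [m2|m2] := leP M (4 * 4 ^+ n * `|I2|); first (exists (u + h n / 2, v) => _;
    by split => //=; first split => //=; move: m2 hn0 kn0 au ub cv vd; clear; lra).
  have [m3|m3] := leP M (4 * 4 ^+ n * `|I3|); first (exists (u, v + k n / 2) => _;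
    by split => //=; first split => //=; move: m3 hn0 kn0 au ub cv vd; clear; lra).
  have [m4|m4] := leP M (4 * 4 ^+ n * `|I4|); first (exists (u + h n / 2, v + k n / 2) => _;
    by split => //=; first split => //=; move: m4 hn0 kn0 au ub cv vd; clear; lra).
  exfalso; lra.
have [next nextP] := choice step.
pose w := fix w n := if n is n'.+1 then next (n', w n') else (a, c).
have gw n : good n (w n).
  elim: n => [|n IH] /=; last by have [] := nextP (n, w n) IH.
  by split; rewrite /= ?lexx// /h /k expr0 ?divr1 ?mul1r ?subrKC.
have mono n : [/\ (w n).1 <= (w n.+1).1, (w n.+1).1 + h n.+1 <= (w n).1 + h n,
    (w n).2 <= (w n.+1).2 & (w n.+1).2 + k n.+1 <= (w n).2 + k n].
  by have [_ ? ? ? ?] := nextP (n, w n) (gw n).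
have [x xP] := nested_intervals (f := fun n => (w n).1) h0
  (fun n => let: And4 q1 q2 _ _ := mono n in conj q1 q2).
have [y yP] := nested_intervals (f := fun n => (w n).2) k0
  (fun n => let: And4 _ _ q1 q2 := mono n in conj q1 q2).
have xab : a <= x <= b.
  by have [q1 q2 _ _ _] := gw 0%N; have := xP 0%N; lra.
have ycd : c <= y <= d.
  by have [_ _ q1 q2 _] := gw 0%N; have := yP 0%N; lra.
have [px [py [qy [dP dQ]]]] := dPQ x y xab ycd.
pose L := (b - a) + (d - c).
have L0 : 0 <= L by rewrite addr_ge0 ?subr_ge0.
have key e : 0 < e -> M <= 2 * (e * L) * L.
  move=> e0; have [r1 r10 H1] := dP e e0; have [r2 r20 H2] := dQ e e0.
  have [n nP] : exists n : nat, L < 2 ^+ n * Num.min r1 r2.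
    have m0 : 0 < Num.min r1 r2 by rewrite lt_min r10.
    exists (Num.bound (L / Num.min r1 r2)).
    rewrite -ltr_pdivrMr//; apply: lt_le_trans (archi_boundP _) _.
      by rewrite divr_ge0// ltW.
    by rewrite -natrX ler_nat ltnW// ltn_expl.
  have hkL : h n + k n = L / 2 ^+ n by rewrite /h /k -mulrDl.
  have small : h n + k n < Num.min r1 r2 by rewrite hkL ltr_pdivrMr// mulrC.
  have := small; rewrite lt_min => /andP[s1 s2].
  have [q1 q2 q3 q4] := gw n; set u := (w n).1 in q1 q2 *; set v := (w n).2 in q3 q4 *.
  have := xP n; have := yP n; rewrite -/u -/v => yv xu.
  have hn := h0 n; have kn := k0 n.
  move=> MI; have := @rect_int_affine_le R A B P Q u (u + h n) v (v + k n)
    (P x y - px * x - py * y) px py (Q x y - py * x - qy * y) qy (e * (h n + k n)).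
  rewrite ![_ + h n]addrC ![_ + k n]addrC !addrK ![h n + _]addrC ![k n + _]addrC.
  have in1 s : u <= s <= u + h n -> a <= s <= b by move: q1 q2; clear; lra.
  have in2 t : v <= t <= v + k n -> c <= t <= d by move: q3 q4; clear; lra.
  have near s t : u <= s <= u + h n -> v <= t <= v + k n ->
     [/\ `|s - x| <= h n, `|t - y| <= k n & `|s - x| + `|t - y| <= h n + k n].
    move=> su tv; have p1 : `|s - x| <= h n by rewrite ler_norml; move: xu su; clear; lra.
    have p3 : `|t - y| <= k n by rewrite ler_norml; move: yv tv; clear; lra.
    by split => //; rewrite lerD.
  have nearP s t (r : R) : h n + k n < r -> u <= s <= u + h n -> v <= t <= v + k n ->
     `|s - x| < r /\ `|t - y| < r.
    by move=> hr su tv; have [a1 a2 _] := near s t su tv;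
      split; apply: le_lt_trans hr; [rewrite (le_trans a1)// lerDl | rewrite (le_trans a2)// lerDr].
  move=> /(_ _ _ _ _ _ _)/wrap[]; rewrite ?lerDl//.
  - by move=> s t su tv; apply: dA; [exact: in1 | exact: in2].
  - by move=> s t su tv; apply: dB; [exact: in1 | exact: in2].
  - move=> s t su tv; have [? ?] := nearP s t r1 s1 su tv.
    have [_ _ le] := near s t su tv.
    apply: le_trans (ler_wpM2l (ltW e0) le); apply: le_trans (H1 s t _ _) => //.
    by rewrite le_eqVlt; apply/orP; left; apply/eqP; congr `|_|; ring.
  - move=> s t su tv; have [? ?] := nearP s t r2 s2 su tv.
    have [_ _ le] := near s t su tv.
    apply: le_trans (ler_wpM2l (ltW e0) le); apply: le_trans (H2 s t _ _) => //.
    by rewrite le_eqVlt; apply/orP; left; apply/eqP; congr `|_|; ring.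
  rewrite hkL => le; apply: le_trans MI _.
  have /(ler_wpM2l (ltW (_ : 0 < 4 ^+ n))) := le; rewrite exprn_gt0// => /(_ isT).
  move=> /le_trans; apply; rewrite le_eqVlt; apply/orP; left; apply/eqP.
  have -> : (4 : R) ^+ n = 2 ^+ n * 2 ^+ n by rewrite -exprMn; congr (_ ^+ n); ring.
  by field; rewrite gt_eqF.
have [L00|Lp] := eqVneq L 0.
  by have := key 1 ltr01; rewrite L00 !mulr0 leNgt M0.
have {}Lp : 0 < L by rewrite lt_neqAle eq_sym Lp.
have := key (M / (4 * L ^+ 2)) (divr_gt0 M0 (mulr_gt0 _ (exprn_gt0 _ Lp))).
rewrite (_ : 2 * _ * L = M / 2); last by field; rewrite gt_eqF.
by move=> /(_ (ltr0n _ 4)); lra.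
Qed.

(** Carathéodory's form of the derivative: the difference quotient extends continuously to [z]. The
    product and chain rules become identities between the continuous factors. *)
Definition cdiff (K : numFieldType) (g : K -> K) (z d : K) : Prop :=
  exists2 f : K -> K, {for z, continuous f} &
    f z = d /\ forall w, g w = g z + f w * (w - z).

Section CDiff.
Variable K : numFieldType.
Implicit Types (g h : K -> K) (z d : K).

Lemma for_contP g z : {for z, continuous g} <->
  forall e : K, 0 < e -> \forall w \near z, `|g z - g w| <= e.
Proof. exact: (@cvgrPdist_le K K K (nbhs z) _ g (g z)). Qed.

Lemma for_cont_near g h z : (\forall w \near z, g w = h w) ->
  {for z, continuous g} -> {for z, continuous h}.
Proof.
move=> gh /for_contP cg; apply/for_contP => e e0; have gz := nbhs_singleton gh.
by move: gh (cg e e0); apply: filterS2 => w <-; rewrite -gz.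
Qed.

Lemma for_contV g z : g z != 0 -> {for z, continuous g} ->
  {for z, continuous (fun w => (g w)^-1)}.
Proof. by move=> gz cg; exact: (@cvgV K _ (nbhs z) _ g (g z)). Qed.

Lemma for_contD g h z : {for z, continuous g} -> {for z, continuous h} ->
  {for z, continuous (fun w => g w + h w)}.
Proof. by move=> cg ch; exact: (@cvgD K K _ (nbhs z) _ g h). Qed.

Lemma for_contN g z : {for z, continuous g} -> {for z, continuous (fun w => - g w)}.
Proof. by move=> cg; exact: (@cvgN K K _ (nbhs z) _ g). Qed.

Lemma for_contM g h z : {for z, continuous g} -> {for z, continuous h} ->
  {for z, continuous (fun w => g w * h w)}.
Proof. by move=> cg ch; exact: (@cvgM K _ (nbhs z) _ g h). Qed.

Lemma for_cont_id z : {for z, continuous (id : K -> K)}.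
Proof. by []. Qed.

Lemma for_cont_cst c z : {for z, continuous (fun=> c : K)}.
Proof. exact: (@cvg_cst _ _ _ (nbhs z)). Qed.

Lemma cdiff_continuous g z d : cdiff g z d -> {for z, continuous g}.
Proof.
case=> f cf [_ gE].
rewrite (_ : g = fun w => g z + f w * (w - z)); last exact/funext.
apply: for_contD; first exact: for_cont_cst.
apply: for_contM => //; apply: for_contD; [exact: for_cont_id | exact: for_cont_cst].
Qed.

Lemma cdiffP g z d : cdiff g z d <->
  forall e : K, 0 < e -> \forall w \near z, `|g w - g z - d * (w - z)| <= e * `|w - z|.
Proof.
split=> [[f cf [fz gE]] e e0|H].
  have /for_contP/(_ e e0) := cf; apply: filterS => w fw.
  rewrite (_ : _ - _ = (f w - f z) * (w - z)); last by rewrite fz (gE w); ring.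
  by rewrite normrM ler_wpM2r// distrC.
exists (fun w => if w == z then d else (g w - g z) / (w - z)); last first.
  split=> [|w]; first by rewrite eqxx.
  case: eqVneq => [->|wz]; first by rewrite subrr mulr0 addr0.
  by rewrite divfK ?subr_eq0// subrKC.
apply/for_contP => e e0; have := H e e0; apply: filterS => w.
rewrite eqxx; case: eqVneq => [->|wz]; first by move=> _; rewrite !subrr normr0 ltW.
rewrite distrC => gw; rewrite -(@ler_pM2r _ `|w - z|) ?normr_gt0 ?subr_eq0//.
by rewrite -normrM mulrBl divfK ?subr_eq0.
Qed.

Lemma cdiff_near g h z d : (\forall w \near z, g w = h w) -> cdiff g z d -> cdiff h z d.
Proof.
move=> gh /cdiffP dg; apply/cdiffP => e e0; have gz := nbhs_singleton gh.
by move: gh (dg e e0); apply: filterS2 => w <-; rewrite -gz.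
Qed.

Lemma cdiff_cst c z : cdiff (fun=> c) z 0.
Proof. by exists (fun=> 0); [exact: for_cont_cst | split=> // w; ring]. Qed.

Lemma cdiff_id z : cdiff id z 1.
Proof. by exists (fun=> 1); [exact: for_cont_cst | split=> // w /=; ring]. Qed.

Lemma cdiffD g h z d d' : cdiff g z d -> cdiff h z d' ->
  cdiff (fun w => g w + h w) z (d + d').
Proof.
case=> [f cf [fz gE]] [f' cf' [fz' hE]]; exists (fun w => f w + f' w); first exact: for_contD.
by split=> [|w]; rewrite ?fz ?fz'// (gE w) (hE w); ring.
Qed.

Lemma cdiffM g h z d d' : cdiff g z d -> cdiff h z d' ->
  cdiff (fun w => g w * h w) z (d * h z + g z * d').
Proof.
move=> dg dh; have ch := cdiff_continuous dh.
case: dg dh => [f cf [fz gE]] [f' cf' [fz' hE]].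
exists (fun w => f w * h w + g z * f' w).
  by apply: for_contD; apply: for_contM => //; exact: for_cont_cst.
by split=> [|w]; rewrite ?fz ?fz'// (gE w) (hE w); ring.
Qed.

Lemma cdiffN g z d : cdiff g z d -> cdiff (fun w => - g w) z (- d).
Proof.
case=> [f cf [fz gE]]; exists (fun w => - f w); first exact: for_contN.
by split=> [|w]; rewrite ?fz// (gE w); ring.
Qed.

Lemma cdiffB g h z d d' : cdiff g z d -> cdiff h z d' ->
  cdiff (fun w => g w - h w) z (d - d').
Proof. by move=> dg dh; apply: cdiffD => //; exact: cdiffN. Qed.

Lemma cdiff_comp g h z d d' : cdiff h (g z) d' -> cdiff g z d ->
  cdiff (fun w => h (g w)) z (d' * d).
Proof.
move=> dh dg; have cg := cdiff_continuous dg.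
case: dg dh => [f cf [fz gE]] [f' cf' [fz' hE]].
exists (fun w => f' (g w) * f w).
  by apply: for_contM => //; exact: (@cvg_comp _ _ _ g f' _ _ _ cg cf').
split=> [|w]; first by rewrite fz fz'.
by rewrite (hE (g w)) -mulrA -(_ : g w - g z = f w * (w - z))// {1}(gE w); ring.
Qed.

Lemma cdiffV g z d : cdiff g z d -> g z != 0 ->
  cdiff (fun w => (g w)^-1) z (- d / g z ^+ 2).
Proof.
move=> dg gz0; have cg := cdiff_continuous dg; case: (dg) => [f cf [fz gE]].
have nz : \forall w \near z, g w != 0.
  have /(@cvgrPdist_lt K K K (nbhs z) _ g (g z))/(_ `|g z|) := cg; rewrite normr_gt0 => /(_ gz0).
  by apply: filterS => w; apply: contraTneq => ->; rewrite subr0 ltxx.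
exists (fun w => if g w == 0 then ((g w)^-1 - (g z)^-1) / (w - z) else - f w / (g w * g z)).
  apply: (@for_cont_near (fun w => - f w * (g w * g z)^-1)).
    by apply: filterS nz => w gw; rewrite (negbTE gw).
  apply: for_contM; first exact: for_contN.
  by apply: for_contV; [rewrite mulf_neq0 | apply: for_contM => //; exact: for_cont_cst].
split=> [|w]; first by rewrite (negbTE gz0) fz expr2.
have [->|wz] := eqVneq w z; first by rewrite !subrr mulr0 addr0.
case: ifPn => gw; first by rewrite divfK ?subr_eq0// subrKC.
have e : f w = (g w - g z) / (w - z) by rewrite (gE w) addrC addKr mulfK// subr_eq0.
by rewrite e; field; rewrite gz0 gw subr_eq0 wz.
Qed.

Lemma cdiffX g z d n : cdiff g z d -> cdiff (fun w => g w ^+ n) z (n%:R * g z ^+ n.-1 * d).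
Proof.
move=> dg; elim: n => [|[|n] IH] /=.
- by rewrite !mul0r; exact: cdiff_cst.
- by rewrite expr0 !mul1r.
- have := cdiffM dg IH; rewrite (_ : _ + _ = n.+2%:R * g z ^+ n.+1 * d) //=.
  by rewrite exprS (natrD _ 1 n.+1) mulr1n /= ; ring.
Qed.

End CDiff.

Import Normc.
Local Open Scope complex_scope.

Section NormC.
Variable R : realType.
Implicit Types z w : R[i].

Lemma normcD_le z w : normc (z + w) <= normc z + normc w.
Proof. exact: le_normcD. Qed.

Lemma normcB_le z w : normc (z - w) <= normc z + normc w.
Proof. by apply: le_trans (normcD_le z (- w)) _; rewrite normcN. Qed.

Lemma normc_dist z w : normc (z - w) = normc (w - z).
Proof. by rewrite -opprB normcN. Qed.

Lemma normc_ge0 z : 0 <= normc z.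
Proof. by case: z => a b; exact: sqrtr_ge0. Qed.

Lemma normc_eq0 z : (normc z == 0) = (z == 0).
Proof. by apply/eqP/eqP => [/eq0_normc //|->]; rewrite normc0. Qed.

Lemma normc_gt0 z : (0 < normc z) = (z != 0).
Proof. by rewrite lt_neqAle normc_ge0 andbT eq_sym normc_eq0. Qed.

Lemma normcX z n : normc (z ^+ n) = normc z ^+ n.
Proof. by elim: n => [|n IH]; rewrite ?normc1// !exprS normcM IH. Qed.

Lemma normc_conj z : normc (conjc z) = normc z.
Proof. by case: z => a b /=; rewrite sqrrN. Qed.

Lemma normc_real (x : R) : normc x%:C = `|x|.
Proof. by rewrite /= expr0n /= addr0 sqrtr_sqr. Qed.

Lemma Re_le_normc z : `|complex.Re z| <= normc z.
Proof. by case: z => a b /=; rewrite -sqrtr_sqr ler_wsqrtr// lerDl sqr_ge0. Qed.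

Lemma Im_le_normc z : `|complex.Im z| <= normc z.
Proof. by case: z => a b /=; rewrite -sqrtr_sqr ler_wsqrtr// lerDr sqr_ge0. Qed.

Lemma normc_le_ReIm z : normc z <= `|complex.Re z| + `|complex.Im z|.
Proof.
case: z => a b /=; rewrite -ler_sqr ?nnegrE ?sqrtr_ge0 ?addr_ge0//.
rewrite sqr_sqrtr ?addr_ge0 ?sqr_ge0// sqrrD !real_normK ?num_real//.
by rewrite lerD2r lerDl mulrn_wge0// mulr_ge0.
Qed.

Lemma conjcB z w : conjc (z - w) = conjc z - conjc w.
Proof. exact: rmorphB. Qed.

Lemma conjcD z w : conjc (z + w) = conjc z + conjc w.
Proof. exact: rmorphD. Qed.

Lemma conjcM z w : conjc (z * w) = conjc z * conjc w.
Proof. exact: rmorphM. Qed.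

Lemma conjcX z n : conjc (z ^+ n) = conjc z ^+ n.
Proof. exact: rmorphXn. Qed.

Lemma CC_normE (z : CC R) : `|z| = (normc z)%:C.
Proof. by []. Qed.

Lemma CC_gt0 (e : CC R) : 0 < e -> exists2 r : R, 0 < r & e = r%:C.
Proof.
case: e => a b; rewrite ltcE /= => /andP[/eqP-> a0]; by exists a.
Qed.

Lemma near_CC (z : CC R) (P : CC R -> Prop) : (\forall w \near z, P w) <->
  exists2 r : R, 0 < r & forall w : CC R, normc (w - z) < r -> P w.
Proof.
split.
  move=> /nbhs_normP[e /= /CC_gt0[r r0 ->]] H; exists r => // w wz; apply: H => /=.
  by rewrite CC_normE ltcR normc_dist.
case=> r r0 H; apply/nbhs_normP; exists r%:C; first by rewrite /= ltcR.
by move=> w /=; rewrite CC_normE ltcR normc_dist; exact: H.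
Qed.

Lemma continuous_CC (g : CC R -> CC R) (z : CC R) : {for z, continuous g} <->
  forall e : R, 0 < e -> exists2 r : R, 0 < r &
    forall w, normc (w - z) < r -> normc (g w - g z) <= e.
Proof.
split.
  move=> /for_contP H e e0; have e0' : 0 < (e%:C : CC R) by rewrite ltcR.
  have /near_CC[r r0 K] := H _ e0'; exists r => // w /K.
  by rewrite CC_normE lecR normc_dist.
move=> H; apply/for_contP => _ /CC_gt0[e e0 ->]; apply/near_CC.
have [r r0 K] := H e e0; exists r => // w /K.
by rewrite CC_normE lecR normc_dist.
Qed.

Lemma cdiff_CC (g : CC R -> CC R) (z d : CC R) : cdiff g z d <->
  forall e : R, 0 < e -> exists2 r : R, 0 < r &
    forall w, normc (w - z) < r -> normc (g w - g z - d * (w - z)) <= e * normc (w - z).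
Proof.
rewrite cdiffP; split.
  move=> H e e0; have e0' : 0 < (e%:C : CC R) by rewrite ltcR.
  have /near_CC[r r0 K] := H _ e0'; exists r => // w /K.
  by rewrite !CC_normE -(rmorphM (real_complex R)) lecR.
move=> H _ /CC_gt0[e e0 ->]; apply/near_CC.
have [r r0 K] := H e e0; exists r => // w /K.
by rewrite !CC_normE -(rmorphM (real_complex R)) lecR.
Qed.

Lemma cdiff_conj (g : CC R -> CC R) (z d : CC R) : cdiff g (conjc z) d ->
  cdiff (fun w => conjc (g (conjc w))) z (conjc d).
Proof.
move=> /cdiff_CC dg; apply/cdiff_CC => e e0; have [r r0 H] := dg e e0.
exists r => // w wr; rewrite -normc_conj conjcB in wr.
have := H _ wr; rewrite -[X in X <= _]normc_conj !conjcB conjcM conjcB !conjcK.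
by rewrite -(normc_conj (w - z)) conjcB.
Qed.

End NormC.

Lemma increment_gt0 (R : realType) (F f : R -> R) (a b : R) : a < b ->
  (forall x, a <= x <= b -> is_derive x 1 F (f x)) ->
  (forall x, a <= x <= b -> 0 < f x) -> F a < F b.
Proof.
move=> ab dF f0; have [x|| z] := @MVT_segment R F f a b (ltW ab).
- by rewrite in_itv /= => /andP[? ?]; apply: dF; rewrite !ltW.
- apply: derivable_within_continuous => x; rewrite in_itv /= => xab.
  by have := dF _ xab; case.
rewrite in_itv /= => zab e.
by rewrite -subr_gt0 e mulr_gt0 ?subr_gt0// f0.
Qed.

Lemma increment_lt0 (R : realType) (F f : R -> R) (a b : R) : a < b ->
  (forall x, a <= x <= b -> is_derive x 1 F (f x)) ->
  (forall x, a <= x <= b -> f x < 0) -> F b < F a.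
Proof.
move=> ab dF f0; rewrite -ltrN2.
apply: (@increment_gt0 R (- F) (- f)) => // x xab; last by rewrite oppr_gt0 f0.
exact/is_deriveN/dF.
Qed.

(** * Cauchy's theorem and a boundary estimate on a rectangle *)

Section Cauchy.
Variable R : realType.

Lemma section_continuous_Re (g : CC R -> CC R) (s t : R) :
  {for (s +i* t : CC R), continuous g} ->
  {for s, continuous (fun s => complex.Re (g (s +i* t)))} /\
  {for s, continuous (fun s => complex.Im (g (s +i* t)))}.
Proof.
have E w : (w +i* t) - (s +i* t) = (w - s)%:C.
  by apply/eqP; rewrite eq_complex /= subrr !eqxx.
move=> /continuous_CC H; split; apply/for_contP => e e0; have [r r0 K] := H e e0;
  apply/nbhs_normP; exists r => // w /= ws.
  rewrite distrC -raddfB; apply: le_trans (Re_le_normc _) (K _ _).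
  by rewrite E normc_real distrC.
rewrite distrC -raddfB; apply: le_trans (Im_le_normc _) (K _ _).
by rewrite E normc_real distrC.
Qed.

Lemma section_continuous_Im (g : CC R -> CC R) (s t : R) :
  {for (s +i* t : CC R), continuous g} ->
  {for t, continuous (fun t => complex.Re (g (s +i* t)))} /\
  {for t, continuous (fun t => complex.Im (g (s +i* t)))}.
Proof.
have E w : (s +i* w) - (s +i* t) = 'i%C * (w - t)%:C.
  by apply/eqP; rewrite eq_complex /=; apply/andP; split; apply/eqP; ring.
move=> /continuous_CC H; split; apply/for_contP => e e0; have [r r0 K] := H e e0;
  apply/nbhs_normP; exists r => // w /= ws.
  rewrite distrC -raddfB; apply: le_trans (Re_le_normc _) (K _ _).
  by rewrite E normcM normc_real /= expr0n expr1n /= add0r sqrtr1 mul1r distrC.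
rewrite distrC -raddfB; apply: le_trans (Im_le_normc _) (K _ _).
by rewrite E normcM normc_real /= expr0n expr1n /= add0r sqrtr1 mul1r distrC.
Qed.

Lemma cdiff_diff2 (g : CC R -> CC R) (s t : R) (d : CC R) : cdiff g (s +i* t) d ->
  diff2_at (fun s t => complex.Im (g (s +i* t))) s t (complex.Im d) (complex.Re d) /\
  diff2_at (fun s t => complex.Re (g (s +i* t))) s t (complex.Re d) (- complex.Im d).
Proof.
move=> /cdiff_CC H.
have key e : 0 < e -> exists2 r, 0 < r & forall s' t', `|s' - s| < r -> `|t' - t| < r ->
    normc (g (s' +i* t') - g (s +i* t) - d * ((s' +i* t') - (s +i* t))) <=
    e * (`|s' - s| + `|t' - t|).
  move=> e0; have [r r0 K] := H e e0; exists (r / 2); rewrite ?divr_gt0// => s' t' ss tt.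
  have nn : normc ((s' +i* t') - (s +i* t)) <= `|s' - s| + `|t' - t|.
    exact: (normc_le_ReIm ((s' +i* t') - (s +i* t))).
  apply: le_trans (ler_wpM2l (ltW e0) nn); apply: K.
  by apply: le_lt_trans nn _; rewrite (splitr r) ltrD.
split=> e /key[r r0 K]; exists r => // s' t' ss tt; apply: le_trans (K _ _ ss tt).
  apply: le_trans (Im_le_normc _); rewrite le_eqVlt; apply/orP; left; apply/eqP; congr `|_|.
  by rewrite !raddfB /=; case: d {H key K} => d1 d2 /=; ring.
apply: le_trans (Re_le_normc _); rewrite le_eqVlt; apply/orP; left; apply/eqP; congr `|_|.
by rewrite !raddfB /=; case: d {H key K} => d1 d2 /=; ring.
Qed.

Lemma rect_int_frame (A B : R -> R -> R) (a b c d e : R) : rect_int A B a b c d =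
  rect_int A B a (- e) c d + rect_int A B e b c d + rect_int A B (- e) e c (- e)
  + rect_int A B (- e) e e d + rect_int A B (- e) e (- e) e.
Proof. by rewrite /rect_int; ring. Qed.

End Cauchy.

Section CauchyBoundary.
Variable R : realType.

(** Continuity alone suffices at the exceptional point 0: four rectangles framing a small square
    about 0 avoid it and contribute nothing, and the integral round the square tends to 0 with its
    size. *)
Lemma rect_int_cauchy (g : CC R -> CC R) (A B : R -> R -> R) :
  {for 0, continuous g} ->
  (forall s t : R, `|s| <= 1 -> `|t| <= 1 -> s +i* t != 0 -> exists d, cdiff g (s +i* t) d) ->
  (forall s t : R, `|s| <= 1 -> `|t| <= 1 -> is_derive s 1 (A^~ t) (complex.Im (g (s +i* t)))) ->
  (forall s t : R, `|s| <= 1 -> `|t| <= 1 -> is_derive t 1 (B s) (complex.Re (g (s +i* t)))) ->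
  rect_int A B (-1) 1 (-2^-1) (2^-1) = 0.
Proof.
move=> cg hg dA dB.
have goursat0 (a b c d : R) : a <= b -> c <= d -> -1 <= a -> b <= 1 -> -1 <= c -> d <= 1 ->
    (0 < a \/ b < 0 \/ 0 < c \/ d < 0) -> rect_int A B a b c d = 0.
  move=> ab cd a1 b1 c1 d1 out.
  have le1 (x y u : R) : -1 <= x -> y <= 1 -> x <= u <= y -> `|u| <= 1.
    by move=> ? ? /andP[? ?]; rewrite ler_norml; apply/andP; split; lra.
  apply: (@goursat _ A B (fun s t => complex.Im (g (s +i* t)))
     (fun s t => complex.Re (g (s +i* t)))) => //.
  - by move=> s t /(le1 _ _ _ a1 b1) s1 /(le1 _ _ _ c1 d1) t1; exact: dA.
  - by move=> s t /(le1 _ _ _ a1 b1) s1 /(le1 _ _ _ c1 d1) t1; exact: dB.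
  move=> s t sab tcd; have s1 := le1 _ _ _ a1 b1 sab; have t1 := le1 _ _ _ c1 d1 tcd.
  have [|D dD] := hg s t s1 t1.
    rewrite eq_complex /= negb_and.
    move: sab tcd => /andP[? ?] /andP[? ?].
    by case: out => [q|[q|[q|q]]]; apply/orP; [left|left|right|right]; apply/eqP => z0; lra.
  by have [? ?] := cdiff_diff2 dD; exists (complex.Im D), (complex.Re D), (- complex.Im D).
have small (e : R) : 0 < e -> `|rect_int A B (-1) 1 (-2^-1) 2^-1| <= 4 * e.
  move=> e0; have [r r0 H] := (continuous_CC g 0).1 cg e e0.
  pose q := Num.min (r / 4) 4^-1.
  have q0 : 0 < q by rewrite lt_min; apply/andP; split; lra.
  have qr : q <= r / 4 by rewrite ge_min lexx.
  have q4 : q <= 4^-1 by rewrite ge_min lexx orbT.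
  rewrite (rect_int_frame A B _ _ _ _ q) (goursat0 (-1) (-q)); try lra.
  rewrite (goursat0 q 1); try lra.
  rewrite (goursat0 (-q) q (-2^-1) (-q)); try lra.
  rewrite (goursat0 (-q) q q 2^-1); try lra.
  rewrite !add0r.
  have inq (u : R) : - q <= u <= q -> `|u| <= 1 /\ `|u| <= q.
    by move=> /andP[? ?]; split; rewrite ler_norml; apply/andP; split; lra.
  have close (s t : R) : - q <= s <= q -> - q <= t <= q -> normc (g (s +i* t) - g 0) <= e.
    move=> /inq[_ sq] /inq[_ tq]; apply: H; rewrite subr0.
    apply: le_lt_trans (normc_le_ReIm _) _ => /=.
    apply: le_lt_trans (lerD sq tq) _; lra.
  apply: le_trans (@rect_int_affine_le R A B (fun s t => complex.Im (g (s +i* t)))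
     (fun s t => complex.Re (g (s +i* t))) _ _ _ _ (complex.Im (g 0)) 0 0 
     (complex.Re (g 0)) 0 e _ _ _ _ _ _) _.
  - lra.
  - lra.
  - by move=> s t /inq[? _] /inq[? _]; exact: dA.
  - by move=> s t /inq[? _] /inq[? _]; exact: dB.
  - move=> s t sq tq; rewrite !mul0r !addr0 -raddfB.
    exact: le_trans (Im_le_normc _) (close s t sq tq).
  - move=> s t sq tq; rewrite !mul0r !addr0 -raddfB.
    exact: le_trans (Re_le_normc _) (close s t sq tq).
  rewrite mulrAC ler_wpM2r ?ltW//; lra.
apply/eqP; rewrite -normr_le0 leNgt; apply/negP => p.
by have := small (`|rect_int A B (-1) 1 (-2^-1) 2^-1| / 8); rewrite divr_gt0// => /(_ isT); lra.
Qed.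

End CauchyBoundary.

Section CauchyBoundary2.
Variable R : realType.

(** A weak Cauchy estimate. If [g] were at most a quarter of [g 0] in modulus on the whole boundary,
    [(1 - g w / g 0) / w] would be so close to [1 / w] that each of the four sides would add a
    positive amount to the imaginary part of its contour integral. But this function extends
    continuously over 0, so the integral vanishes. The signs suffice; the value [2 * pi] is never
    computed. *)
Lemma cauchy_boundary (g : CC R -> CC R) :
  (forall z : CC R, `|complex.Re z| < 2 -> `|complex.Im z| < 2 -> exists d, cdiff g z d) ->
  g 0 != 0 ->
  exists s t : R, [/\ `|s| <= 1, `|t| <= 2^-1, `|s| = 1 \/ `|t| = 2^-1
    & normc (g 0) < 4 * normc (g (s +i* t))].
Proof.
move=> hg g0; apply: contrapT => H.
have hb (s t : R) : `|s| <= 1 -> `|t| <= 2^-1 -> `|s| = 1 \/ `|t| = 2^-1 ->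
    4 * normc (g (s +i* t)) <= normc (g 0).
  by move=> s1 t1 st; rewrite leNgt; apply/negP => lt; apply: H; exists s, t.
have [|| d0 [f cf [f0 gE]]] := hg 0; rewrite ?raddf0 ?normr0//.

(* The continuous extension of [(1 - g w / g 0) / w] to 0, read off from the continuous factor of
   [cdiff]. *)
pose k w := - f w / g 0.
have kE w : k w * w = 1 - g w / g 0 by rewrite /k (gE w); field.
have k0 : {for 0, continuous k} by apply: for_contM; [exact: for_contN | exact: for_cont_cst].
have dk (z : CC R) : z != 0 -> `|complex.Re z| < 2 -> `|complex.Im z| < 2 ->
    exists d, cdiff k z d.
  move=> z0 rz iz; have [d dg] := hg z rz iz; eexists.
  apply: (@cdiff_near _ (fun w => (1 - g w / g 0) * w^-1)); last first.
    apply: cdiffM; last exact: cdiffV (cdiff_id z) z0.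
    apply: cdiffB; first exact: cdiff_cst.
    by apply: cdiffM dg _; exact: cdiff_cst.
  apply/near_CC; exists (normc z); first by rewrite normc_gt0.
  move=> w wz; have w0 : w != 0.
    by apply: contraTneq wz => ->; rewrite sub0r normcN ltxx.
  by rewrite -kE mulfK.
have ck (z : CC R) : `|complex.Re z| < 2 -> `|complex.Im z| < 2 -> {for z, continuous k}.
  move=> rz iz; have [->//|z0] := eqVneq z 0.
  by have [d] := dk z z0 rz iz; exact: cdiff_continuous.
have b32 (x : R) : - (3 / 2) <= x <= 3 / 2 -> `|x| < 2.
  by move=> /andP[? ?]; rewrite ltr_norml; apply/andP; split; lra.
have exA (t : R) : exists A : R -> R, `|t| <= 1 -> forall s : R, `|s| <= 1 ->
    is_derive s 1 A (complex.Im (k (s +i* t))).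
  have [t1|t1] := pselect (`|t| <= 1); last by exists id => /t1.
  have [|s s32|A dA] := @continuous_primitive R (fun s => complex.Im (k (s +i* t))) (-(3/2)) (3/2).
  - lra.
  - by apply: (section_continuous_Re _).2; apply: ck => /=; [exact: b32 | lra].
  by exists A => _ s s1; apply: dA; move: s1; rewrite ler_norml; lra.
have exB (s : R) : exists B : R -> R, `|s| <= 1 -> forall t : R, `|t| <= 1 ->
    is_derive t 1 B (complex.Re (k (s +i* t))).
  have [t1|t1] := pselect (`|s| <= 1); last by exists id => /t1.
  have [|t s32|A dA] := @continuous_primitive R (fun t => complex.Re (k (s +i* t))) (-(3/2)) (3/2).
  - lra.
  - by apply: (section_continuous_Im _).1; apply: ck => /=; [lra | exact: b32].
  by exists A => _ s' s1; apply: dA; move: s1; rewrite ler_norml; lra.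
have [A' dA'] := choice exA; have [B dB'] := choice exB.
pose A s t := A' t s.
have dA (s t : R) : `|s| <= 1 -> `|t| <= 1 -> is_derive s 1 (A^~ t) (complex.Im (k (s +i* t))).
  by move=> s1 t1; exact: dA'.
have dB (s t : R) : `|s| <= 1 -> `|t| <= 1 -> is_derive t 1 (B s) (complex.Re (k (s +i* t))).
  by move=> s1 t1; exact: dB'.
have RI0 : rect_int A B (-1) 1 (-2^-1) 2^-1 = 0.
  apply: rect_int_cauchy k0 _ dA dB => s t s1 t1 st0.
  by apply: dk => //=; lra.
have half1 (t : R) : `|t| <= 2^-1 -> `|t| <= 1 by lra.
(* With [g w / g 0 = a + i b] at [w = s + i t], this is [k w * |w|^2 = (1 - a - i b) * conj w],
   split into real and imaginary part. *)
have bd (s t : R) : `|s| <= 1 -> `|t| <= 2^-1 -> `|s| = 1 \/ `|t| = 2^-1 ->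
  exists a b : R, [/\ `|a| <= 4^-1, `|b| <= 4^-1,
    complex.Re (k (s +i* t)) * (s ^+ 2 + t ^+ 2) = (1 - a) * s - b * t &
    complex.Im (k (s +i* t)) * (s ^+ 2 + t ^+ 2) = - b * s - (1 - a) * t].
  move=> s1 t1 st; pose e := g (s +i* t) / g 0.
  have ne : normc e <= 4^-1.
    have := hb s t s1 t1 st; rewrite /e normcM normcV ler_pdivrMr ?normc_gt0//; lra.
  have := kE (s +i* t); rewrite -/e.
  case: (k _) => kr ki; case: e ne => a b ne /eqP; rewrite eq_complex /= => /andP[/eqP e1 /eqP e2].
  exists a, b; split.
  - exact: le_trans (Re_le_normc (a +i* b)) ne.
  - exact: le_trans (Im_le_normc (a +i* b)) ne.
  - rewrite (_ : 1 - a = kr * s - ki * t) // (_ : b = - (kr * t + ki * s)); last by rewrite e2; ring.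
    by ring.
  - rewrite (_ : 1 - a = kr * s - ki * t) // (_ : b = - (kr * t + ki * s)); last by rewrite e2; ring.
    by ring.
have [le11 hN] : (-1 : R) <= 1 /\ - 2^-1 <= (2^-1 : R) by split; lra.
have n1 : `|1 : R| = 1 by rewrite normr1.
have nh : `|2^-1 : R| = 2^-1 by rewrite ger0_norm// invr_ge0.
have itv1 (s : R) : -1 <= s <= 1 -> `|s| <= 1 by rewrite ler_norml.
have itvh (t : R) : - 2^-1 <= t <= 2^-1 -> `|t| <= 2^-1 by rewrite ler_norml.
have s2 (s t : R) : `|s| = 1 \/ `|t| = 2^-1 -> 0 < s ^+ 2 + t ^+ 2.
  by case=> [e|e]; [apply: ltr_pwDl; rewrite ?sqr_ge0// | apply: ltr_wpDl; rewrite ?sqr_ge0//];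
    rewrite exprn_even_gt0//= -normr_gt0 e ?invr_gt0.
have bot : A (-1) (-2^-1) < A 1 (-2^-1).
  apply: (@increment_gt0 R (A^~ (-2^-1)) (fun s => complex.Im (k (s +i* (-2^-1))))).
  - lra.
  - by move=> s /itv1 s1; apply: dA => //; rewrite normrN nh; lra.
  move=> s /itv1 s1; have st : `|s| = 1 \/ `|- 2^-1| = 2^-1 :> R by right; rewrite normrN.
  have [|a [b [na nb _ E]]] := bd s (-2^-1) s1 _ st; first by rewrite normrN nh.
  rewrite -(pmulr_lgt0 _ (s2 _ _ st)) E; move: na nb s1; rewrite !ler_norml.
  by move=> /andP[? ?] /andP[? ?] /andP[? ?]; nra.
have top : A 1 2^-1 < A (-1) 2^-1.
  apply: (@increment_lt0 R (A^~ (2^-1)) (fun s => complex.Im (k (s +i* 2^-1)))).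
  - lra.
  - by move=> s /itv1 s1; apply: dA => //; rewrite nh; lra.
  move=> s /itv1 s1; have st : `|s| = 1 \/ `|2^-1| = 2^-1 :> R by right.
  have [|a [b [na nb _ E]]] := bd s 2^-1 s1 _ st; first by rewrite nh.
  rewrite -(pmulr_llt0 _ (s2 _ _ st)) E; move: na nb s1; rewrite !ler_norml.
  by move=> /andP[? ?] /andP[? ?] /andP[? ?]; nra.
have right : B 1 (-2^-1) < B 1 2^-1.
  apply: (@increment_gt0 R (B 1) (fun t => complex.Re (k (1 +i* t)))).
  - lra.
  - by move=> t /itvh t1; apply: dB; rewrite ?n1//; lra.
  move=> t /itvh t1; have st : `|1 : R| = 1 \/ `|t| = 2^-1 by left.
  have [|a [b [na nb E _]]] := bd 1 t _ t1 st; first by rewrite n1.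
  rewrite -(pmulr_lgt0 _ (s2 _ _ st)) E; move: na nb t1; rewrite !ler_norml.
  by move=> /andP[? ?] /andP[? ?] /andP[? ?]; nra.
have left : B (-1) 2^-1 < B (-1) (-2^-1).
  apply: (@increment_lt0 R (B (-1)) (fun t => complex.Re (k ((-1) +i* t)))).
  - lra.
  - by move=> t /itvh t1; apply: dB; rewrite ?normrN ?n1//; lra.
  move=> t /itvh t1; have st : `|-1 : R| = 1 \/ `|t| = 2^-1 by left; rewrite normrN.
  have [|a [b [na nb E _]]] := bd (-1) t _ t1 st; first by rewrite normrN n1.
  rewrite -(pmulr_llt0 _ (s2 _ _ st)) E; move: na nb t1; rewrite !ler_norml.
  by move=> /andP[? ?] /andP[? ?] /andP[? ?]; nra.
move: RI0 bot top right left; rewrite /rect_int; clear; lra.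
Qed.

End CauchyBoundary2.

(** * The identity theorem across a real segment *)

Section Identity.
Variable R : realType.

Lemma continuous_segment_bounded (f : R -> R) (a b : R) : a <= b ->
  (forall x, a <= x <= b -> {for x, continuous f}) ->
  exists M, forall x, a <= x <= b -> `|f x| <= M.
Proof.
move=> ab cf.
have wf : {within `[a, b], continuous f}.
  by apply: continuous_in_subspaceT => x; rewrite inE /= in_itv /=; exact: cf.
have [c _ mx] := EVT_max ab wf; have [d _ mn] := EVT_min ab wf.
exists (`|f c| + `|f d|) => x xab; have xi : x \in `[a, b] by rewrite in_itv.
have := mx _ xi; have := mn _ xi => ? ?; rewrite ler_norml; apply/andP; split.
  by rewrite (le_trans _ (_ : f d <= _))// lerNl (le_trans (ler_norm _))// normrN lerDr.
by rewrite (le_trans (_ : _ <= f c))// (le_trans (ler_norm _))// lerDl.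
Qed.

Lemma horizontal_bounded (g : CC R -> CC R) (t : R) :
  (forall s : R, -1 <= s <= 1 -> {for (s +i* t : CC R), continuous g}) ->
  exists M, forall s, -1 <= s <= 1 -> normc (g (s +i* t)) <= M.
Proof.
move=> cg; have le11 : (-1 : R) <= 1 by lra.
have [M HM] := continuous_segment_bounded le11
  (fun s s1 => (section_continuous_Re (cg s s1)).1).
have [L HL] := continuous_segment_bounded le11
  (fun s s1 => (section_continuous_Re (cg s s1)).2).
exists (M + L) => s s1; apply: le_trans (normc_le_ReIm _) _.
by apply: lerD; [exact: HM | exact: HL].
Qed.

Lemma vertical_bounded (g : CC R -> CC R) (s : R) :
  (forall t : R, -1 <= t <= 1 -> {for (s +i* t : CC R), continuous g}) ->
  exists M, forall t, -1 <= t <= 1 -> normc (g (s +i* t)) <= M.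
Proof.
move=> cg; have le11 : (-1 : R) <= 1 by lra.
have [M HM] := continuous_segment_bounded le11
  (fun t t1 => (section_continuous_Im (cg t t1)).1).
have [L HL] := continuous_segment_bounded le11
  (fun t t1 => (section_continuous_Im (cg t t1)).2).
exists (M + L) => t t1; apply: le_trans (normc_le_ReIm _) _.
by apply: lerD; [exact: HM | exact: HL].
Qed.

(* [|q| <= 1] on three sides of the rectangle and [|q 0| > 1]: multiplying by [q ^+ n]
   concentrates everything on the fourth side, where the function vanishes. *)
Lemma vanish_center (g : CC R -> CC R) :
  (forall z : CC R, `|complex.Re z| < 2 -> `|complex.Im z| < 2 -> exists d, cdiff g z d) ->
  (forall s : R, `|s| <= 1 -> g (s +i* (- 2^-1)) = 0) -> g 0 = 0.
Proof.
move=> hg g0; apply/eqP; apply: contraT => gn0.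
have cg (s t : R) : `|s| <= 1 -> `|t| <= 1 -> {for (s +i* t : CC R), continuous g}.
  by move=> s1 t1; have [||d] := hg (s +i* t); [move=> /=; lra | move=> /=; lra | exact: cdiff_continuous].
have [M1 HM1] : exists M, forall s, -1 <= s <= 1 -> normc (g (s +i* 2^-1)) <= M.
  apply: horizontal_bounded => s; rewrite -ler_norml => s1; apply: cg => //.
  by rewrite ger0_norm; lra.
have [M2 HM2] : exists M, forall t, -1 <= t <= 1 -> normc (g (1 +i* t)) <= M.
  by apply: vertical_bounded => t; rewrite -ler_norml => t1; apply: cg; rewrite ?normr1.
have [M3 HM3] : exists M, forall t, -1 <= t <= 1 -> normc (g ((-1) +i* t)) <= M.
  by apply: vertical_bounded => t; rewrite -ler_norml => t1; apply: cg; rewrite ?normrN ?normr1.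
pose M := `|M1| + `|M2| + `|M3|.
(* The real part of [(1/2 + i z)^2] is [(1/2 - t)^2 - s^2]. It is [1/4] at 0 and at most 0 on the
   sides [|s| = 1] and [t = 1/2], and [1/8] separates the two cases. The division by 36 makes the
   imaginary part too small to lift the modulus above 1 on these sides. *)
pose q (z : CC R) : CC R := 1 + ((2^-1 + 'i%C * z) ^+ 2 - 8^-1) * 36^-1.
have qE (s t : R) : q (s +i* t) = (1 + ((2^-1 - t) ^+ 2 - s ^+ 2 - 8^-1) / 36) +i* (2 * s * (2^-1 - t) / 36).
  have e (n : nat) : (n.+1%:R^-1 : CC R) = (n.+1%:R^-1)%:C by rewrite fmorphV rmorph_nat.
  rewrite /q !e !expr2; apply/eqP; rewrite eq_complex /=.
  by apply/andP; split; apply/eqP; field.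
have q0 : 1 < normc (q 0).
  rewrite (_ : 0 = 0 +i* 0) // qE /= mulr0 !mul0r expr0n /= addr0 sqrtr_sqr ger0_norm; lra.
have q1 (s t : R) : `|s| <= 1 -> `|t| <= 2^-1 -> `|s| = 1 \/ t = 2^-1 -> normc (q (s +i* t)) <= 1.
  move=> s1 t1 st; rewrite qE /= -[leRHS](sqrtr1 R) ler_wsqrtr//.
  have s2 : s ^+ 2 <= 1 by rewrite -(expr1n _ 2) -real_normK ?num_real// lerXn2r ?nnegrE.
  have [a0 a1] : 0 <= 2^-1 - t <= 1 /\ True by move: t1; rewrite ler_norml; split=> //; lra.
  case: st => [s11|->]; last by rewrite subrr mulr0 mul0r expr0n /=; nra.
  have {}s2 : s ^+ 2 = 1 by rewrite -real_normK ?num_real// s11 expr1n.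
  move: a0; set a := 2^-1 - t => /andP[a0 a1'].
  rewrite (_ : (2 * s * a / 36) ^+ 2 = s ^+ 2 * (a ^+ 2 / 324)); last by field.
  rewrite s2.
  have b1 : a ^+ 2 <= 1 by rewrite exprn_ile1.
  move: b1 (sqr_ge0 a); set b := a ^+ 2; clear; nra.
have dq z : exists d, cdiff q z d.
  eexists; apply: cdiffD; first exact: cdiff_cst.
  apply: cdiffM; last exact: cdiff_cst.
  apply: cdiffB; last exact: cdiff_cst.
  apply: cdiffX; apply: cdiffD; first exact: cdiff_cst.
  by apply: cdiffM; [exact: cdiff_cst | exact: cdiff_id].
clearbody q.
have key n : normc (g 0) * normc (q 0) ^+ n <= 4 * M.
  have hG (z : CC R) : `|complex.Re z| < 2 -> `|complex.Im z| < 2 ->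
      exists d, cdiff (fun z => g z * q z ^+ n) z d.
    move=> z1 z2; have [d dg] := hg z z1 z2; have [d' dq'] := dq z.
    by eexists; exact: (cdiffM dg (cdiffX n dq')).
  have [|s [t [s1 t1 st lt]]] := cauchy_boundary hG.
    by rewrite mulf_neq0// expf_neq0// -normc_gt0 (lt_trans _ q0).
  move: lt; rewrite (normcM (g 0)) (normcM (g (s +i* t))) (normcX (q 0)) (normcX (q (s +i* t))).
  move=> lt; apply: le_trans (ltW lt) _; apply: ler_wpM2l; first exact: ler0n.
  have [tb|tb] := eqVneq t (- 2^-1).
    move: lt; rewrite tb g0// normc0 mul0r mulr0 ltNge mulr_ge0 ?normc_ge0//.
    by rewrite exprn_ge0 ?normc_ge0.
  have st' : `|s| = 1 \/ t = 2^-1.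
    case: st => [|e]; [by left | right]; move/eqP: e; rewrite eqr_norml (negbTE tb) orbF.
    by rewrite invr_ge0 ler0n andbT => /eqP.
  have qn : normc (q (s +i* t)) ^+ n <= 1 by rewrite exprn_ile1 ?normc_ge0// q1.
  have gM : normc (g (s +i* t)) <= M.
    have t11 : -1 <= t <= 1 by rewrite -ler_norml; lra.
    have := ler_norm M1; have := ler_norm M2; have := ler_norm M3.
    have := normr_ge0 M1; have := normr_ge0 M2; have := normr_ge0 M3; rewrite /M => ? ? ? ? ? ?.
    case: st' => [/eqP|->].
      rewrite eqr_norml ler01 andbT => /orP[]/eqP->.
        by have := HM2 _ t11; lra.
      by have := HM3 _ t11; lra.
    by have := HM1 s; rewrite -ler_norml => /(_ s1); lra.
  apply: le_trans gM; rewrite -[leRHS]mulr1 ler_wpM2l ?normc_ge0//.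
pose e := normc (q 0) - 1; have e0 : 0 < e by rewrite subr_gt0.
have gp : 0 < normc (g 0) by rewrite normc_gt0.
have qe : normc (q 0) = 1 + e by rewrite /e; ring.
have bern n : 1 + e *+ n <= normc (q 0) ^+ n.
  rewrite qe; elim: n => [|n IH]; first by rewrite mulr0n addr0 expr0.
  rewrite exprS; apply: le_trans (ler_wpM2l _ IH); last by rewrite addr_ge0// ltW.
  rewrite mulrSr -mulr_natl; have : 0 <= e * (n%:R * e) by rewrite !mulr_ge0 ?(ltW e0) ?ler0n.
  lra.
have Mn0 : 0 <= M by rewrite !addr_ge0.
have := archi_boundP (_ : 0 <= 4 * M / (normc (g 0) * e)).
set n := Num.bound _ => /(_ _)/wrap[]; first by rewrite divr_ge0 ?mulr_ge0 ?normc_ge0// ltW.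
rewrite ltr_pdivrMr ?mulr_gt0// ltNge => /negP; case.
apply: le_trans (key n); rewrite mulrCA ler_wpM2l ?normc_ge0//.
by apply: le_trans (bern n); rewrite mulr_natl ler_wpDl.
Qed.

(** The affine map [z -> i y + 2 y z] takes the bottom side of the rectangle of [vanish_center] into
    the real axis and 0 to [i y]. On the square where differentiability is needed its real and
    imaginary parts stay below [5 * |y|]. *)
Lemma identity_imaginary (k : CC R -> CC R) (r y : R) :
  (forall z : CC R, `|complex.Re z| < r -> `|complex.Im z| < r -> exists d, cdiff k z d) ->
  (forall s : R, `|s| < r -> k s%:C = 0) -> 5 * `|y| < r -> k (0 +i* y) = 0.
Proof.
move=> hk k0 yr; have [->|y0] := eqVneq y 0.
  by rewrite -[0 +i* 0]/(0%:C) k0// normr0; have := normr_ge0 y; lra.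
have ay : 0 < `|y| by rewrite normr_gt0.
pose a z : CC R := (0 +i* y) + (2 * y)%:C * z.
have aE (s t : R) : a (s +i* t) = (2 * y * s) +i* (y + 2 * y * t).
  by apply/eqP; rewrite eq_complex /=; apply/andP; split; apply/eqP; ring.
have := @vanish_center (fun z => k (a z)).
rewrite /a mulr0 addr0; apply.
  move=> [s t] /= s2 t2; have [||d dk] := hk (a (s +i* t)).
  - rewrite aE /= !normrM normr_nat; nra.
  - rewrite aE /= (_ : y + _ = y * (1 + 2 * t)); last by ring.
    rewrite normrM; have : `|1 + 2 * t| <= 5.
      by move: t2; rewrite ltr_norml ler_norml => /andP[? ?]; apply/andP; split; lra.
    by move=> h; apply: le_lt_trans yr; rewrite mulrC ler_wpM2r.
  eexists; apply: cdiff_comp dk _; apply: cdiffD; first exact: cdiff_cst.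
  by apply: cdiffM; [exact: cdiff_cst | exact: cdiff_id].
move=> s s1; rewrite -/(a _) aE (_ : y + _ = 0); last by field.
rewrite -[_ +i* 0]/((2 * y * s)%:C) k0// !normrM normr_nat; nra.
Qed.
End Identity.

(** * Power series and the inductive construction *)

Section PowerSeries.
Variable R : realType.
Implicit Types (c : nat -> R) (z w h : R[i]) (N j : nat).

Lemma geometric_limit (u : nat -> R[i]) (a : R) :
  (forall n, normc (u n.+1 - u n) <= a * 2^-1 ^+ n) ->
  exists l, forall n, normc (u n - l) <= 4 * a * 2^-1 ^+ n.
Proof.
move=> ua.
have a0 : 0 <= a by have := ua 0%N; rewrite expr0 mulr1; apply: le_trans; exact: normc_ge0.
have real_lim (s : nat -> R) : (forall n, `|s n.+1 - s n| <= a * 2^-1 ^+ n) ->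
    exists l, forall n, `|s n - l| <= 2 * a * 2^-1 ^+ n.
  move=> sa; have [||l lP] := @nested_intervals R (fun n => s n - 2 * a * 2^-1 ^+ n)
      (fun n => 4 * a * 2^-1 ^+ n).
  - by move=> n; rewrite mulr_ge0 ?mulr_ge0// exprn_ge0// invr_ge0.
  - move=> n; have := sa n; rewrite exprS ler_norml => /andP[? ?].
    by split; lra.
  exists l => n; have := lP n; rewrite ler_norml => /andP[? ?].
  by apply/andP; split; lra.
have [|l lP] := real_lim (fun n => complex.Re (u n)).
  by move=> n; rewrite -raddfB; exact: le_trans (Re_le_normc _) (ua n).
have [|k kP] := real_lim (fun n => complex.Im (u n)).
  by move=> n; rewrite -raddfB; exact: le_trans (Im_le_normc _) (ua n).
exists (l +i* k) => n; apply: le_trans (normc_le_ReIm _) _; rewrite !raddfB /=.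
by have := lP n; have := kP n; lra.
Qed.

Definition psum c z N : R[i] := \sum_(j < N) (c j)%:C * z ^+ j.

Definition pder c z N : R[i] := \sum_(j < N) (c j)%:C * (j%:R * z ^+ j.-1).

Lemma leq_expn2 j : (j <= 2 ^ j)%N. Proof. exact/ltnW/ltn_expl. Qed.

Lemma normc_pow_le z j : normc z <= 4^-1 -> normc (z ^+ j) <= 4^-1 ^+ j.
Proof. by move=> z4; rewrite normcX lerXn2r// nnegrE ?normc_ge0// invr_ge0. Qed.

Lemma quarter_pow j : 4^-1 ^+ j = 2^-1 ^+ j * 2^-1 ^+ j :> R.
Proof. by rewrite -exprMn; congr (_ ^+ _); field. Qed.

Lemma half_pow_le1 j : 2^-1 ^+ j <= 1 :> R.
Proof. by rewrite exprn_ile1 ?invr_ge0// invf_le1// ler1n. Qed.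

Lemma nat_half_pow_le1 j : j%:R * 2^-1 ^+ j <= 1 :> R.
Proof. by rewrite exprVn ler_pdivrMr ?exprn_gt0// mul1r -natrX ler_nat leq_expn2. Qed.

(** The sum is known only through the explicit rate [2^-N] at which the partial sums approach it.
    Identities and estimates then follow from finite sums, with the two powers of 1/2 contained in
    [4^-j] covering the tail and, for the derivative, the factor [j]. *)
Lemma pser_sig : {s : (nat -> R) -> R[i] -> R[i] |
  forall c z, (forall j, `|c j| <= 1) -> normc z <= 4^-1 ->
    forall N, normc (psum c z N - s c z) <= 4 * 2^-1 ^+ N}.
Proof.
exists (fun c z => xget 0 [set l | forall N, normc (psum c z N - l) <= 4 * 2^-1 ^+ N]).
move=> c z c1 z4; case: xgetP => [l _ //|none].
have [|l lP] := @geometric_limit (psum c z) 1; last first.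
  by exfalso; apply: (none l) => N /=; rewrite -{1}[4]mulr1; exact: lP.
move=> n; rewrite /psum big_ord_recr /= [X in normc X]addrAC subrr add0r normcM normc_real mul1r.
rewrite -[leRHS]mul1r; apply: ler_pM; rewrite ?normc_ge0//.
apply: le_trans (normc_pow_le n z4) _.
by rewrite quarter_pow ler_piMr ?half_pow_le1// exprn_ge0// invr_ge0.
Qed.

Lemma pser_der_sig : {s : (nat -> R) -> R[i] -> R[i] |
  forall c z, (forall j, `|c j| <= 1) -> normc z <= 4^-1 ->
    forall N, normc (pder c z N - s c z) <= 16 * 2^-1 ^+ N}.
Proof.
exists (fun c z => xget 0 [set l | forall N, normc (pder c z N - l) <= 16 * 2^-1 ^+ N]).
move=> c z c1 z4; case: xgetP => [l _ //|none].
have [|l lP] := @geometric_limit (pder c z) 4; last first.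
  exfalso; apply: (none l) => N /=.
  by rewrite (_ : 16 = 4 * 4); [exact: lP | ring].
move=> n; rewrite /pder big_ord_recr /= [X in normc X]addrAC subrr add0r normcM normc_real.
rewrite -[leRHS]mul1r; apply: ler_pM; rewrite ?normc_ge0//.
case: n => [|n]; first by rewrite mul0r normc0 mulr_ge0// exprn_ge0// invr_ge0.
rewrite /= normcM -(rmorph_nat (real_complex R)) normc_real normr_nat.
apply: (@le_trans _ _ (n.+1%:R * 4^-1 ^+ n)).
  by rewrite ler_wpM2l// normc_pow_le.
have -> : n.+1%:R * 4^-1 ^+ n = 4 * (n.+1%:R * 2^-1 ^+ n.+1) * 2^-1 ^+ n.+1 :> R.
  by rewrite quarter_pow !exprS; field.
by rewrite ler_wpM2r ?exprn_ge0 ?invr_ge0// -[leRHS]mulr1 ler_wpM2l// nat_half_pow_le1.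
Qed.

Definition pser := sval pser_sig.

Definition pser_der := sval pser_der_sig.

Lemma pserP c z : (forall j, `|c j| <= 1) -> normc z <= 4^-1 ->
  forall N, normc (psum c z N - pser c z) <= 4 * 2^-1 ^+ N.
Proof. exact: (svalP pser_sig c z). Qed.

Lemma pser_derP c z : (forall j, `|c j| <= 1) -> normc z <= 4^-1 ->
  forall N, normc (pder c z N - pser_der c z) <= 16 * 2^-1 ^+ N.
Proof. exact: (svalP pser_der_sig c z). Qed.

Lemma le_half_pow_limit (a b K : R) : (forall N, a <= b + K * 2^-1 ^+ N) -> a <= b.
Proof.
move=> H; rewrite leNgt; apply/negP => ba.
have K0 : 0 < K by have := H 0%N; rewrite expr0 mulr1; move: ba; clear; lra.
have ab0 : 0 < a - b by rewrite subr_gt0.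
have := archi_boundP (ltW (divr_gt0 K0 ab0)); set N := Num.Def.archi_bound _.
rewrite ltr_pdivrMr// => KN; have HN := H N.
have : N%:R * (a - b) <= K * (N%:R * 2^-1 ^+ N).
  rewrite mulrCA ler_wpM2l//; move: HN; clear; lra.
have := nat_half_pow_le1 N => /(ler_wpM2l (ltW K0)); move: KN; clear; lra.
Qed.

Lemma normc_le0_eq z : normc z <= 0 -> z = 0.
Proof. by move=> z0; apply/eqP; rewrite -normc_eq0 eq_le z0 normc_ge0. Qed.

Lemma normc_limit_eq z w (u : nat -> R[i]) (K : R) (m : nat) :
  (forall N, (m <= N)%N -> normc (u N - z) <= K * 2^-1 ^+ N) ->
  (forall N, (m <= N)%N -> normc (u N - w) <= K * 2^-1 ^+ N) -> z = w.
Proof.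
move=> uz uw; apply/eqP; rewrite -subr_eq0; apply/eqP; apply: normc_le0_eq.
apply: (@le_half_pow_limit _ _ (2 * K)) => N.
rewrite (_ : z - w = (u (m + N)%N - w) - (u (m + N)%N - z)); last by ring.
apply: le_trans (normcB_le _ _) _.
have := uz (m + N)%N (leq_addr _ _); have := uw (m + N)%N (leq_addr _ _).
have p0 : 0 <= (2^-1 : R) ^+ (m + N) by rewrite exprn_ge0// invr_ge0.
have K0 : 0 <= K * (2^-1 : R) ^+ (m + N).
  by apply: le_trans (uz (m + N)%N (leq_addr _ _)); exact: normc_ge0.
have : K * (2^-1 : R) ^+ (m + N) <= K * 2^-1 ^+ N.
  rewrite exprD mulrCA ler_piMl ?half_pow_le1//.
  have := K0; rewrite exprD mulrCA pmulr_rge0 ?exprn_gt0 ?invr_gt0//.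
by move=> *; lra.
Qed.

Lemma pser_eq c z l (K : R) m : (forall j, `|c j| <= 1) -> normc z <= 4^-1 -> 4 <= K ->
  (forall N, (m <= N)%N -> normc (psum c z N - l) <= K * 2^-1 ^+ N) -> pser c z = l.
Proof.
move=> c1 z4 K4; apply: normc_limit_eq => N _; apply: le_trans (pserP c1 z4 N) _.
by rewrite ler_wpM2r// exprn_ge0// invr_ge0.
Qed.

Lemma pser_der_eq c z l (K : R) m : (forall j, `|c j| <= 1) -> normc z <= 4^-1 -> 16 <= K ->
  (forall N, (m <= N)%N -> normc (pder c z N - l) <= K * 2^-1 ^+ N) -> pser_der c z = l.
Proof.
move=> c1 z4 K4; apply: normc_limit_eq => N _; apply: le_trans (pser_derP c1 z4 N) _.
by rewrite ler_wpM2r// exprn_ge0// invr_ge0.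
Qed.

(** The constant 16 closes the recursion: the previous remainder is multiplied by [w], at most 1/4,
    and the new term costs [4 * 2^-j], giving [8 * 2^-j]. *)
Lemma monomial_remainder z w j : normc z <= 4^-1 -> normc w <= 4^-1 ->
  normc (w ^+ j - z ^+ j - j%:R * z ^+ j.-1 * (w - z))
    <= 16 * 2^-1 ^+ j * normc (w - z) ^+ 2.
Proof.
move=> z4 w4; elim: j => [|j IH].
  rewrite !expr0 mul0r mul0r subrr subrr normc0 mulr_ge0 ?sqr_ge0//.
have -> : w ^+ j.+1 - z ^+ j.+1 - j.+1%:R * z ^+ j * (w - z) =
   w * (w ^+ j - z ^+ j - j%:R * z ^+ j.-1 * (w - z)) + j%:R * z ^+ j.-1 * (w - z) ^+ 2.
  by case: j {IH} => [|j]; rewrite ?[j.+1.-1]/= !exprS -?[j.+2%:R]natr1 -?[j.+1%:R]natr1; ring.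
apply: le_trans (normcD_le _ _) _; rewrite normcM.
have -> : normc (j%:R * z ^+ j.-1 * (w - z) ^+ 2) =
    j%:R * normc (z ^+ j.-1) * normc (w - z) ^+ 2.
  by rewrite normcM (normcX (w - z)) [X in X * _]normcM -(rmorph_nat (real_complex R)) normc_real normr_nat.
have zj := normc_pow_le j.-1 z4; set H := normc (w - z) ^+ 2 in IH *.
have H0 : 0 <= H by exact: sqr_ge0.
have l1 : normc w * normc (w ^+ j - z ^+ j - j%:R * z ^+ j.-1 * (w - z))
     <= 4^-1 * (16 * 2^-1 ^+ j * H) by apply: ler_pM; rewrite ?normc_ge0.
have l2 : j%:R * normc (z ^+ j.-1) * H <= 4 * 2^-1 ^+ j * H.
  apply: ler_wpM2r => //; case: j zj {IH l1} => [|j] zj.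
    by rewrite mul0r mulr_ge0// exprn_ge0// invr_ge0.
  apply: (@le_trans _ _ (j.+1%:R * 4^-1 ^+ j)); first by rewrite ler_wpM2l.
  have -> : j.+1%:R * 4^-1 ^+ j = 4 * (j.+1%:R * 2^-1 ^+ j.+1) * 2^-1 ^+ j.+1 :> R.
    by rewrite quarter_pow !exprS; field.
  by rewrite ler_wpM2r ?exprn_ge0 ?invr_ge0// -[leRHS]mulr1 ler_wpM2l// nat_half_pow_le1.
by rewrite [in leRHS]exprS; move: l1 l2; clear; lra.
Qed.

(** The remainders of the monomials sum to 32 uniformly in the number of terms. The quadratic bound
    therefore survives the limit, and the derivative of the sum comes without interchanging
    limits. *)
Lemma pser_remainder c z w : (forall j, `|c j| <= 1) -> normc z <= 4^-1 -> normc w <= 4^-1 ->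
  normc (pser c w - pser c z - pser_der c z * (w - z)) <= 32 * normc (w - z) ^+ 2.
Proof.
move=> c1 z4 w4; set H := normc (w - z) ^+ 2.
have part N : normc (psum c w N - psum c z N - pder c z N * (w - z))
    <= 32 * (1 - 2^-1 ^+ N) * H.
  elim: N => [|N IH].
    by rewrite /psum /pder !big_ord0 mul0r subrr subrr normc0 expr0 subrr mulr0 mul0r.
  have -> : psum c w N.+1 - psum c z N.+1 - pder c z N.+1 * (w - z) =
     (psum c w N - psum c z N - pder c z N * (w - z)) +
     (c N)%:C * (w ^+ N - z ^+ N - N%:R * z ^+ N.-1 * (w - z)).
    by rewrite /psum /pder !big_ord_recr /=; ring.
  apply: le_trans (normcD_le _ _) _; rewrite normcM normc_real.
  have := monomial_remainder N z4 w4; rewrite -/H => rN.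
  have : `|c N| * normc (w ^+ N - z ^+ N - N%:R * z ^+ N.-1 * (w - z)) <= 1 * (16 * 2^-1 ^+ N * H).
    by apply: ler_pM; rewrite ?normc_ge0.
  by rewrite exprS; move: IH; clear; lra.
have H0 : 0 <= H by exact: sqr_ge0.
have tri (s p a b d k : R[i]) : s = p - (a - (b + d * k)) ->
    normc s <= normc p + normc a + normc b + normc d * normc k.
  move=> ->; rewrite -normcM; apply: le_trans (normcB_le _ _) _; rewrite -!addrA lerD2l.
  by apply: le_trans (normcB_le _ _) _; rewrite lerD2l; exact: normcD_le.
apply: (@le_half_pow_limit _ _ (8 + 16 * normc (w - z))) => N.
apply: le_trans (tri _ (psum c w N - psum c z N - pder c z N * (w - z))
   (psum c w N - pser c w) (psum c z N - pser c z) (pder c z N - pser_der c z) (w - z) _) _.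
  by ring.
have p0 : 0 <= (2^-1 : R) ^+ N * H by apply: mulr_ge0 => //; rewrite exprn_ge0// invr_ge0.
apply: le_trans (lerD (lerD (lerD (part N) (pserP c1 w4 N)) (pserP c1 z4 N))
  (ler_wpM2r (normc_ge0 (w - z)) (pser_derP c1 z4 N))) _.
move: (normc (w - z)) H p0 {H0 part tri} => r H; clear; move: (_ ^+ N) => p; lra.
Qed.

Lemma pser_cdiff c (z : CC R) : (forall j, `|c j| <= 1) -> normc z < 4^-1 ->
  cdiff (pser c : CC R -> CC R) z (pser_der c z).
Proof.
move=> c1 z4; apply/cdiff_CC => e e0.
exists (Num.min (4^-1 - normc z) (e / 32)).
  by rewrite lt_min subr_gt0 z4 divr_gt0.
move=> w; rewrite lt_min => /andP[w1 w2].
have w4 : normc w <= 4^-1.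
  rewrite -[w](subrK z); apply: le_trans (normcD_le _ _) _; move: w1; clear; lra.
apply: le_trans (pser_remainder c1 (ltW z4) w4) _.
by rewrite expr2 mulrA ler_wpM2r ?normc_ge0//; move: w2; clear; lra.
Qed.

Lemma pser_conj c z : (forall j, `|c j| <= 1) -> normc z <= 4^-1 ->
  conjc (pser c z) = pser c (conjc z).
Proof.
move=> c1 z4; apply/esym/(@pser_eq _ _ _ 4 0) => //; first by rewrite normc_conj.
move=> N _; have -> : psum c (conjc z) N = conjc (psum c z N).
  rewrite /psum rmorph_sum /=; apply: eq_bigr => j _.
  by rewrite conjcM conjcX conjc_real.
by rewrite -conjcB normc_conj pserP.
Qed.

Lemma pser0 c : (forall j, `|c j| <= 1) -> pser c 0 = (c 0%N)%:C.
Proof.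
move=> c1; apply: (@pser_eq _ _ _ 4 1) => //; first by rewrite normc0 invr_ge0.
case=> // N _; rewrite /psum big_ord_recl expr0 mulr1 big1 ?addr0 ?subrr ?normc0.
  by rewrite mulr_ge0// exprn_ge0// invr_ge0.
by move=> i _; rewrite expr0n mulr0.
Qed.

Lemma pser_agree c c' z m : (forall j, `|c j| <= 1) -> (forall j, `|c' j| <= 1) ->
  normc z <= 4^-1 -> (forall j, (j < m)%N -> c j = c' j) ->
  normc (pser c z - pser c' z) <= 8 * 2^-1 ^+ m /\
  normc (pser_der c z - pser_der c' z) <= 32 * 2^-1 ^+ m.
Proof.
move=> c1 c1' z4 cc; split.
  have E : psum c z m = psum c' z m by apply: eq_bigr => j _; rewrite cc.
  rewrite (_ : _ - _ = (psum c' z m - pser c' z) - (psum c z m - pser c z)); last by rewrite E; ring.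
  apply: le_trans (normcB_le _ _) _.
  by have := pserP c1 z4 m; have := pserP c1' z4 m; clear; lra.
have E : pder c z m = pder c' z m by apply: eq_bigr => j _; rewrite cc.
rewrite (_ : _ - _ = (pder c' z m - pser_der c' z) - (pder c z m - pser_der c z)); last by rewrite E; ring.
apply: le_trans (normcB_le _ _) _.
by have := pser_derP c1 z4 m; have := pser_derP c1' z4 m; clear; lra.
Qed.

Lemma pser_poly (p : {poly R}) (x : R) : (forall j, `|p`_j| <= 1) -> `|x| <= 4^-1 ->
  pser (fun j => p`_j) x%:C = (p.[x])%:C /\ pser_der (fun j => p`_j) x%:C = (p^`().[x])%:C.
Proof.
move=> p1 x4; split.
  apply: (@pser_eq _ _ _ 4 (size p)) => //; first by rewrite normc_real.
  move=> N pN; rewrite (horner_coef_wide _ pN) /psum rmorph_sum /=.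
  rewrite (eq_bigr (fun i : 'I_N => (p`_i * x ^+ i)%:C)) ?subrr ?normc0.
    by rewrite mulr_ge0// exprn_ge0// invr_ge0.
  by move=> i _; rewrite rmorphM rmorphXn.
apply: (@pser_der_eq _ _ _ 16 (size p).+1) => //; first by rewrite normc_real.
case=> // N pN; rewrite (@horner_coef_wide _ N); last first.
  by rewrite (leq_trans (size_poly _ _))// -ltnS (leq_trans _ pN)// ltnS leq_pred.
rewrite /pder big_ord_recl mul0r mulr0 add0r rmorph_sum /=.
rewrite (eq_bigr (fun i : 'I_N => ((p^`())`_i * x ^+ i)%:C)) ?subrr ?normc0.
  by rewrite mulr_ge0// exprn_ge0// invr_ge0.
move=> i _; rewrite -[bump 0 i]/(i.+1) -[(0 + i)%N]/(i : nat) coef_deriv -mulr_natl.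
by rewrite rmorphM rmorphMn rmorphXn -mulr_natl /=; ring.
Qed.
End PowerSeries.

(** * The limit of the perturbations *)

Section Limit.
Variable R : realType.
Implicit Types (p w : {poly R}) (g : R).

Lemma coef_le_coef_norm p j : `|p`_j| <= coef_norm p.
Proof.
case: (ltnP j (size p)) => [jp|jp]; last by rewrite nth_default// normr0 coef_norm_ge0.
by rewrite /coef_norm (bigD1 (Ordinal jp))//= lerDl sumr_ge0.
Qed.

Lemma coef_normE p n : (size p <= n)%N -> coef_norm p = \sum_(i < n) `|p`_i|.
Proof.
move=> pn; rewrite /coef_norm (big_ord_widen n (fun i => `|p`_i|))//.
rewrite [RHS](bigID (fun i : 'I_n => (i < size p)%N))//= [X in _ + X]big1 ?addr0//.
by move=> i; rewrite -leqNgt => ip; rewrite nth_default// normr0.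
Qed.

Lemma coef_normD p w : coef_norm (p + w) <= coef_norm p + coef_norm w.
Proof.
pose n := maxn (size p) (size w).
rewrite (@coef_normE (p + w) n) ?size_polyD// (@coef_normE p n) ?leq_maxl//.
rewrite (@coef_normE w n) ?leq_maxr// -big_split; apply: ler_sum => i _.
by rewrite coefD ler_normD.
Qed.

Lemma coef_dvd_Xn p n j : 'X^n %| p -> (j < n)%N -> p`_j = 0.
Proof. by case/dvdpP => q ->; rewrite coefMXn => ->. Qed.

Lemma double_zero_dvd_Xn p n : (1 < n)%N -> 'X^n %| p -> p.[0] = 0 /\ p^`().[0] = 0.
Proof.
move=> n1 pn; rewrite !horner_coef0 coef_deriv.
by rewrite !(coef_dvd_Xn pn)// ?mul0rn// (ltn_trans _ n1).
Qed.

(** A state consists of the polynomial built so far and the nonzero points of the orbits found so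
    far. The divisibility fixes the low coefficients, the norms [2^-(k+1)] keep all coefficients at
    most 1, and the double zeros protect the earlier orbits. *)
Definition refines g (k : nat) (u u' : {poly R} * seq R) : Prop :=
  exists p t q x T,
  [/\ 'X^(8 + k) %| p, coef_norm p <= 2^-1 ^+ k.+1,
      {in u.2, forall s, p.[s] = 0 /\ p^`().[s] = 0} & u' = (u.1 + p, u.2 ++ T)] /\
  [/\ resonant_orbit g (horner u'.1) (horner u'.1^`()) t q x,
      forall i, `|x i| <= 2^-1 ^+ k.+1, forall i, x i \in 0 :: T & 0 \notin T].

Lemma refining_sequence g : 2^-1 < g -> exists u : nat -> {poly R} * seq R,
  u 0%N = (0, [::]) /\ forall k, refines g k (u k) (u k.+1).
Proof.
move=> g2; pose inv (u : {poly R} * seq R) := 'X^8 %| u.1 /\ 0 \notin u.2.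
have step (a : nat * ({poly R} * seq R)) :
    exists u', inv a.2 -> inv u' /\ refines g a.1 a.2 u'.
  case: a => k [w S]; case: (pselect (inv (w, S))) => [[/= w8 S0]|]; last by exists (w, S).
  have e0 : 0 < 2^-1 ^+ k.+1 :> R by rewrite exprn_gt0// invr_gt0.
  have [p [t [q [x [T [[p8 pe pS] [ro xe xT T0]]]]]]] := perturbation_exists k g2 w8 S0 e0.
  exists (w + p, S ++ T) => _; split; first split=> /=.
  - by rewrite dvdp_add// (dvdp_trans _ p8)// dvdp_exp2l// leq_addr.
  - by rewrite mem_cat negb_or S0.
  - by exists p, t, q, x, T.
have [f fP] := choice step.
pose u := fix u n := if n is m.+1 then f (m, u m) else (0, [::]) : {poly R} * seq R.
exists u; split=> // k; suff uk : inv (u k) by case: (fP (k, u k) uk).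
by elim: k => [|k IH]; [split=> //=; rewrite dvdp0 | case: (fP (k, u k) IH)].
Qed.

(** From stage [j] on coefficient [j] no longer changes, so the diagonal [(w j)_j] is the limit
    series. The later perturbations vanish to second order at the points of an orbit found at stage
    [k]. There the limit has the value and the derivative of [w k.+1], and the orbit remains
    resonant. *)
Lemma resonant_series_exists g : 2^-1 < g -> exists c : nat -> R,
  [/\ forall j, `|c j| <= 1, forall j, (j < 8)%N -> c j = 0 &
   forall e : R, 0 < e -> exists t q (x : nat -> R), (forall i, `|x i| <= e) /\
     resonant_orbit g (fun s => complex.Re (pser c s%:C))
       (fun s => complex.Re (pser_der c s%:C)) t q x].
Proof.
move=> /refining_sequence[u [u0 uP]]; pose w k := (u k).1.
have wS k : exists p, [/\ w k.+1 = w k + p, 'X^(8 + k) %| p, coef_norm p <= 2^-1 ^+ k.+1 &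
    {in (u k).2, forall s, p.[s] = 0 /\ p^`().[s] = 0}].
  by have [p [t [q [x [T [[? ? ? e] _]]]]]] := uP k; exists p; rewrite /w e.
have Sm k m s : s \in (u k).2 -> s \in (u (k + m)%N).2.
  move=> sk; elim: m => [|m IH]; first by rewrite addn0.
  by rewrite addnS; have [p [t [q [x [T [[_ _ _ ->] _]]]]]] := uP (k + m)%N; rewrite mem_cat IH.
have wn k : coef_norm (w k) <= 1 - 2^-1 ^+ k.
  elim: k => [|k IH]; first by rewrite /w u0 /coef_norm size_poly0 big_ord0 expr0 subrr.
  have [p [-> _ pk _]] := wS k; apply: le_trans (coef_normD _ _) _.
  by move: IH pk; rewrite exprS; clear; lra.
have w1 k j : `|(w k)`_j| <= 1.
  apply: le_trans (coef_le_coef_norm _ _) (le_trans (wn k) _).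
  by rewrite gerBl exprn_ge0// invr_ge0.
have wst k m j : (j < 8 + k)%N -> (w (k + m)%N)`_j = (w k)`_j.
  move=> jk; elim: m => [|m IH]; first by rewrite addn0.
  have [p [pE pk _ _]] := wS (k + m)%N; rewrite addnS pE coefD IH (coef_dvd_Xn pk) ?addr0//.
  by rewrite addnA ltn_addr.
pose c j := (w j)`_j.
have cw m j : (j < 8 + m)%N -> c j = (w m)`_j.
  move=> jm; rewrite /c; case: (leqP j m) => [/subnKC <-|/ltnW/subnKC mj].
    by rewrite wst// (leq_trans (ltnSn j))// addSn ltnS leq_addl.
  by rewrite -{1}mj wst.
exists c; split=> [j|j j8|e e0].
- exact: w1.
- by rewrite (@cw 0%N)// /w u0 coef0.
wlog e4 : e e0 / e <= 4^-1.
  move=> H; case: (leP e 4^-1) => [|/ltW e4]; first exact: H.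
  have [||t [q [x [xe ro]]]] := H 4^-1; rewrite ?invr_gt0//.
  by exists t, q, x; split=> // i; exact: le_trans (xe i) e4.
have [k ke] : exists k, (2^-1 : R) ^+ k.+1 <= e.
  exists (Num.Def.archi_bound e^-1).
  have := archi_boundP (ltW (_ : 0 < e^-1)); rewrite invr_gt0 e0 => /(_ isT).
  set k := Num.Def.archi_bound _ => ek.
  rewrite exprVn -[leRHS]invrK lef_pV2 ?posrE ?exprn_gt0 ?invr_gt0//.
  by rewrite (le_trans (ltW ek))// -natrX ler_nat ltnW// ltnW// ltn_expl.
have [p [t [q [x [T [[_ _ _ uE] [ro xk xT T0]]]]]]] := uP k.
exists t, q, x; split=> [i|]; first exact: le_trans (xk i) ke.
have agree i : pser c (x i)%:C = ((w k.+1).[x i])%:C /\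
    pser_der c (x i)%:C = ((w k.+1)^`().[x i])%:C.
  have xi4 : normc (x i)%:C <= 4^-1.
    by rewrite normc_real (le_trans (xk i))// (le_trans ke).
  have st m : (w (k.+1 + m)%N).[x i] = (w k.+1).[x i] /\
      (w (k.+1 + m)%N)^`().[x i] = (w k.+1)^`().[x i].
    elim: m => [|m [IH1 IH2]]; first by rewrite addn0.
    have [r [wE rd _ rS]] := wS (k.+1 + m)%N; rewrite addnS wE.
    have [r0 r0'] : r.[x i] = 0 /\ r^`().[x i] = 0.
      have := xT i; rewrite inE => /orP[/eqP->|xiT]; first exact: double_zero_dvd_Xn rd.
      by apply: rS; apply: Sm; rewrite uE mem_cat xiT orbT.
    by rewrite derivD !hornerD r0 r0' !addr0.
  have ag m := pser_agree (c' := fun j => (w (k.+1 + m)%N)`_j) (m := 8 + (k.+1 + m))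
    (fun j => w1 j j) (w1 _) xi4 (cw _).
  have half N : (2^-1 : R) ^+ (8 + (k.+1 + N)) <= 2^-1 ^+ N.
    by rewrite addnA exprD ler_piMl ?half_pow_le1// exprn_ge0// invr_ge0.
  have small (u1 u2 : R[i]) K :
      (forall N, normc (u1 - u2) <= K * 2^-1 ^+ (8 + (k.+1 + N))) -> 0 <= K -> u1 = u2.
    move=> uu K0; apply/eqP; rewrite -subr_eq0; apply/eqP/normc_le0_eq.
    apply: (@le_half_pow_limit _ _ _ K) => N; rewrite add0r.
    by apply: le_trans (uu N) _; rewrite ler_wpM2l.
  have wp m := @pser_poly _ (w (k.+1 + m)%N) (x i) (w1 _) (le_trans (xk i) (le_trans ke e4)).
  by split; [apply: (@small _ _ 8) | apply: (@small _ _ 32)] => // N; have [A B] := ag N;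
    have [P Q] := wp N; have [X Y] := st N; [rewrite -X -P | rewrite -Y -Q].
by apply: resonant_orbit_ext ro => i /=; rewrite -/(w k.+1); case: (agree i) => E1 E2; rewrite ?E1 ?E2.
Qed.
End Limit.

(** * The surface *)

Section Surface.
Variables (R : realType) (g : R) (a : nat -> R).
Hypothesis a_le1 : forall j, `|a j| <= 1.
Hypothesis a0 : forall j, (j < 8)%N -> a j = 0.
Implicit Types z w : R[i].

Definition side_coef (i : nat) : R := (i == 2)%:R * g + a i.

Definition side z : R[i] := g%:C * z ^+ 2 + pser a z.

Definition level_fun z w : R[i] := (z * w + side z + side w) / (1 - z * w).

(* Since [side] has no constant term, multiplying by [\sum_m (z * w) ^+ m] spreads its
   coefficients along the diagonals. *)
Definition level_coef (j k : nat) : R :=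
  if j == k then (0 < j)%:R else side_coef ((j - k) + (k - j)).

Definition surface_coef (j k : nat) : CC R := if (j + k < 3)%N then 0 else (level_coef j k)%:C.

Lemma side_coef_le i : `|side_coef i| <= `|g| + 1.
Proof.
rewrite (le_trans (ler_normD _ _))// lerD// normrM ler_piMl//.
by case: eqP => _; rewrite ?normr1 ?normr0.
Qed.

Lemma level_coef_le j k : `|level_coef j k| <= `|g| + 1.
Proof.
rewrite /level_coef; case: eqP => _; last exact: side_coef_le.
by case: ltnP => _; rewrite ?normr1 ?normr0 ?lerDr// addr_ge0.
Qed.

Lemma surface_coef_conv : conv_pseries2 surface_coef.
Proof.
exists 1, (`|g| + 1); split=> // j k; rewrite rmorph1 expr1n mulr1 /surface_coef.
case: ifP => _; first by rewrite normr0 lecR addr_ge0.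
by rewrite CC_normE lecR normc_real level_coef_le.
Qed.

Lemma surface_coef_order : order_ge3 surface_coef.
Proof. by move=> j k jk; rewrite /surface_coef jk. Qed.

Definition level_sum z w N : R[i] :=
  \sum_(j < N) \sum_(k < N) (level_coef j k)%:C * z ^+ j * w ^+ k.

Lemma psum_side z N : psum side_coef z N.+3 = g%:C * z ^+ 2 + psum a z N.+3.
Proof.
rewrite /psum (eq_bigr (fun i : 'I_N.+3 => (if (i : nat) == 2 then g%:C * z ^+ 2 else 0) +
   (a i)%:C * z ^+ i)); last first.
  move=> i _; rewrite /side_coef; case: eqP => [->|_].
    by rewrite mul1r rmorphD mulrDl.
  by rewrite mul0r !add0r.
rewrite big_split /=; congr (_ + _).
rewrite (bigD1 (Ordinal (isT : (2 < N.+3)%N)))//= big1 ?addr0// => i.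
by rewrite -val_eqE /= => /negbTE ->.
Qed.

(** The first row and column are the two [side] series and the rest is the same array shifted along
    the diagonal. The extra 1 arises because the diagonal entry is 0 at the origin and 1 everywhere
    else. This is [level_fun_eq] for partial sums. *)
Lemma level_sumS z w N : level_sum z w N.+2 =
  psum side_coef z N.+2 + psum side_coef w N.+2 + z * w * (level_sum z w N.+1 + 1).
Proof.
have c0 : side_coef 0 = 0 by rewrite /side_coef mul0r add0r a0.
have cS j k : level_coef j.+1 k.+1 = level_coef j k + ((j == 0) && (k == 0))%N%:R.
  rewrite /level_coef eqSS !subSS; case: eqP => [->|jk]; first by case: k; rewrite /= ?add0r ?addr0.
  by case: j jk => [|j]; case: k => [|k]; rewrite /= ?addr0.
rewrite /level_sum big_ord_recl.
have -> : \sum_(k < N.+2) (level_coef (ord0 : 'I_N.+2) k)%:C * z ^+ (ord0 : 'I_N.+2) * w ^+ k =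
    psum side_coef w N.+2.
  apply: eq_bigr => k _; rewrite expr0 mulr1 /level_coef /=.
  by case: k => -[|k] kN //=; rewrite c0.
rewrite (eq_bigr (fun j : 'I_N.+1 => (side_coef j.+1)%:C * z ^+ j.+1 +
   z * w * \sum_(k < N.+1) (level_coef j.+1 k.+1)%:C * z ^+ j * w ^+ k)); last first.
  move=> j _; rewrite big_ord_recl /= expr0 mulr1; congr (_ + _).
    by rewrite -[bump 0 j]/(j.+1) /level_coef /= addn0.
  by rewrite mulr_sumr; apply: eq_bigr => k _; rewrite /bump !exprS; ring.
rewrite big_split /= -mulr_sumr.
have -> : \sum_(i < N.+1) \sum_(k < N.+1) (level_coef i.+1 k.+1)%:C * z ^+ i * w ^+ k =
    level_sum z w N.+1 + 1.
  transitivity (level_sum z w N.+1 + \sum_(i < N.+1) \sum_(k < N.+1)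
     (((i : nat) == 0)%N && ((k : nat) == 0)%N)%:R * z ^+ i * w ^+ k).
    rewrite -big_split; apply: eq_bigr => i _; rewrite -big_split; apply: eq_bigr => k _ /=.
    by rewrite cS rmorphD rmorph_nat; ring.
  congr (_ + _); rewrite big_ord_recl [X in _ + X]big1 ?addr0; last first.
    by move=> i _; rewrite big1// => k _; rewrite !mul0r.
  rewrite big_ord_recl [X in _ + X]big1 ?addr0 ?mul1r ?expr0//.
  by move=> i _; rewrite /= !mul0r.
rewrite [psum side_coef z _]big_ord_recl c0 rmorph0 mul0r add0r.
rewrite addrCA addrA; congr (_ + _ + _).
Qed.

Lemma level_fun_eq z w : 1 - z * w != 0 ->
  level_fun z w = side z + side w + z * w * (level_fun z w + 1).
Proof. by move=> zw; rewrite /level_fun; field. Qed.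

(** Subtracting [level_fun_eq] from [level_sumS] multiplies the error by [z * w], of modulus at most
    1/16, and adds two tails of the one-variable series. *)
Lemma level_sum_limit z w : normc z <= 4^-1 -> normc w <= 4^-1 ->
  exists M : R, forall N, normc (level_sum z w N.+3 - level_fun z w) <= M * 2^-1 ^+ N.
Proof.
move=> z4 w4.
have zw : normc (z * w) <= 16^-1.
  rewrite normcM (le_trans (ler_pM _ _ z4 w4)) ?normc_ge0//.
  by rewrite -invfM -natrM.
have zw1 : 1 - z * w != 0.
  apply/negP => /eqP/subr0_eq E; move: zw; by rewrite -E normc1 leNgt invf_lt1 ?ltr1n.
exists (normc (level_sum z w 3 - level_fun z w) + 16); elim=> [|N IH].
  by rewrite expr0 mulr1 lerDl.
rewrite level_sumS {1}level_fun_eq// !psum_side.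
rewrite (_ : _ - _ = z * w * (level_sum z w N.+3 - level_fun z w) +
   ((psum a z N.+4 - pser a z) + (psum a w N.+4 - pser a w))); last first.
  by rewrite /side; ring.
apply: le_trans (normcD_le _ _) _; apply: le_trans (lerD (lexx _) (normcD_le _ _)) _.
have arith (s1 s2 s3 b p : R) : 0 <= p -> 0 <= b * p -> s1 <= 16^-1 * ((b + 16) * p) ->
    s2 <= 4 * (2^-1 * (2^-1 * (2^-1 * (2^-1 * p)))) ->
    s3 <= 4 * (2^-1 * (2^-1 * (2^-1 * (2^-1 * p)))) ->
    s1 + (s2 + s3) <= (b + 16) * (2^-1 * p).
  by move=> *; lra.
have pz := pserP a_le1 z4 N.+4; have pw := pserP a_le1 w4 N.+4.
rewrite !exprS in pz pw *; apply: arith pz pw.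
- by rewrite exprn_ge0// invr_ge0.
- by rewrite mulr_ge0 ?normc_ge0// exprn_ge0// invr_ge0.
- by rewrite normcM; apply: ler_pM; rewrite ?normc_ge0.
Qed.

Lemma sum_ord3 (V : zmodType) (F : nat -> V) m : (forall k, F k.+3 = 0) ->
  \sum_(k < m.+3) F k = F 0%N + F 1%N + F 2%N.
Proof.
move=> F0; rewrite 3!big_ord_recl big1 ?addr0 ?addrA// => i _; exact: F0.
Qed.

Lemma surface_sum z w N : \sum_(j < N.+3) \sum_(k < N.+3) surface_coef j k * z ^+ j * w ^+ k =
  level_sum z w N.+3 - (z * w + g%:C * z ^+ 2 + g%:C * w ^+ 2).
Proof.
set A := LHS; suff <- : level_sum z w N.+3 - A = z * w + g%:C * z ^+ 2 + g%:C * w ^+ 2.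
  by rewrite opprB addrC subrK.
rewrite /A /level_sum -sumrB.
pose d j k := ((level_coef j k)%:C - surface_coef j k) * z ^+ j * w ^+ k.
rewrite (eq_bigr (fun j : 'I_N.+3 => \sum_(k < N.+3) d j k)); last first.
  by move=> j _; rewrite -sumrB; apply: eq_bigr => k _; rewrite /d; ring.
have d0 j k : (3 <= j + k)%N -> d j k = 0.
  by rewrite leqNgt /d /surface_coef => /negbTE ->; rewrite subrr !mul0r.
rewrite (sum_ord3 (F := fun j => \sum_(k < N.+3) d j k)); last first.
  by move=> j; rewrite big1// => k _; apply: d0.
rewrite !sum_ord3; try by move=> k; apply: d0; rewrite ?addnS.
rewrite ![d 1%N 2%N]d0// ![d 2%N 1%N]d0// ![d 2%N 2%N]d0// /d /surface_coef /level_coef /=.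
rewrite /side_coef !a0//= !subr0 !mul0r !add0r !mul1r; ring.
Qed.

Lemma pseries2_valE (z : CC R) : normc z <= 4^-1 ->
  pseries2_val surface_coef z =
    level_fun z (conjc z) - (z * conjc z + g%:C * z ^+ 2 + g%:C * conjc z ^+ 2).
Proof.
move=> z4; have z4' : normc (conjc z) <= 4^-1 by rewrite normc_conj.
have [M HM] := level_sum_limit z4 z4'.
apply: cvg_lim; first exact: norm_hausdorff.
apply/cvgrPdist_le => _ /CC_gt0[e e0 ->].
have M0 : 0 <= M by have := HM 0%N; rewrite expr0 mulr1; apply: le_trans; exact: normc_ge0.
pose m := Num.Def.archi_bound (M / e).
have shift n : (m.+3 <= n)%N -> exists2 k, n = k.+3 & (m <= k)%N.
  by case: n => [|[|[|k]]]//; exists k.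
near=> n; have [|k -> mk] := shift n; first by near: n; exact: nbhs_infty_ge.
rewrite surface_sum CC_normE lecR normc_dist.
rewrite (_ : _ - _ = level_sum z (conjc z) k.+3 - level_fun z (conjc z)); last by ring.
apply: le_trans (HM k) _.
have := archi_boundP (divr_ge0 M0 (ltW e0)); rewrite -/m ltr_pdivrMr// => Mm.
have mk' : m%:R <= k%:R :> R by rewrite ler_nat.
have : M <= k%:R * e by rewrite (le_trans (ltW Mm))// ler_wpM2r// ltW.
move=> /(ler_wpM2r (_ : 0 <= (2^-1 : R) ^+ k)); rewrite exprn_ge0 ?invr_ge0// => /(_ isT).
move=> /le_trans; apply; rewrite -mulrA mulrCA ler_piMr ?(ltW e0)//.
exact: nat_half_pow_le1.
Unshelve. all: by end_near.
Qed.
End Surface.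

Section Surface.
Variables (R : realType) (g : R) (a : nat -> R).
Hypothesis a_le1 : forall j, `|a j| <= 1.
Hypothesis a0 : forall j, (j < 8)%N -> a j = 0.
Implicit Types z w : R[i].
Local Notation L := (level_fun g a).

Lemma surfM_level (z : CC R * CC R) : normc z.1 <= 4^-1 ->
  surfM g (surface_coef g a) z <-> z.2 = L z.1 (conjc z.1).
Proof.
move=> z4; rewrite /surfM /= (pseries2_valE g a_le1 a0 z4).
by rewrite (_ : _ + (_ - _) = L z.1 (conjc z.1)) //; ring.
Qed.

Lemma level_funC z w : L z w = L w z.
Proof. by rewrite /level_fun (mulrC z w) addrAC. Qed.

Lemma side_conj z : normc z <= 4^-1 -> conjc (side g a z) = side g a (conjc z).
Proof.
by move=> z4; rewrite /side conjcD conjcM conjc_real conjcX pser_conj.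
Qed.

Lemma level_fun_conj z w : normc z <= 4^-1 -> normc w <= 4^-1 ->
  conjc (L z w) = L (conjc z) (conjc w).
Proof.
move=> z4 w4; rewrite /level_fun conjcM 2!conjcD !side_conj// conjcM conjc_inv.
by rewrite conjcB conjcM conjc1.
Qed.

Lemma surfM_hyperplane : exists (U : set (CC R * CC R)) (F : CC R * CC R -> CC R * CC R)
    (H : set (CC R * CC R)), biholo_on U F /\ real_hyperplane H /\
  (forall z : CC R * CC R, U z -> surfM g (surface_coef g a) z -> H (F z)).
Proof.
pose U := ball (0 : CC R * CC R) (4^-1 : CC R).
(* [Re (- i * w2)] is [Im w2], so this hyperplane is [y_2 = 0] and the identity map does. *)
exists U, id, [set w | complex.Re (0 * w.1 + (- 'i%C) * w.2) = 0]; split; last split.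
- split; first by apply: ball_open; rewrite invr_gt0.
  split; first by apply: ballxx; rewrite invr_gt0.
  exists U, id; split; first by apply: ball_open; rewrite invr_gt0.
  by do 4 split=> //; split=> z _; have [] := is_diff_id z.
- by exists 0, (- 'i%C), 0; split=> //; right; rewrite oppr_eq0 -normc_gt0 /= !expr0n /= expr1n add0r sqrtr1.
move=> z [z1 _]; have z4 : normc z.1 <= 4^-1.
  have E : (4^-1 : CC R) = (4^-1 : R)%:C by rewrite fmorphV rmorph_nat.
  by move: z1; rewrite -ball_normE /= sub0r normrN CC_normE E ltcR => /ltW.
move=> /(surfM_level z4) zE /=; rewrite mul0r add0r.
have : conjc z.2 = z.2 by rewrite zE level_fun_conj ?normc_conj// conjcK level_funC.
by case: (z.2) => x y [] /=; lra.
Qed.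
End Surface.

(** * Obstruction to the normal form *)

Section PartialDerivatives.
Variable R : realType.
Local Notation C := (CC R).
Implicit Types (f : C * C -> C) (z : C * C).

Definition pdiff f z (p q : C) : Prop := forall e : R, 0 < e -> exists2 d : R, 0 < d &
  forall h k : C, normc h < d -> normc k < d ->
    normc (f (z.1 + h, z.2 + k) - f z - p * h - q * k) <= e * (normc h + normc k).

Lemma prod_norm_CC z : `|z| = (Num.max (normc z.1) (normc z.2))%:C :> C.
Proof.
rewrite prod_normE !CC_normE.
by case: (leP (normc z.1) (normc z.2)) => [H|/ltW H]; [rewrite max_r | rewrite max_l]; rewrite ?lecR.
Qed.

Lemma near_CC2 z (P : C * C -> Prop) : (\forall w \near z, P w) <->
  exists2 r : R, 0 < r & forall w, normc (w.1 - z.1) < r -> normc (w.2 - z.2) < r -> P w.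
Proof.
split.
  move=> /nbhs_normP[e /= /CC_gt0[r r0 ->]] H; exists r => // w w1 w2; apply: H => /=.
  by rewrite -normrN opprB prod_norm_CC ltcR gt_max w1.
case=> r r0 H; apply/nbhs_normP; exists r%:C; first by rewrite /= ltcR.
move=> w /=; rewrite -normrN opprB prod_norm_CC ltcR gt_max => /andP[w1 w2]; exact: H.
Qed.

Lemma holo_pdiff (F : C * C -> C * C) z : holo_at F z -> exists p1 q1 p2 q2,
  pdiff (fun w => (F w).1) z p1 q1 /\ pdiff (fun w => (F w).2) z p2 q2.
Proof.
move=> /diff_locallyP[_ /eqaddoP FE].
have dE h k : 'd F z (h, k) = h *: 'd F z (1, 0) + k *: 'd F z (0, 1).
  rewrite -!linearZ -linearD; congr ('d F z _).
  by rewrite /GRing.scale /= /scale_pair /= /GRing.add /= /add_pair /= !scaler0 addr0 add0r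
    /GRing.scale /= !mulr1.
have key (e : R) : 0 < e -> exists2 d : R, 0 < d & forall h k : C, normc h < d -> normc k < d ->
    normc ((F (z.1 + h, z.2 + k)).1 - (F z).1 - ('d F z (1, 0)).1 * h - ('d F z (0, 1)).1 * k)
      <= e * (normc h + normc k) /\
    normc ((F (z.1 + h, z.2 + k)).2 - (F z).2 - ('d F z (1, 0)).2 * h - ('d F z (0, 1)).2 * k)
      <= e * (normc h + normc k).
  move=> e0; have e0' : 0 < (e%:C : C) by rewrite ltcR.
  have /near_CC2[d d0 H] := FE _ e0'; exists d => // h k hd kd.
  have := H (h, k); rewrite /= !subr0 => /(_ hd kd).
  rewrite !prod_norm_CC -(rmorphM (real_complex R)) lecR ge_max /=.
  have hk : Num.max (normc h) (normc k) <= normc h + normc k.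
    by rewrite ge_max lerDl lerDr !normc_ge0.
  move=> /andP[H1 H2].
  have zE : (h, k) + z = (z.1 + h, z.2 + k).
    by rewrite [z.1 + h]addrC [z.2 + k]addrC.
  rewrite zE in H1 H2.
  have d1 : ('d F z (h, k)).1 = h * ('d F z (1, 0)).1 + k * ('d F z (0, 1)).1 by rewrite dE.
  have d2 : ('d F z (h, k)).2 = h * ('d F z (1, 0)).2 + k * ('d F z (0, 1)).2 by rewrite dE.
  split; [apply: le_trans (le_trans (_ : _ <= _) H1) (ler_wpM2l (ltW e0) hk) |
          apply: le_trans (le_trans (_ : _ <= _) H2) (ler_wpM2l (ltW e0) hk)];
    by rewrite le_eqVlt; apply/orP; left; apply/eqP; congr normc; rewrite ?d1 ?d2; ring.
by exists ('d F z (1, 0)).1, ('d F z (0, 1)).1, ('d F z (1, 0)).2, ('d F z (0, 1)).2;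
  split=> e /key[d d0 H]; exists d => // h k hd kd; case: (H h k hd kd).
Qed.

Lemma pdiff_comp f (al be : C -> C) (b p q al' be' : C) : pdiff f (al b, be b) p q ->
  cdiff al b al' -> cdiff be b be' -> cdiff (fun x => f (al x, be x)) b (p * al' + q * be').
Proof.
move=> df /cdiff_CC da /cdiff_CC db; apply/cdiff_CC => e e0.
pose M := normc al' + normc be' + 2; pose P := normc p + normc q + 1.
have M0 : 0 < M by rewrite ltr_wpDl ?addr_ge0 ?normc_ge0.
have P0 : 0 < P by rewrite ltr_wpDl ?addr_ge0 ?normc_ge0.
have e1 : 0 < e / (2 * M) by rewrite divr_gt0 ?mulr_gt0.
have e2 : 0 < Num.min 1 (e / (2 * P)) by rewrite lt_min ltr01 divr_gt0 ?mulr_gt0.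
have [d d0 H] := df _ e1; have [r1 r10 H1] := da _ e2; have [r2 r20 H2] := db _ e2.
have dM : 0 < d / M by rewrite divr_gt0.
exists (Num.min (d / M) (Num.min r1 r2)); first by rewrite !lt_min dM r10.
move=> w; rewrite !lt_min => /and3P[w0 w1 w2]; have {}H1 := H1 w w1; have {}H2 := H2 w w2.
set s := w - b in w0 H1 H2 *; set h := al w - al b in H1; set k := be w - be b in H2.
have s0 := normc_ge0 s.
have grow (u v : C) : normc (u - v * s) <= Num.min 1 (e / (2 * P)) * normc s ->
    normc u <= (normc v + 1) * normc s /\ normc (u - v * s) <= e / (2 * P) * normc s.
  move=> le; split; last by apply: le_trans le _; rewrite ler_wpM2r// ge_min lexx orbT.
  rewrite -[u](subrK (v * s)) addrC; apply: le_trans (normcD_le _ _) _.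
  rewrite normcM mulrDl lerD2l mul1r; apply: le_trans le _.
  by rewrite ler_piMl// ge_min lexx.
have [h1 h2] := grow h al' H1; have [k1 k2] := grow k be' H2.
have hk : normc h + normc k <= M * normc s by rewrite /M; lra.
have sm : M * normc s < d by rewrite mulrC -ltr_pdivlMr.
have hd : normc h < d by apply: le_lt_trans sm; apply: le_trans hk; rewrite lerDl normc_ge0.
have kd : normc k < d by apply: le_lt_trans sm; apply: le_trans hk; rewrite lerDr normc_ge0.
have le := H h k hd kd.
have fE : (al b + h, be b + k) = (al w, be w).
  by congr pair; rewrite addrC subrK.
rewrite [X in f X - _]fE in le; clearbody h k.
rewrite (_ : _ - _ = (f (al w, be w) - f (al b, be b) - p * h - q * k) +
   (p * (h - al' * s) + q * (k - be' * s))); last by ring.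
apply: le_trans (normcD_le _ _) _; apply: le_trans (lerD le (normcD_le _ _)) _.
rewrite !normcM.
have l1 : e / (2 * M) * (normc h + normc k) <= e / 2 * normc s.
  apply: le_trans (ler_wpM2l (ltW e1) hk) _; rewrite le_eqVlt; apply/orP; left; apply/eqP.
  by field; rewrite gt_eqF.
have l2 : normc p * normc (h - al' * s) + normc q * normc (k - be' * s) <= e / 2 * normc s.
  have E : e / 2 * normc s = P * (e / (2 * P) * normc s) by field; rewrite gt_eqF.
  rewrite E {1}/P mulrDl mulrDl -[leLHS]addr0.
  by rewrite !lerD ?ler_wpM2l ?normc_ge0// mul1r mulr_ge0// ltW// divr_gt0// mulr_gt0.
have eE : e * normc s = e / 2 * normc s + e / 2 * normc s by field.
by rewrite eE lerD.
Qed.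

Lemma cdiff_real_eq0 (k : C -> C) (d : C) (r : R) : 0 < r -> cdiff k 0 d ->
  (forall s : R, `|s| < r -> k s%:C = 0) -> d = 0.
Proof.
move=> r0 /cdiff_CC dk k0; apply/eqP; rewrite -normc_eq0 eq_le normc_ge0 andbT.
rewrite leNgt; apply/negP => dp; have [|r1 r10 H] := dk (normc d / 2); first by rewrite divr_gt0.
pose s := Num.min r r1 / 2.
have s0 : 0 < s by rewrite divr_gt0// lt_min r0.
have sr : s < r /\ s < r1.
  have := s0; rewrite /s; case: (leP r r1) => *; split; lra.
have := H s%:C; rewrite subr0 normc_real gtr0_norm// => /(_ sr.2).
rewrite k0 ?gtr0_norm ?sr.1// -(rmorph0 (real_complex R)) k0 ?normr0// subrr sub0r normcN.
rewrite normcM normc_real gtr0_norm// ler_pM2r//; move: dp; clear; lra.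
Qed.
End PartialDerivatives.

Lemma cdiff_eq_der (K : numFieldType) (f : K -> K) z d d' : d = d' -> cdiff f z d -> cdiff f z d'.
Proof. by move=> ->. Qed.

Section LevelFunction.
Variables (R : realType) (g : R) (a : nat -> R).
Hypothesis a_le1 : forall j, `|a j| <= 1.
Implicit Types z w : R[i].
Local Notation L := (level_fun g a).

Lemma pser_der_conj z : normc z <= 4^-1 -> conjc (pser_der a z) = pser_der a (conjc z).
Proof.
move=> z4; apply/esym/(@pser_der_eq _ _ _ _ 16 0) => //; first by rewrite normc_conj.
move=> N _; have -> : pder a (conjc z) N = conjc (pder a z N).
  rewrite /pder rmorph_sum /=; apply: eq_bigr => j _.
  by rewrite !conjcM conjcX conjc_real conjc_nat.
by rewrite -conjcB normc_conj pser_derP.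
Qed.

Lemma conjc_fixed_real z : conjc z = z -> z = (complex.Re z)%:C.
Proof. by case: z => x y [/= H]; congr Complex; lra. Qed.

Lemma level_denom_neq0 z w : normc z <= 4^-1 -> normc w <= 4^-1 -> 1 - z * w != 0.
Proof.
move=> z4 w4; apply/negP => /eqP/subr0_eq E.
have := ler_pM (normc_ge0 _) (normc_ge0 _) z4 w4.
by rewrite -normcM -E normc1 -invfM -natrM leNgt invf_lt1 ?ltr1n.
Qed.

Definition side_der z : R[i] := 2 * g%:C * z + pser_der a z.

Lemma side_cdiff (z : CC R) : normc z < 4^-1 ->
  cdiff (side g a : CC R -> CC R) z (side_der z).
Proof.
move=> z4; rewrite /side_der (_ : 2 * _ * _ = 0 * z ^+ 2 + g%:C * (2%:R * z ^+ 2.-1 * 1)); last first.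
  by rewrite expr1; ring.
apply: cdiffD; last exact: pser_cdiff.
apply: (@cdiffM _ (fun=> g%:C : CC R) (fun w => w ^+ 2)); first exact: cdiff_cst.
exact: (cdiffX 2 (cdiff_id z)).
Qed.

(** The quotient rule, with the value of the level function reinserted so that the numerators become
    the slopes [slope_fst] at real points. Paths along which these cancel are tangent to the
    level. *)
Lemma level_fun_cdiff (al be : CC R -> CC R) (b al' be' : CC R) :
  normc (al b) < 4^-1 -> normc (be b) < 4^-1 -> cdiff al b al' -> cdiff be b be' ->
  cdiff (fun x => L (al x) (be x) : CC R) b
   ((((1 + L (al b) (be b)) * be b + side_der (al b)) * al' +
     ((1 + L (al b) (be b)) * al b + side_der (be b)) * be') / (1 - al b * be b)).
Proof.
move=> a4 b4 da db; have ab := cdiffM da db.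
have nz := level_denom_neq0 (ltW a4) (ltW b4).
have dn := cdiffB (cdiff_cst 1 b) ab.
have num := cdiffD (cdiffD ab (cdiff_comp (side_cdiff a4) da)) (cdiff_comp (side_cdiff b4) db).
apply: cdiff_eq_der (cdiffM num (cdiffV dn nz)).
rewrite /level_fun; set s1 := side_der _; set s2 := side_der _.
set u := side g a (al b); set v := side g a (be b).
by field.
Qed.

Lemma level_fun_real (t x y : R) : `|x| <= 4^-1 -> `|y| <= 4^-1 ->
  on_level g (fun s => complex.Re (pser a s%:C)) t x y -> L x%:C y%:C = t%:C.
Proof.
move=> x4 y4 lv; have nz := level_denom_neq0 (z := x%:C) (w := y%:C).
rewrite !normc_real in nz; have {}nz := nz x4 y4.
have re (s : R) : `|s| <= 4^-1 -> pser a s%:C = (complex.Re (pser a s%:C))%:C.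
  by move=> s4; apply: (conjc_fixed_real (z := pser a s%:C)); rewrite pser_conj ?conjc_real ?normc_real.
rewrite /level_fun /side (re x)// (re y)//; apply: (mulIf nz); rewrite mulfVK//.
move: lv; rewrite /on_level; move: (complex.Re (pser a x%:C)) (complex.Re (pser a y%:C)) => p q lv.
have {}lv : x * y + (g * x ^+ 2 + p) + (g * y ^+ 2 + q) = t * (1 - x * y) by lra.
rewrite -!(rmorphXn (real_complex R)) -(rmorph1 (real_complex R)).
by rewrite -!(rmorphM (real_complex R)) -(rmorphB (real_complex R)) -!(rmorphD (real_complex R)) -rmorphM lv.
Qed.

Lemma side_der_real (t x y : R) : `|x| <= 4^-1 ->
  (1 + t%:C) * y%:C + side_der x%:C =
    (slope_fst g (fun s => complex.Re (pser_der a s%:C)) t x y)%:C.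
Proof.
move=> x4; rewrite /side_der /slope_fst [pser_der a x%:C]conjc_fixed_real; last first.
  by rewrite pser_der_conj ?normc_real// conjc_real.
by rewrite !(rmorphD, rmorphM, rmorph1, rmorph_nat) /=; ring.
Qed.

Hypothesis a00 : a 0%N = 0.

Lemma level_fun_small (e : R) : 0 < e -> exists2 r : R, 0 < r <= 4^-1 &
  forall z w, normc z < r -> normc w < r -> normc (L z w) < e.
Proof.
move=> e0; have c0 : normc (0 : CC R) < 4^-1 by rewrite normc0 invr_gt0.
have e8 : 0 < e / 8 by rewrite divr_gt0.
have /continuous_CC/(_ _ e8)[r0 r00 H0] := cdiff_continuous (side_cdiff c0).
have s0 : side g a 0 = 0 by rewrite /side pser0// a00 expr0n /= mulr0 addr0.
exists (Num.min (Num.min 4^-1 r0) (e / 8)); first by rewrite !lt_min r00 e8 invr_gt0 !ge_min lexx ltr0n.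
move=> z w; rewrite !lt_min => /andP[/andP[z4 z0] z8] /andP[/andP[w4 w0] w8].
have := H0 z; have := H0 w; rewrite !subr0 s0 !subr0 => /(_ w0) sw /(_ z0) sz.
have zw : normc (z * w) <= e / 8 * 4^-1.
  by rewrite normcM; apply: ler_pM; rewrite ?normc_ge0 ?ltW.
have zw' : normc (z * w) <= 4^-1 * 4^-1.
  by rewrite normcM; apply: ler_pM; rewrite ?normc_ge0 ?ltW.
have d2 : 2^-1 <= normc (1 - z * w).
  have := normcD_le (1 - z * w) (z * w); rewrite subrK normc1.
  have : (4^-1 * 4^-1 : R) <= 2^-1 by rewrite -invfM -natrM lef_pV2 ?posrE// ler_nat.
  by lra.
rewrite /level_fun normcM.
have nz := level_denom_neq0 (ltW z4) (ltW w4).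
have -> : normc (1 - z * w)^-1 = (normc (1 - z * w))^-1.
  have d0 : normc (1 - z * w) != 0 by rewrite normc_eq0.
  by apply: (mulIf d0); rewrite -normcM !mulVf// normc1.
rewrite ltr_pdivrMr; last by apply: lt_le_trans d2; rewrite invr_gt0.
apply: le_lt_trans (normcD_le _ _) _; apply: le_lt_trans (lerD (normcD_le _ _) (lexx _)) _.
have : e * 2^-1 <= e * normc (1 - z * w) by rewrite ler_wpM2l// ltW.
by move: zw sw sz e0; lra.
Qed.
End LevelFunction.

(** On the complex line [z = s + i b], [w = s - i b], real values of [b] are the points with
    [w = conj z], while the imaginary value [b = i (y - x) / 2] with [s = (x + y) / 2] is the point
    [(x, y)]. One-variable identity along this line suffices. *)
Lemma totally_real_identity (R : realType) (K : CC R -> CC R -> CC R) (r : R) :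
  (forall (s : R) (b : CC R), normc (s%:C + 'i%C * b) < r -> normc (s%:C - 'i%C * b) < r ->
     exists d, cdiff (fun b => K (s%:C + 'i%C * b) (s%:C - 'i%C * b) : CC R) b d) ->
  (forall z, normc z < r -> K z (conjc z) = 0) ->
  forall x y : R, 20 * `|x| < r -> 20 * `|y| < r -> K x%:C y%:C = 0.
Proof.
move=> dK K0 x y xr yr; pose s := (x + y) / 2.
have sr : 20 * `|s| < r.
  have := ler_normD x y; rewrite /s normrM (ger0_norm (_ : 0 <= 2^-1)) ?invr_ge0//.
  by move: xr yr; clear; lra.
have small (b : CC R) : `|complex.Re b| < r / 3 -> `|complex.Im b| < r / 3 ->
    normc (s%:C + 'i%C * b) < r /\ normc (s%:C - 'i%C * b) < r.
  move=> b1 b2; have := normc_le_ReIm b.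
  have ib : normc ('i%C * b) = normc b by rewrite normcM /= expr0n expr1n add0r sqrtr1 mul1r.
  have := normcD_le s%:C ('i%C * b); have := normcB_le s%:C ('i%C * b).
  rewrite ib normc_real; have := normr_ge0 s; move: sr b1 b2; clear => *; split; lra.
have := @identity_imaginary R (fun b => K (s%:C + 'i%C * b) (s%:C - 'i%C * b)) (r / 3) ((y - x) / 2).
have -> : s%:C + 'i%C * (0 +i* ((y - x) / 2)) = x%:C.
  by rewrite /s; simpc; congr Complex; field.
have -> : s%:C - 'i%C * (0 +i* ((y - x) / 2)) = y%:C.
  by rewrite /s; simpc; congr Complex; field.
apply.
- by move=> b b1 b2; have [? ?] := small b b1 b2; exact: dK.
- move=> b br; have b2 : `|complex.Im b%:C| < r / 3 by rewrite normr0 (le_lt_trans _ br).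
  have [z1 _] := small b%:C br b2; have := K0 _ z1.
  by rewrite conjcD conjcM !conjc_real (_ : conjc 'i%C = - 'i%C) ?mulNr //; simpc.
have := ler_normB y x; rewrite normrM (ger0_norm (_ : 0 <= 2^-1)) ?invr_ge0//.
by have := normr_ge0 x; move: xr yr; clear; lra.
Qed.

(* Subtracting consecutive level equations gives [a i.+1 = - G * (a i + a i.+2)], which turns the
   linearized equation into [Y i.+2 * (a i.+2 - a i) = Y i.+1 * (a i.+3 - a i.+1)]. *)
Lemma linearized_orbit_periodic (K : fieldType) (a Y : nat -> K) (G tau : K) (q : nat) :
  G != 0 -> (forall i, a i * a i.+1 + G * (a i ^+ 2 + a i.+1 ^+ 2) = tau) ->
  (forall i, a i.+2 != a i) -> (forall i, a (i + q)%N = a i) ->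
  (forall i, Y i.+1 * (a i.+2 + 2 * G * a i.+1) + Y i.+2 * (a i.+1 + 2 * G * a i.+2) = 0) ->
  Y (1 + q)%N = Y 1%N.
Proof.
move=> G0 lev nd per lin.
have rec i : a i.+1 = - G * (a i + a i.+2).
  have d0 : a i.+2 - a i != 0 by rewrite subr_eq0.
  apply/eqP; rewrite -subr_eq0; apply/eqP; apply: (mulfI d0); rewrite mulr0.
  transitivity ((a i.+1 * a i.+2 + G * (a i.+1 ^+ 2 + a i.+2 ^+ 2)) -
                (a i * a i.+1 + G * (a i ^+ 2 + a i.+1 ^+ 2))); first by ring.
  by rewrite !lev subrr.
have step i : Y i.+2 * (a i.+2 - a i) = Y i.+1 * (a i.+3 - a i.+1).
  apply/eqP; rewrite -subr_eq0; apply/eqP; apply: (mulfI G0); rewrite mulr0 -[RHS](lin i).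
  have -> : a i.+2 + 2 * G * a i.+1 = - (G * (a i.+3 - a i.+1)) by rewrite {1}[a i.+2]rec; ring.
  have -> : a i.+1 + 2 * G * a i.+2 = G * (a i.+2 - a i) by rewrite {1}[a i.+1]rec; ring.
  by ring.
have inv i : Y i.+1 / (a i.+2 - a i) = Y 1%N / (a 2%N - a 0%N).
  elim: i => [//|i <-].
  have d1 : a i.+2 - a i != 0 by rewrite subr_eq0.
  have d2 : a i.+3 - a i.+1 != 0 by rewrite subr_eq0.
  by apply/eqP; rewrite eqr_div// step mulrC mulrC.
have := inv q; rewrite (per 2%N : a q.+2 = _) (per 0%N : a q = _).
by apply: mulIf; rewrite invr_eq0 subr_eq0.
Qed.

Section MappedSurface.
Variables (R : realType) (g eps : R) (s : nat) (a : nat -> R).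
Variables (U : set (CC R * CC R)) (F : CC R * CC R -> CC R * CC R).
Hypothesis a_le1 : forall j, `|a j| <= 1.
Hypothesis a0 : forall j, (j < 8)%N -> a j = 0.
Hypothesis openU : open U.
Hypothesis U0 : U (0, 0).
Hypothesis F0 : F (0, 0) = (0, 0).
Hypothesis holF : forall z, U z -> holo_at F z.
Hypothesis FM : forall z, U z -> (surfM g (surface_coef g a) z <-> surfN g eps s (F z)).
Local Notation C := (CC R).
Local Notation L := (level_fun g a).

(** The equation of the normal form with [Y], which takes the place of the conjugate of [X], as an
    independent variable, so that it is holomorphic in all three arguments. *)
Definition normal_form (X Y T : C) : C :=
  X * Y + (g%:C + eps%:C * T ^+ s) * (X ^+ 2 + Y ^+ 2) - T.

Lemma normal_form_cdiff (X Y T : C -> C) (b X' Y' T' : C) :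
  cdiff X b X' -> cdiff Y b Y' -> cdiff T b T' ->
  cdiff (fun x => normal_form (X x) (Y x) (T x)) b
   (X' * Y b + X b * Y' + eps%:C * (s%:R * T b ^+ s.-1 * T') * (X b ^+ 2 + Y b ^+ 2)
    + (g%:C + eps%:C * T b ^+ s) * (2 * X b * X' + 2 * Y b * Y') - T').
Proof.
move=> dX dY dT.
have dG := cdiffD (cdiff_cst (g%:C : C) b) (cdiffM (cdiff_cst (eps%:C : C) b) (cdiffX s dT)).
have dQ := cdiffD (cdiffX 2 dX) (cdiffX 2 dY).
apply: cdiff_eq_der (cdiffB (cdiffD (cdiffM dX dY) (cdiffM dG dQ)) dT).
by rewrite !expr1; ring.
Qed.

(** The bound 1/2 on the second component is what later keeps [g + eps * T ^+ s] away from 0. *)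
Lemma mapped_domain : exists2 r : R, 0 < r <= 4^-1 & forall z w : C, normc z < r -> normc w < r ->
  U (z, L z w) /\ normc (F (z, L z w)).2 <= 2^-1.
Proof.
have cF : {for (0, 0), continuous F} by exact/differentiable_continuous/holF.
have nU : \forall z \near ((0, 0) : C * C), U z by exact: open_nbhs_nbhs.
have h2 : 0 < ((2^-1 : R)%:C : C) by rewrite ltcR invr_gt0.
have nF : \forall z \near ((0, 0) : C * C), normc (F z).2 <= 2^-1.
  have /cvgrPdist_le/(_ _ h2) := cF; apply: filterS => z.
  by rewrite F0 prod_norm_CC /= lecR ge_max !sub0r !normcN => /andP[].
have /near_CC2[e1 e10 H1] := nU; have /near_CC2[e2 e20 H2] := nF.
have [|r /andP[r0 r4] H] := level_fun_small g a_le1 (a0 (isT : (0 < 8)%N)) (e := Num.min e1 e2).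
  by rewrite lt_min e10.
exists (Num.min r (Num.min e1 e2)); first by rewrite !lt_min r0 e10 e20 ge_min r4.
move=> z w; rewrite !lt_min => /and3P[z1 z2 z3] /andP[w1 _].
have := H z w z1 w1; rewrite lt_min => /andP[l1 l2].
by split; [apply: H1 | apply: H2]; rewrite /= subr0.
Qed.

Variable r : R.
Hypothesis r4 : r <= 4^-1.
Hypothesis rU : forall z w : C, normc z < r -> normc w < r -> U (z, L z w).

Lemma path_cdiff (al be : C -> C) (b al' be' p q e f : C) :
  normc (al b) < r -> normc (be b) < r -> cdiff al b al' -> cdiff be b be' ->
  pdiff (fun z => (F z).1) (al b, L (al b) (be b)) p q ->
  pdiff (fun z => (F z).2) (al b, L (al b) (be b)) e f ->
  let L' := (((1 + L (al b) (be b)) * be b + side_der g a (al b)) * al' +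
     ((1 + L (al b) (be b)) * al b + side_der g a (be b)) * be') / (1 - al b * be b) in
  cdiff (fun x => (F (al x, L (al x) (be x))).1) b (p * al' + q * L') /\
  cdiff (fun x => (F (al x, L (al x) (be x))).2) b (e * al' + f * L').
Proof.
move=> ar br da db dF1 dF2 /=.
have dL := level_fun_cdiff g a_le1 (lt_le_trans ar r4) (lt_le_trans br r4) da db.
by split; [apply: (@pdiff_comp R (fun z => (F z).1) al (fun x => L (al x) (be x)) b) |
           apply: (@pdiff_comp R (fun z => (F z).2) al (fun x => L (al x) (be x)) b)].
Qed.

Lemma mapped_conj_point (z : C) : normc z < r ->
  let w := F (z, L z (conjc z)) in
  conjc w.2 = w.2 /\ normal_form w.1 (conjc w.1) w.2 = 0.
Proof.
move=> zr /=; have zU : U (z, L z (conjc z)) by apply: rU => //; rewrite normc_conj.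
have /(FM zU) : surfM g (surface_coef g a) (z, L z (conjc z)).
  by apply/(surfM_level _ a_le1 a0) => //=; exact: ltW (lt_le_trans zr r4).
case: (F _) => X T [/= XT T0].
have TE : T = (complex.Re T)%:C by case: (T) T0 => x y /= ->.
split; first by rewrite TE conjc_real.
rewrite /normal_form {2}TE XT {1}TE; rewrite rmorphD rmorphM rmorphXn /=.
by apply/eqP; rewrite subr_eq0.
Qed.

(** Conjugating [F] and its arguments gives again a holomorphic function, so [K1] and [K2] are
    holomorphic on the lines used by [totally_real_identity]. For [w = conj z] they express that the
    image point lies on the normal form. *)
Lemma real_relations (x y : R) : 20 * `|x| < r -> 20 * `|y| < r ->
  (F (x%:C, L x%:C y%:C)).2 = conjc (F (y%:C, L x%:C y%:C)).2 /\
  normal_form (F (x%:C, L x%:C y%:C)).1 (conjc (F (y%:C, L x%:C y%:C)).1)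
    (F (x%:C, L x%:C y%:C)).2 = 0.
Proof.
move=> xr yr.
pose al (t : R) (b : C) : C := t%:C + 'i%C * b; pose be (t : R) (b : C) : C := t%:C - 'i%C * b.
have cal t b : conjc (al t b) = be t (conjc b).
  by rewrite /al /be conjcD conjcM conjc_real (_ : conjc 'i%C = - 'i%C) ?mulNr //; simpc.
have cbe t b : conjc (be t b) = al t (conjc b).
  by rewrite -[b in LHS]conjcK -cal conjcK.
pose m1 t b := (F (al t b, L (al t b) (be t b))).1.
pose m2 t b := (F (al t b, L (al t b) (be t b))).2.
have dm t b : normc (al t b) < r -> normc (be t b) < r ->
    (exists d, cdiff (m1 t) b d) /\ (exists d, cdiff (m2 t) b d).
  move=> ar br; have dal : cdiff (al t) b (0 + (0 * b + 'i%C * 1)).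
    by apply: cdiffD; [exact: cdiff_cst | apply: cdiffM; [exact: cdiff_cst | exact: cdiff_id]].
  have dbe : cdiff (be t) b (0 - (0 * b + 'i%C * 1)).
    by apply: cdiffB; [exact: cdiff_cst | apply: cdiffM; [exact: cdiff_cst | exact: cdiff_id]].
  have [p [q [e [f [d1 d2]]]]] := holo_pdiff (holF (rU ar br)).
  have [D1 D2] := path_cdiff ar br dal dbe d1 d2.
  by split; [exact: ex_intro D1 | exact: ex_intro D2].
have dmc t b : normc (al t b) < r -> normc (be t b) < r ->
    (exists d, cdiff (fun b => conjc (m1 t (conjc b)) : C) b d) /\
    (exists d, cdiff (fun b => conjc (m2 t (conjc b)) : C) b d).
  move=> ar br; have [||[d1 D1] [d2 D2]] := dm t (conjc b).
  - by rewrite -cbe normc_conj.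
  - by rewrite -cal normc_conj.
  by split; [exists (conjc d1); exact: cdiff_conj D1 | exists (conjc d2); exact: cdiff_conj D2].
pose K2 z w := (F (z, L z w)).2 - conjc (F (conjc w, L (conjc w) (conjc z))).2.
pose K1 z w := normal_form (F (z, L z w)).1 (conjc (F (conjc w, L (conjc w) (conjc z))).1)
   (F (z, L z w)).2.
have E1 : K1 x%:C y%:C = 0.
  apply: (totally_real_identity (r := r)) => // [t b tb tb'|z zr].
    have [[d1 D1] [d2 D2]] := dm t b tb tb'; have [[d3 D3] _] := dmc t b tb tb'.
    eexists; have := normal_form_cdiff D1 D3 D2; apply: cdiff_near; near=> u.
    by rewrite /K1 -/(al t u) -/(be t u) cal cbe.
  by rewrite /K1 conjcK; case: (mapped_conj_point zr).
have E2 : K2 x%:C y%:C = 0.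
  apply: (totally_real_identity (r := r)) => // [t b tb tb'|z zr].
    have [_ [d2 D2]] := dm t b tb tb'; have [_ [d3 D3]] := dmc t b tb tb'.
    eexists; have := cdiffB D2 D3; apply: cdiff_near; near=> u.
    by rewrite /K2 -/(al t u) -/(be t u) cal cbe.
  by rewrite /K2 conjcK; case: (mapped_conj_point zr) => -> _; rewrite subrr.
move: E1 E2; rewrite /K1 /K2 !conjc_real (level_funC _ _ y%:C) => E1 /eqP.
by rewrite subr_eq0 => /eqP E2.
Unshelve. all: by end_near.
Qed.

(** The hypothesis on [de] and [de'] says that the line [u -> (x + de u, y + de' u)] is tangent to
    the level. The derivative of [L] along it is therefore 0, and only the partial derivatives of
    [F] in its first variable survive. Differentiating [real_relations] along this line gives both
    conclusions. *)
Lemma real_derivatives (x y de de' : R) (t p q e f p' q' e' f' : C) :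
  40 * `|x| < r -> 40 * `|y| < r -> L x%:C y%:C = t ->
  pdiff (fun z => (F z).1) (x%:C, t) p q -> pdiff (fun z => (F z).2) (x%:C, t) e f ->
  pdiff (fun z => (F z).1) (y%:C, t) p' q' -> pdiff (fun z => (F z).2) (y%:C, t) e' f' ->
  ((1 + t) * y%:C + side_der g a x%:C) * de%:C +
  ((1 + t) * x%:C + side_der g a y%:C) * de'%:C = 0 ->
  let X := (F (x%:C, t)).1 in let Y := conjc (F (y%:C, t)).1 in let T := (F (x%:C, t)).2 in
  e * de%:C = conjc e' * de'%:C /\
  p * de%:C * Y + X * (conjc p' * de'%:C) +
    eps%:C * (s%:R * T ^+ s.-1 * (e * de%:C)) * (X ^+ 2 + Y ^+ 2) +
    (g%:C + eps%:C * T ^+ s) * (2 * X * (p * de%:C) + 2 * Y * (conjc p' * de'%:C))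
    - e * de%:C = 0.
Proof.
move=> xr yr Lt dp de_ dp' de'_ ND X Y T.
pose al (b : C) : C := x%:C + de%:C * b; pose be (b : C) : C := y%:C + de'%:C * b.
have al0 : al 0 = x%:C by rewrite /al mulr0 addr0.
have be0 : be 0 = y%:C by rewrite /be mulr0 addr0.
have dal : cdiff al 0 de%:C.
  apply: cdiff_eq_der (cdiffD (cdiff_cst (x%:C : C) 0) (cdiffM (cdiff_cst (de%:C : C) 0) (cdiff_id 0))).
  by ring.
have dbe : cdiff be 0 de'%:C.
  apply: cdiff_eq_der (cdiffD (cdiff_cst (y%:C : C) 0) (cdiffM (cdiff_cst (de'%:C : C) 0) (cdiff_id 0))).
  by ring.
have r0 : 0 < r by have := normr_ge0 x; move: xr; lra.
have ar : normc (al 0) < r by rewrite al0 normc_real; have := normr_ge0 x; move: xr; lra.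
have br : normc (be 0) < r by rewrite be0 normc_real; have := normr_ge0 y; move: yr; lra.
pose n1 b := (F (al b, L (al b) (be b))).1; pose n2 b := (F (al b, L (al b) (be b))).2.
pose k1 b := (F (be b, L (be b) (al b))).1; pose k2 b := (F (be b, L (be b) (al b))).2.
have [D1 D2] : cdiff n1 0 (p * de%:C) /\ cdiff n2 0 (e * de%:C).
  have := @path_cdiff al be 0 de%:C de'%:C p q e f ar br dal dbe.
  by rewrite !al0 !be0 Lt => /(_ dp de_) /=; rewrite ND mul0r !mulr0 !addr0.
have [D3 D4] : cdiff k1 0 (p' * de'%:C) /\ cdiff k2 0 (e' * de'%:C).
  have := @path_cdiff be al 0 de'%:C de%:C p' q' e' f' br ar dbe dal.
  by rewrite !al0 !be0 level_funC Lt => /(_ dp' de'_) /=; rewrite [X in X / _]addrC ND mul0r !mulr0 !addr0.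
have {}D3 : cdiff (fun b => conjc (k1 (conjc b)) : C) 0 (conjc p' * de'%:C).
  have := @cdiff_conj _ k1 0 (p' * de'%:C); rewrite conjc0 conjcM conjc_real; exact.
have {}D4 : cdiff (fun b => conjc (k2 (conjc b)) : C) 0 (conjc e' * de'%:C).
  have := @cdiff_conj _ k2 0 (e' * de'%:C); rewrite conjc0 conjcM conjc_real; exact.
pose M := `|de| + `|de'| + 1.
have M0 : 0 < M by rewrite ltr_wpDl// addr_ge0.
have rM : 0 < r / (40 * M) by rewrite divr_gt0// mulr_gt0.
have small (c z u : R) : 40 * `|z| < r -> `|c| <= M -> `|u| < r / (40 * M) -> 20 * `|z + c * u| < r.
  move=> zr cM; rewrite ltr_pdivlMr ?mulr_gt0// => ur.
  have := ler_normD z (c * u); rewrite normrM.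
  have := ler_pM (normr_ge0 c) (normr_ge0 u) cM (lexx _); move: zr ur; lra.
have deM : `|de| <= M by rewrite /M -addrA lerDl addr_ge0.
have deM' : `|de'| <= M by rewrite /M addrAC lerDr addr_ge0.
have rel (u : R) : `|u| < r / (40 * M) -> n2 u%:C = conjc (k2 u%:C) /\
    normal_form (n1 u%:C) (conjc (k1 u%:C)) (n2 u%:C) = 0.
  move=> ur; have := real_relations (small _ _ _ xr deM ur) (small _ _ _ yr deM' ur).
  by rewrite !(rmorphD, rmorphM) /= /n1 /n2 /k1 /k2 (level_funC g a (be _) (al _)).
have N1 : n1 0 = X by rewrite /n1 al0 be0 Lt.
have N2 : n2 0 = T by rewrite /n2 al0 be0 Lt.
have N3 : conjc (k1 (conjc 0)) = Y by rewrite /k1 conjc0 al0 be0 level_funC Lt.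
split.
  apply/eqP; rewrite -subr_eq0; apply/eqP.
  apply: (cdiff_real_eq0 rM (cdiffB D2 D4)) => u ur.
  by rewrite conjc_real; case: (rel u ur) => -> _; rewrite subrr.
have := normal_form_cdiff D1 D3 D2; rewrite N1 N2 N3 => D5.
apply: (cdiff_real_eq0 rM D5) => u ur.
by rewrite conjc_real; case: (rel u ur).
Qed.

(** Otherwise [F] would map the line [z.1 + b] with velocity 0, and so would [G] composed with [F],
    whose first component has derivative 1 there. *)
Lemma biholo_partials_nonzero (G : C * C -> C * C) (z : C * C) (q f : C) : U z ->
  (forall w, U w -> G (F w) = w) -> holo_at G (F z) ->
  ~ (pdiff (fun w => (F w).1) z 0 q /\ pdiff (fun w => (F w).2) z 0 f).
Proof.
move=> Uz GF holG [d1 d2].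
have [A [B [_ [_ [dG _]]]]] := holo_pdiff holG.
pose u (b : C) := (F (z.1 + b, z.2)).1; pose v (b : C) := (F (z.1 + b, z.2)).2.
have z0 : (z.1 + 0, z.2) = z by rewrite addr0; case: (z).
have dz : cdiff (fun b : C => z.1 + b) 0 1.
  by apply: cdiff_eq_der (cdiffD (cdiff_cst z.1 0) (cdiff_id 0)); rewrite add0r.
have du : cdiff u 0 0.
  apply: (@cdiff_eq_der _ _ _ (0 * 1 + q * 0)); first by rewrite mul0r mulr0 addr0.
  apply: (@pdiff_comp R (fun w => (F w).1) (fun b => z.1 + b) (fun=> z.2) 0) => //.
    by rewrite z0.
  exact: cdiff_cst.
have dv : cdiff v 0 0.
  apply: (@cdiff_eq_der _ _ _ (0 * 1 + f * 0)); first by rewrite mul0r mulr0 addr0.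
  apply: (@pdiff_comp R (fun w => (F w).2) (fun b => z.1 + b) (fun=> z.2) 0) => //.
    by rewrite z0.
  exact: cdiff_cst.
have dk : cdiff (fun b => (G (u b, v b)).1) 0 (A * 0 + B * 0).
  apply: (@pdiff_comp R (fun w => (G w).1) u v 0) => //.
  by rewrite /u /v z0 -surjective_pairing.
have nU : \forall w \near z, U w by exact: open_nbhs_nbhs.
have /near_CC2[r1 r10 H] := nU.
have := cdiff_real_eq0 r10 (cdiffB dk dz); rewrite !mulr0 addr0 sub0r => K0.
have /eqP : (-1 : C) = 0; last by rewrite oppr_eq0 oner_eq0.
apply: K0 => b br; rewrite /u /v -surjective_pairing GF ?subrr//.
by apply: H; rewrite /= ?subrr ?normc0// addrAC subrr add0r normc_real.
Qed.

(* By [real_relations] consecutive points of an orbit enter through [F] and its conjugate. *)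
Definition alternate_conj (i : nat) : {rmorphism C -> C} :=
  if odd i then (@conjc R : {rmorphism C -> C}) else idfun.

Lemma alternate_conjS i (u : C) : alternate_conj i (conjc u) = alternate_conj i.+1 u.
Proof. by rewrite /alternate_conj /=; case: (odd i) => //=; rewrite conjcK. Qed.

Lemma alternate_conj_real i (u : R) : alternate_conj i u%:C = u%:C.
Proof. by rewrite /alternate_conj; case: (odd i) => //; exact: conjc_real. Qed.

Lemma rmorph_linearized (h : {rmorphism C -> C}) (A B E X Y T c d : C) (n m : nat) :
  h (A * Y + X * B + c * (n%:R * T ^+ m * E) * (X ^+ 2 + Y ^+ 2) +
     (d + c * T ^+ n) * (2 * X * A + 2 * Y * B) - E) =
  h A * h Y + h X * h B + h c * (n%:R * h T ^+ m * h E) * (h X ^+ 2 + h Y ^+ 2) +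
     (h d + h c * h T ^+ n) * (2 * h X * h A + 2 * h Y * h B) - h E.
Proof. by rewrite !(rmorphXn, rmorphB, rmorphD, rmorphM, rmorph_nat) /=; ring. Qed.

(** A displacement tangent to the level is carried round the orbit and returns multiplied by [m],
    the multiplier, which is not 1. Its image in the second component, [W], is constant along the
    orbit and hence 0. With [W = 0] its image [Y] in the first component obeys the linearized
    recurrence of the normal form, is periodic, and hence also 0. So both partial derivatives of [F]
    in the first variable vanish at [pt 1]. *)
Lemma resonant_orbit_contradiction (G : C * C -> C * C) (t : R) (q : nat)
    (x : nat -> R) :
  2^-1 < g -> (eps = 0 \/ ((eps = 1 \/ eps = -1) /\ (0 < s)%N)) ->
  (forall z, U z -> G (F z) = z) -> (forall z, U z -> holo_at G (F z)) ->
  (forall z w : C, normc z < r -> normc w < r -> normc (F (z, L z w)).2 <= 2^-1) ->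
  (forall i, 40 * `|x i| < r) ->
  resonant_orbit g (fun s => complex.Re (pser a s%:C))
     (fun s => complex.Re (pser_der a s%:C)) t q x -> False.
Proof.
move=> g2 Heps GF holG F2 xr [[q0 oq per lev] [nd D0 ND]].
pose pt i : C * C := ((x i)%:C, t%:C).
pose N i := slope_fst g (fun s => complex.Re (pser_der a s%:C)) t (x i) (x i.+1).
pose D i := slope_fst g (fun s => complex.Re (pser_der a s%:C)) t (x i.+1) (x i).
have x20 i : 20 * `|x i| < r by have := xr i; have := normr_ge0 (x i); lra.
have xr1 i : normc (x i)%:C < r by rewrite normc_real; have := xr i; have := normr_ge0 (x i); lra.
have x4 i : `|x i| <= 4^-1 by rewrite -normc_real; exact: ltW (lt_le_trans (xr1 i) r4).
have Lt i : L (x i)%:C (x i.+1)%:C = t%:C by apply: level_fun_real.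
have ptU i : U (pt i) by rewrite /pt -(Lt i); apply: rU.
have partials z : exists d : (C * C) * (C * C), U z ->
    pdiff (fun w => (F w).1) z d.1.1 d.1.2 /\ pdiff (fun w => (F w).2) z d.2.1 d.2.2.
  have [Uz|] := pselect (U z); last by exists ((0, 0), (0, 0)).
  by have [p [q1 [e [f [? ?]]]]] := holo_pdiff (holF Uz); exists ((p, q1), (e, f)).
have [P HP] := choice partials.
pose cj := alternate_conj.
pose al i := cj i (F (pt i)).1; pose be i := cj i (F (pt i)).2.
(* The displacement of the point [x j.+1] when that of [x 1] is 1; hence the index [i.-1] in [Y] and
   [W]. *)
pose de j := \prod_(k < j) (- N k.+1 / D k.+1).
pose Y i := cj i (P (pt i)).1.1 * (de i.-1)%:C.
pose W i := cj i (P (pt i)).2.1 * (de i.-1)%:C.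
have ptq i : pt (i + q)%N = pt i by rewrite /pt per.
have cjq i u : cj (i + q)%N u = cj i u by rewrite /cj /alternate_conj oddD (negbTE oq) addbF.
have rel i := real_relations (x20 i) (x20 i.+1).
have beS i : be i.+1 = be i.
  by have [E _] := rel i; rewrite Lt in E; rewrite /be /cj -alternate_conjS -E.
have beE i : be i = be 0%N by elim: i => // i <-.
pose tau := be 0%N; pose Gc := g%:C + eps%:C * tau ^+ s.
have lvl i : al i * al i.+1 + Gc * (al i ^+ 2 + al i.+1 ^+ 2) = tau.
  have [_ E] := rel i; rewrite Lt in E; move: (congr1 (cj i) E).
  rewrite /normal_form rmorph0 !(rmorphB, rmorphD, rmorphM, rmorphXn) /=.
  rewrite /cj !alternate_conj_real alternate_conjS -/cj -/(al i) -/(al i.+1) -/(be i) beE.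
  by move/eqP; rewrite subr_eq0 => /eqP.
have der i : W i.+1 = W i.+2 /\ Y i.+1 * al i.+2 + al i.+1 * Y i.+2 +
    eps%:C * (s%:R * tau ^+ s.-1 * W i.+1) * (al i.+1 ^+ 2 + al i.+2 ^+ 2) +
    Gc * (2 * al i.+1 * Y i.+1 + 2 * al i.+2 * Y i.+2) - W i.+1 = 0.
  have [d1 d2] := HP _ (ptU i.+1); have [d3 d4] := HP _ (ptU i.+2).
  have := @real_derivatives (x i.+1) (x i.+2) (de i) (de i.+1) t%:C _ _ _ _ _ _ _ _
    (xr _) (xr _) (Lt _) d1 d2 d3 d4.
  have -> : (1 + t%:C) * (x i.+2)%:C + side_der g a (x i.+1)%:C = (N i.+1)%:C.
    by rewrite (side_der_real _ a_le1).
  have -> : (1 + t%:C) * (x i.+1)%:C + side_der g a (x i.+2)%:C = (D i.+1)%:C.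
    by rewrite (side_der_real _ a_le1).
  have -> : (N i.+1)%:C * (de i)%:C + (D i.+1)%:C * (de i.+1)%:C = 0.
    rewrite -!(rmorphM (real_complex R)) -(rmorphD (real_complex R)).
    rewrite /de big_ord_recr /= (_ : _ + _ = 0) ?rmorph0//.
    by field; exact: D0.
  move=> /(_ erefl) /= [E1 E2]; split.
    move: (congr1 (cj i.+1) E1); rewrite !rmorphM /= /cj !alternate_conj_real.
    by rewrite alternate_conjS.
  move: (congr1 (cj i.+1) E2).
  rewrite rmorph_linearized !(rmorphM (cj _)) rmorph0 /= /cj !alternate_conj_real !alternate_conjS -/cj.
  by rewrite -/(al i.+1) -/(al i.+2) -/(be i.+1) beE.
have cjI i : injective (cj i).
  by rewrite /cj /alternate_conj; case: (odd i) => // u v /(congr1 conjc); rewrite !conjcK.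
(* Since [tau] has modulus at most 1/2, [eps * tau ^+ s] has modulus at most 1/2 and cannot cancel
   [g > 1/2]. *)
have Gc0 : Gc != 0.
  apply/eqP => G0; have gE : normc (g%:C : C) = normc (eps%:C * tau ^+ s).
    by move/eqP: G0; rewrite /Gc addr_eq0 => /eqP ->; rewrite normcN.
  have g0 : `|g| = g by rewrite ger0_norm// ltW// (lt_trans _ g2)// invr_gt0.
  have tau2 : normc tau <= 2^-1.
    rewrite /tau /be /cj /alternate_conj /= /pt -(Lt 0%N); exact: F2.
  move: gE; rewrite normc_real g0 normcM normc_real normcX.
  case: Heps => [->|[He s0]].
    by rewrite normr0 mul0r => gE; move: g2; rewrite gE ltNge invr_ge0 ler0n.
  have -> : `|eps| = 1 by case: He => ->; rewrite ?normrN normr1.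
  rewrite mul1r => gE.
  have tau_s : normc tau ^+ s <= 2^-1.
    rewrite -(prednK s0) exprS -[leRHS]mulr1; apply: ler_pM; rewrite ?normc_ge0 ?exprn_ge0 ?normc_ge0//.
    rewrite exprn_ile1 ?normc_ge0// (le_trans tau2)// invf_le1 ?ler1n//.
  by move: g2; rewrite gE ltNge tau_s.
(* Points two steps apart carry the same conjugation and the same second image component, so
   injectivity of [F] transfers the absence of turning points. *)
have ndal i : al i.+2 != al i.
  apply/eqP; rewrite /al /cj -!alternate_conjS conjcK => /cjI F1E.
  have F2E : (F (pt i.+2)).2 = (F (pt i)).2.
    have : be i.+2 = be i by rewrite !beS.
    by rewrite /be /cj -!alternate_conjS conjcK => /cjI.
  have : F (pt i.+2) = F (pt i) by rewrite [LHS]surjective_pairing F1E F2E -surjective_pairing.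
  by move=> /(congr1 G); rewrite !GF// => -[/nd].
have peral i : al (i + q)%N = al i by rewrite /al ptq cjq.
pose m := de q.
(* The sign [(-1)^q] disappears as [q] is even, and shifting the index by one turns the quotient
   into that of the two products in [resonant_orbit]. *)
have m1 : m != 1.
  apply/eqP => mE; move/eqP: ND; apply.
  have rot (f : nat -> R) : f q = f 0%N -> \prod_(k < q) f k.+1 = \prod_(k < q) f k.
    move=> fq; case: (q) q0 fq => // n _ fq.
    by rewrite big_ord_recr big_ord_recl /= fq mulrC.
  have xq : x q = x 0%N by rewrite -(per 0%N).
  have xq1 : x q.+1 = x 1%N by rewrite -(per 1%N).
  rewrite -(rot N) ?/N ?xq ?xq1// -(rot D) ?/D ?xq ?xq1//.
  move: mE; rewrite /m /de prodf_div prodrN card_ord -signr_odd (negbTE oq) expr0 mul1r => mE.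
  transitivity (1 * \prod_(k < q) D k.+1); last by rewrite mul1r.
  by rewrite -[X in _ = X * _]mE mulfVK//; apply/prodf_neq0 => k _; exact: D0.
have Yq : Y (1 + q)%N = Y 1%N * m%:C.
  rewrite /Y ptq cjq /de big_ord0 mulr1 //.
have Wq : W (1 + q)%N = W 1%N * m%:C.
  by rewrite /W ptq cjq /de big_ord0 mulr1.
have m1' : m%:C - 1 != 0 :> C.
  by rewrite subr_eq0 -(rmorph1 (real_complex R)) (inj_eq (@complexI R)).
have fixed (u : C) : u = u * m%:C -> u = 0.
  move=> uE; apply: (mulIf m1'); rewrite mul0r mulrBr mulr1 -uE subrr //.
have W0 i : W i.+1 = W 1%N by elim: i => // i <-; case: (der i).
have {}W0 i : W i.+1 = 0 by rewrite W0; apply: fixed; rewrite -Wq W0.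
have Y0 : Y 1%N = 0.
  apply: fixed; rewrite -Yq; apply/esym; apply: (linearized_orbit_periodic Gc0 lvl ndal peral) => i.
  have [_ E] := der i; rewrite W0 in E; rewrite -[RHS]E; ring.
apply: (@biholo_partials_nonzero G (pt 1%N) (P (pt 1%N)).1.2 (P (pt 1%N)).2.2) => //.
  exact: holG.
have [d1 d2] := HP _ (ptU 1%N).
move: Y0 (W0 0%N); rewrite /Y /W /= /de !big_ord0 !mulr1 => Y0 W1.
have z1 : (P (pt 1%N)).1.1 = 0 by apply: (cjI 1%N); rewrite rmorph0.
have z2 : (P (pt 1%N)).2.1 = 0 by apply: (cjI 1%N); rewrite rmorph0.
by rewrite -{1}z1 -z2.
Qed.

End MappedSurface.

Theorem theorem1p3 (R : realType) (g : R) (hg : 1 / 2 < g)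
  (hne : ~ exceptional g) :
  exists c : nat -> nat -> CC R,
    conv_pseries2 c /\ order_ge3 c /\
    (exists (U : set (CC R * CC R)) (F : CC R * CC R -> CC R * CC R)
            (H : set (CC R * CC R)),
        biholo_on U F /\ real_hyperplane H /\
        (forall z, U z -> surfM g c z -> H (F z))) /\
    (forall (eps : R) (s : nat),
        (eps = 0 \/ ((eps = 1 \/ eps = -1) /\ (0 < s)%N)) ->
        ~ exists (U : set (CC R * CC R)) (F : CC R * CC R -> CC R * CC R),
            biholo_on U F /\ F (0, 0) = (0, 0) /\
            (forall z, U z -> (surfM g c z <-> surfN g eps s (F z)))).
Proof.
have g2 : 2^-1 < g by rewrite -div1r.
have [a [a1 a8 orbits]] := resonant_series_exists g2.
exists (surface_coef g a); split; first exact: surface_coef_conv.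
split; first exact: surface_coef_order.
split; first exact: surfM_hyperplane.
move=> eps s He [U [F [[oU [U0 [V [G [oV [FV [GV [GF [FG [hF hG]]]]]]]]]] [F0 FM]]]].
have [r /andP[r0 r4] H] := mapped_domain g a1 a8 oU U0 F0 hF.
have [|t [q [x [xe ro]]]] := orbits (r / 80); first by rewrite divr_gt0.
apply: (resonant_orbit_contradiction a1 a8 oU hF FM r4 _ g2 He GF _ _ _ ro).
- by move=> z w zr wr; case: (H z w zr wr).
- by move=> z Uz; apply/hG/FV.
- by move=> z w zr wr; case: (H z w zr wr).
- by move=> i; have := xe i; lra.
Qed.
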